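(* The geometric compactification $\Sigma\cup S_\infty(\Sigma)$ of $\Sigma$ is homeomorphic to the closed half disk $D=\{(u,v):u^2+v^2\le1,\ v\ge0\}$, with $S_\infty(\Sigma)$ corresponding to the boundary of $D$ (the segment $[-1,1]\times\{0\}$ together with the upper semicircle), in such a way that: (1) the asymptotic classes of geodesic rays whose points converge (in $\mathbb{R}^2$) to a point $(\xi,0)$, $\xi\in\mathbb{R}$, correspond homeomorphically to the points of $\{(u,0):-1<u<1\}$; (2) the class of the vertical rays $\{x=\text{const},\,y\to\infty\}$ corresponds to $(0,1)$; (3) the classes of geodesics given (up to translation in $x$) by $x=\pm\frac{1}{\sqrt3}(\cosh y-\cosh a)$, $y\to\infty$ ($a>0$), correspond to $(\pm1,0)$; (4) for $a>0$ and $m>\sqrt3/\sinh a$, the class of the geodesic $x=\pm(F(y)-F(a))$, $y\to\infty$, where $$F(y)=\frac{\sqrt{3+\sinh^2a}}{\sqrt{m^2\sinh^2a-3}}\log\Big\{(m^2\sinh^2a-3)\cosh y+\sqrt{m^2\sinh^2a-3}\,\sqrt{(m^2\sinh^2a-3)\cosh^2y+3\cosh^2a+2m^2\sinh^2a}\Big\},$$ corresponds to $(\cos\theta,\sin\theta)$, where $\theta\in(0,\pi/2)\cup(\pi/2,\pi)$ is determined by $\tan\theta=\pm\dfrac{\sqrt{m^2\sinh^2a-3}}{\sqrt{3+\sinh^2a}}$ (these geodesics are asymptotic to the Euclidean rays $y=x\tan\theta$).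
   Context: $\Sigma=\mathbb{R}\times(0,\infty)$ with the complete metric $ds^2=P(y)(dx^2+dy^2)$, $P(y)=\frac{e^{4y}+10e^{2y}+1}{4(e^{2y}-1)^2}$; it is a Cartan–Hadamard surface (simply connected, complete, negative curvature). $S_\infty(\Sigma)$ is its geometric boundary: the set of equivalence classes of unit speed geodesic rays, two rays being equivalent if their distance stays bounded, with the cone topology on $\Sigma\cup S_\infty(\Sigma)$. *)

(* Defs.v *)
From Stdlib Require Import Reals Lra.
Open Scope R_scope.

(* ---------- The surface Sigma = R x (0,oo), ds^2 = P(y)(dx^2+dy^2) ---------- *)

Definition P (y : R) : R :=
  (exp (4 * y) + 10 * exp (2 * y) + 1) / (4 * (exp (2 * y) - 1) ^ 2).

Definition in_Sigma (q : R * R) : Prop := 0 < snd q.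

(* A (complete, unit speed) geodesic of Sigma, parametrised by all of R, given
   in the coordinates (x,y).  Geodesic equations of the conformal metric
   P(y)(dx^2+dy^2):  x'' + (P'/P) x' y' = 0,  y'' + (P'/(2P)) (y'^2 - x'^2) = 0. *)
Definition geodesic (g : R -> R * R) : Prop :=
  exists (dP vx vy ax ay : R -> R),
    (forall y, 0 < y -> derivable_pt_lim P y (dP y)) /\
    forall t,
      0 < snd (g t) /\
      derivable_pt_lim (fun s => fst (g s)) t (vx t) /\
      derivable_pt_lim (fun s => snd (g s)) t (vy t) /\
      derivable_pt_lim vx t (ax t) /\
      derivable_pt_lim vy t (ay t) /\
      ax t + dP (snd (g t)) / P (snd (g t)) * vx t * vy t = 0 /\
      ay t + dP (snd (g t)) / (2 * P (snd (g t))) * (vy t ^ 2 - vx t ^ 2) = 0 /\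
      P (snd (g t)) * (vx t ^ 2 + vy t ^ 2) = 1.

(* The unit speed geodesic ray of g is its restriction to [0,oo). *)

Definition curve_len_le (q1 q2 : R * R) (L : R) : Prop :=
  exists (c : R -> R * R) (dc1 dc2 : R -> R),
    c 0 = q1 /\ c 1 = q2 /\
    (forall s, 0 <= s <= 1 ->
        0 < snd (c s) /\
        derivable_pt_lim (fun u => fst (c u)) s (dc1 s) /\
        derivable_pt_lim (fun u => snd (c u)) s (dc2 s) /\
        continuity_pt dc1 s /\ continuity_pt dc2 s) /\
    exists pr : Riemann_integrable
                  (fun s => sqrt (P (snd (c s)) * (dc1 s ^ 2 + dc2 s ^ 2))) 0 1,
      RiemannInt pr <= L.

Definition dist_le (q1 q2 : R * R) (r : R) : Prop :=
  forall e, 0 < e -> curve_len_le q1 q2 (r + e).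

Definition asymptotic (g1 g2 : R -> R * R) : Prop :=
  exists B, forall t, 0 <= t -> dist_le (g1 t) (g2 t) B.

(* Pt q : a point of Sigma;  Inf g : the asymptotic class of the ray of g. *)
Inductive cpt : Type :=
| Pt  : R * R -> cpt
| Inf : (R -> R * R) -> cpt.

Definition valid (z : cpt) : Prop :=
  match z with
  | Pt q => in_Sigma q
  | Inf g => geodesic g
  end.

(* equality in Sigma u S_oo(Sigma) *)
Definition same (z1 z2 : cpt) : Prop :=
  match z1, z2 with
  | Pt q1, Pt q2 => q1 = q2
  | Inf g1, Inf g2 => asymptotic g1 g2
  | _, _ => False
  end.

Definition is_inf (z : cpt) : Prop :=
  match z with Inf _ => True | Pt _ => False end.

(* ---------- cone topology (Eberlein-O'Neill), base point p0 = (0,1) ---------- *)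

Definition p0 : R * R := (0, 1).

(* Angle at p0 between tangent vectors v and w (the metric is conformal, so
   this is the Euclidean angle of the coordinate vectors). *)
Definition angle (v w : R * R) : R :=
  acos ((fst v * fst w + snd v * snd w) /
        (sqrt (fst v ^ 2 + snd v ^ 2) * sqrt (fst w ^ 2 + snd w ^ 2))).

Definition starts_in_cone (v : R * R) (eps : R) (sg : R -> R * R) : Prop :=
  geodesic sg /\ sg 0 = p0 /\
  exists w1 w2, derivable_pt_lim (fun s => fst (sg s)) 0 w1 /\
                derivable_pt_lim (fun s => snd (sg s)) 0 w2 /\
                angle v (w1, w2) < eps.

Definition in_trunc_cone (v : R * R) (eps Rad : R) (z : cpt) : Prop :=
  match z with
  | Pt q => ~ dist_le p0 q Rad /\
            exists sg T, 0 < T /\ sg T = q /\ starts_in_cone v eps sg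
  | Inf g => exists sg, asymptotic sg g /\ starts_in_cone v eps sg
  end.

(* Open sets of the cone topology: generated by the open subsets of Sigma and the
   truncated cones. *)
Definition cone_open (S : cpt -> Prop) : Prop :=
  forall z, valid z -> S z ->
    match z with
    | Pt q => exists r, 0 < r /\
        forall q', in_Sigma q' ->
          (fst q' - fst q) ^ 2 + (snd q' - snd q) ^ 2 < r ^ 2 -> S (Pt q')
    | Inf g => exists v eps Rad, v <> (0, 0) /\ 0 < eps /\ 0 < Rad /\
        in_trunc_cone v eps Rad z /\
        forall z', valid z' -> in_trunc_cone v eps Rad z' -> S z'
    end.

Definition inD (w : R * R) : Prop := fst w ^ 2 + snd w ^ 2 <= 1 /\ 0 <= snd w.

Definition bdD (w : R * R) : Prop :=
  (fst w ^ 2 + snd w ^ 2 = 1 /\ 0 <= snd w) \/ (snd w = 0 /\ -1 <= fst w <= 1).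

Definition open_in_D (V : R * R -> Prop) : Prop :=
  forall w, inD w -> V w -> exists r, 0 < r /\
    forall w', inD w' -> (fst w' - fst w) ^ 2 + (snd w' - snd w) ^ 2 < r ^ 2 -> V w'.

Definition conv_to (g : R -> R * R) (q : R * R) : Prop :=
  forall e, 0 < e -> exists T, forall t, T <= t ->
    Rabs (fst (g t) - fst q) < e /\ Rabs (snd (g t) - snd q) < e.

Definition y_to_infty (g : R -> R * R) : Prop :=
  forall M, exists T, forall t, T <= t -> M < snd (g t).

Definition eventually_on (g : R -> R * R) (x0 : R) (f : R -> R) : Prop :=
  exists T, forall t, T <= t -> fst (g t) = x0 + f (snd (g t)).

Definition Fm (a m y : R) : R :=
  sqrt (3 + sinh a ^ 2) / sqrt (m ^ 2 * sinh a ^ 2 - 3) *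
  ln ((m ^ 2 * sinh a ^ 2 - 3) * cosh y +
      sqrt (m ^ 2 * sinh a ^ 2 - 3) *
      sqrt ((m ^ 2 * sinh a ^ 2 - 3) * cosh y ^ 2 + 3 * cosh a ^ 2
            + 2 * m ^ 2 * sinh a ^ 2)).

(* Main.v *)
Require Import Defs.
From Stdlib Require Import Reals Lra Lia Psatz ClassicalEpsilon.
From Coquelicot Require Import Coquelicot.
Open Scope R_scope.

(** In the coordinates [x] and [u = cosh y], with Clairaut constant [c] and the parameter [s]
    given by [ds/dt = 2 (u^2 - 1) / (u^2 + 2)], the geodesics are [x = x0 + 2 c s],
    [u'' = (1 - 4 c^2) u], and the arc length is an elementary function of [s], [u], [u'].
    Hence a ray either has [1 - 4 c^2 >= 0] and goes up, with direction tending to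
    [(2 c, sqrt (1 - 4 c^2))], or it goes down and reaches the line [y = 0] at a point [xi].
    The compactification is that of the closed Euclidean half plane by directions,
    [(x, y) |-> (x, y) / sqrt (1 + x^2 + y^2)], and a ray is sent to the limit of its points.

    Rays with different ends diverge, because half the Euclidean coordinates and half the
    hyperbolic Busemann functions are 1-Lipschitz for the metric; rays with the same end are
    joined by straight segments of bounded length. Continuity on truncated cones comes from
    Gronwall's inequality at a fixed time followed by trapping near the end. The inverse is
    continuous by compactness of the circle of directions at [p0], once every point is known to lie
    on a ray from [p0] (a boundary value problem for [u]) and the end of a ray from [p0] is known to
    determine its direction (Sturm comparison). *)

(** * Calculus and hyperbolic functions *)

(** After cancellation [P y = 1/4 + 3 / (4 sinh y ^ 2)]. High up, lengths are half the Euclidean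
    ones, so unit speed is nearly Euclidean speed 2 and ends are directions; near [y = 0] lengths
    are [sqrt 3 / 2] times the hyperbolic ones and ends are points of the line. The same 3 is the
    constant of the energy law [p ^ 2 = 3 + lam c * (u ^ 2 - 1)] for [p = du/ds]; hence
    [p = - sqrt 3] where a ray runs into [u = 1], and [p = sqrt 3] on a rising critical ray. The
    delicate ends are the corners [(1, 0)] and [(-1, 0)], reached when [4 c ^ 2 = 1] and [u] is
    affine in [s]. Directions next to such a ray either rise with small slope or fall towards a
    remote [xi], and the constants of the linear asymptotics blow up there. A bound on the slope
    [dy/dx] that holds for both kinds takes their place. The constant [c] alone does not fix a
    direction at [p0], since the energy leaves the sign of [p 0] open; directions are therefore
    carried by the pair [(2 c sinh 1, p 0)], which runs over a circle. *)

Lemma derive_le (f df : R -> R) a b :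
  (forall t : R, a <= t <= b -> is_derive f t (df t)) ->
  (forall t, a <= t <= b -> 0 <= df t) -> a <= b -> f a <= f b.
Proof.
  intros Hd Hp Hab.
  destruct (MVT_gen f a b df) as [c [Hc E]].
  - intros x Hx. apply Hd. rewrite Rmin_left, Rmax_right in Hx; lra.
  - intros x Hx. rewrite Rmin_left, Rmax_right in Hx by lra.
    apply continuity_pt_filterlim, (ex_derive_continuous f x). exists (df x). apply Hd; lra.
  - rewrite Rmin_left, Rmax_right in Hc by lra.
    pose proof (Hp c ltac:(lra)). nra.
Qed.

Lemma derive_lt (f df : R -> R) a b :
  (forall t : R, a <= t <= b -> is_derive f t (df t)) ->
  (forall t, a <= t <= b -> 0 < df t) -> a < b -> f a < f b.
Proof.
  intros Hd Hp Hab.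
  destruct (MVT_gen f a b df) as [c [Hc E]].
  - intros x Hx. apply Hd. rewrite Rmin_left, Rmax_right in Hx; lra.
  - intros x Hx. rewrite Rmin_left, Rmax_right in Hx by lra.
    apply continuity_pt_filterlim, (ex_derive_continuous f x). exists (df x). apply Hd; lra.
  - rewrite Rmin_left, Rmax_right in Hc by lra.
    pose proof (Hp c ltac:(lra)). nra.
Qed.

Lemma derive_0_const (f df : R -> R) : (forall t : R, is_derive f t (df t)) -> (forall t, df t = 0) ->
  forall a b, f a = f b.
Proof.
  intros Hd Hz.
  assert (L : forall a b, a <= b -> f a = f b).
  { intros a b Hab. apply Rle_antisym.
    - apply (derive_le f df); auto. intros t _. rewrite Hz; lra.
    - apply Ropp_le_cancel. apply (derive_le (fun t => - f t) (fun t => - df t)); auto.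
      + intros t _. apply (is_derive_opp f t), Hd.
      + intros t _. rewrite Hz; lra. }
  intros a b. destruct (Rle_dec a b); [|symmetry]; apply L; lra.
Qed.

Lemma is_derive_eq (f : R -> R) (x l l' : R) : is_derive f x l -> l = l' -> is_derive f x l'.
Proof. intros H <-. exact H. Qed.

Lemma cosh_sq y : cosh y ^ 2 = 1 + sinh y ^ 2.
Proof.
  unfold cosh, sinh. assert (exp y * exp (- y) = 1).
  { rewrite <- exp_plus, Rplus_opp_r. apply exp_0. }
  nra.
Qed.

Lemma sinh_pos y : 0 < y -> 0 < sinh y.
Proof. intros H. rewrite <- sinh_0. apply sinh_lt, H. Qed.

Lemma cosh_ge_1 y : 1 <= cosh y.
Proof.
  unfold cosh. assert (exp y * exp (- y) = 1).
  { rewrite <- exp_plus, Rplus_opp_r. apply exp_0. }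
  pose proof (exp_pos y). pose proof (exp_pos (- y)).
  pose proof (pow2_ge_0 (exp y - exp (- y))). apply Rnot_lt_le. intros H3. nra.
Qed.

Lemma cosh_gt_1 y : 0 < y -> 1 < cosh y.
Proof.
  intros H. pose proof (sinh_pos y H). pose proof (cosh_sq y). pose proof (cosh_ge_1 y). nra.
Qed.

Lemma is_derive_cosh y : is_derive cosh y (sinh y).
Proof. apply is_derive_Reals, derivable_pt_lim_cosh. Qed.

Lemma is_derive_sinh y : is_derive sinh y (cosh y).
Proof. apply is_derive_Reals, derivable_pt_lim_sinh. Qed.

Lemma cosh_lt a b : 0 <= a -> a < b -> cosh a < cosh b.
Proof.
  intros Ha Hab. pose proof (sinh_lt a b Hab).
  assert (0 <= sinh a). { destruct Ha as [Ha|<-]; [left; now apply sinh_pos|rewrite sinh_0; lra]. }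
  pose proof (cosh_sq a). pose proof (cosh_sq b). pose proof (cosh_ge_1 a).
  pose proof (cosh_ge_1 b). nra.
Qed.

Lemma cosh_le a b : 0 <= a -> a <= b -> cosh a <= cosh b.
Proof. intros Ha [H| ->]; [left; now apply cosh_lt|lra]. Qed.

Lemma cosh_lt_inv a b : 0 <= b -> cosh a < cosh b -> a < b.
Proof.
  intros Hb H. destruct (Rlt_dec a b) as [|n]; auto.
  pose proof (cosh_le b a Hb ltac:(lra)). lra.
Qed.

Definition acosh (u : R) : R := ln (u + sqrt (u ^ 2 - 1)).

Lemma acosh_arg u : 1 <= u -> 1 <= u + sqrt (u ^ 2 - 1).
Proof. intros H. pose proof (sqrt_pos (u ^ 2 - 1)). lra. Qed.

Lemma acosh_exp_inv u : 1 <= u -> exp (- acosh u) = u - sqrt (u ^ 2 - 1).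
Proof.
  intros H. unfold acosh. pose proof (acosh_arg u H).
  rewrite exp_Ropp, exp_ln by lra.
  assert (sqrt (u ^ 2 - 1) ^ 2 = u ^ 2 - 1). { apply pow2_sqrt. nra. }
  apply (Rmult_eq_reg_l (u + sqrt (u ^ 2 - 1))); [|lra].
  rewrite Rinv_r by lra. nra.
Qed.

Lemma cosh_acosh u : 1 <= u -> cosh (acosh u) = u.
Proof.
  intros H. unfold cosh. rewrite acosh_exp_inv by auto. unfold acosh.
  pose proof (acosh_arg u H). rewrite exp_ln by lra. field.
Qed.

Lemma sinh_acosh u : 1 <= u -> sinh (acosh u) = sqrt (u ^ 2 - 1).
Proof.
  intros H. unfold sinh. rewrite acosh_exp_inv by auto. unfold acosh.
  pose proof (acosh_arg u H). rewrite exp_ln by lra. field.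
Qed.

Lemma acosh_pos u : 1 < u -> 0 < acosh u.
Proof.
  intros H. unfold acosh. rewrite <- ln_1. apply ln_increasing; [lra|].
  pose proof (sqrt_pos (u ^ 2 - 1)). lra.
Qed.

Lemma acosh_cosh y : 0 < y -> acosh (cosh y) = y.
Proof.
  intros H. unfold acosh. rewrite cosh_sq.
  replace (1 + sinh y ^ 2 - 1) with (sinh y ^ 2) by ring.
  rewrite sqrt_pow2 by (left; now apply sinh_pos).
  rewrite <- (ln_exp y) at 3. f_equal. unfold cosh, sinh. field.
Qed.

Lemma cosh_inj a b : 0 < a -> 0 < b -> cosh a = cosh b -> a = b.
Proof. intros Ha Hb H. rewrite <- (acosh_cosh a), <- (acosh_cosh b), H; auto. Qed.

Lemma is_derive_acosh u : 1 < u -> is_derive acosh u (/ sqrt (u ^ 2 - 1)).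
Proof.
  intros H. unfold acosh.
  assert (0 < u ^ 2 - 1) by nra. pose proof (sqrt_lt_R0 _ H0).
  auto_derive; simpl in *; repeat split; try nra.
  replace (u * (u * 1) + - (1)) with (u * (u * 1) - 1) by ring. lra.
  replace (u * (u * 1) + - (1)) with (u * (u * 1) - 1) by ring.
  field. lra.
Qed.

(** A factor [exp (2 y)] cancels: the numerator is [exp (2 y) (4 sinh y ^ 2 + 12)] and [(exp (2 y) -
    1) ^ 2 = 4 exp (2 y) sinh y ^ 2]. *)
Lemma P_sinh y : 0 < y -> P y = (3 + sinh y ^ 2) / (4 * sinh y ^ 2).
Proof.
  intros H. pose proof (sinh_pos y H) as Hs. unfold P, sinh in *.
  assert (E : exp y * exp (- y) = 1). { rewrite <- exp_plus, Rplus_opp_r. apply exp_0. }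
  assert (E2 : exp (2 * y) = exp y ^ 2). { replace (2 * y) with (y + y) by ring. rewrite exp_plus; ring. }
  assert (E4 : exp (4 * y) = exp y ^ 4). { replace (4 * y) with (y + y + y + y) by ring. rewrite !exp_plus; ring. }
  rewrite E2, E4. pose proof (exp_pos y). pose proof (exp_pos (- y)).
  assert (E' : exp (- y) = / exp y). { apply exp_Ropp. }
  rewrite E' in *. set (a := exp y) in *. clearbody a.
  assert (Ha : 1 < a). { destruct (Rlt_dec 1 a); auto. assert (1 <= / a); [|nra].
    apply (Rmult_le_reg_l a); [lra|]. rewrite E. lra. }
  field. repeat split; nra.
Qed.

Lemma is_derive_P y : 0 < y -> is_derive P y (- (3 / 2) * cosh y / sinh y ^ 3).
Proof.
  intros H. apply is_derive_ext_loc with (f := fun y => (3 + sinh y ^ 2) / (4 * sinh y ^ 2)).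
  - exists (mkposreal y H). intros z Hz. unfold ball in Hz; simpl in Hz.
    unfold AbsRing_ball, abs, minus, plus, opp in Hz; simpl in Hz.
    symmetry. apply P_sinh. apply Rabs_def2 in Hz. lra.
  - pose proof (sinh_pos y H). auto_derive.
    + intro E. nra.
    + field. lra.
Qed.

(** * Geodesics as a first order system *)

(* [ds/dt] as a function of [u = cosh y]. *)
Definition srate (u : R) : R := 2 * (u ^ 2 - 1) / (u ^ 2 + 2).

Definition lam (c : R) : R := 1 - 4 * c ^ 2.

(* [p] is [du/ds]; the last clause is the unit speed condition. *)
Definition flow (c : R) (x u p : R -> R) : Prop :=
  forall t, 1 < u t /\
    is_derive x t (2 * c * srate (u t)) /\
    is_derive u t (p t * srate (u t)) /\
    is_derive p t (lam c * u t * srate (u t)) /\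
    p t ^ 2 = 3 + lam c * (u t ^ 2 - 1).

Lemma srate_pos u : 1 < u -> 0 < srate u.
Proof. intros H. unfold srate. apply Rdiv_lt_0_compat; nra. Qed.

Lemma srate_lt_2 u : srate u < 2.
Proof.
  unfold srate. apply (Rmult_lt_reg_r (u ^ 2 + 2)); [nra|].
  unfold Rdiv. rewrite Rmult_assoc, Rinv_l by nra. nra.
Qed.

Lemma srate_le a b : 1 < a -> a <= b -> srate a <= srate b.
Proof.
  intros Ha Hab. unfold srate.
  replace (2 * (a ^ 2 - 1) / (a ^ 2 + 2)) with (2 - 6 / (a ^ 2 + 2)) by (field; nra).
  replace (2 * (b ^ 2 - 1) / (b ^ 2 + 2)) with (2 - 6 / (b ^ 2 + 2)) by (field; nra).
  assert (/ (b ^ 2 + 2) <= / (a ^ 2 + 2)). { apply Rinv_le_contravar; nra. }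
  unfold Rdiv. lra.
Qed.

(** In the new variables [srate (cosh y)] is [1 / (2 P y)], which is what turns the geodesic
    equations into a linear system up to a change of time. *)
Lemma geodesic_flow g : geodesic g -> exists c p,
  flow c (fun t => fst (g t)) (fun t => cosh (snd (g t))) p /\
  forall t, 0 < snd (g t) /\
    is_derive (fun t => snd (g t)) t (p t * srate (cosh (snd (g t))) / sinh (snd (g t))).
Proof.
  intros (dP & vx & vy & ax & ay & HP & H).
  assert (EP : forall y, 0 < y -> dP y = - (3 / 2) * cosh y / sinh y ^ 3).
  { intros y Hy. rewrite <- (is_derive_unique P y _ (is_derive_P y Hy)). symmetry.
    apply is_derive_unique, is_derive_Reals, HP, Hy. }
  set (y := fun t => snd (g t)). set (x := fun t => fst (g t)).
  assert (Hy : forall t, 0 < y t) by (intro; apply H).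
  assert (Dx : forall t : R, is_derive x t (vx t)) by (intro; apply is_derive_Reals, H).
  assert (Dy : forall t : R, is_derive y t (vy t)) by (intro; apply is_derive_Reals, H).
  assert (Dvx : forall t : R, is_derive vx t (ax t)) by (intro; apply is_derive_Reals, H).
  assert (Dvy : forall t : R, is_derive vy t (ay t)) by (intro; apply is_derive_Reals, H).
  assert (DP : forall t : R, is_derive (fun t => P (y t)) t (vy t * dP (y t))).
  { intro t. apply (is_derive_comp P y t (dP (y t)) (vy t)); auto.
    apply is_derive_Reals, HP, Hy. }
  assert (PP : forall t, 0 < P (y t)).
  { intro t. rewrite P_sinh by auto. pose proof (sinh_pos _ (Hy t)). apply Rdiv_lt_0_compat; nra. }
  (* Clairaut's integral for the translations in [x]: the first geodesic equation says that [P * vx]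
     has derivative zero. *)
  assert (Ec : forall t, P (y t) * vx t = P (y 0) * vx 0).
  { intro t. apply (derive_0_const (fun t => P (y t) * vx t)
      (fun t => vy t * dP (y t) * vx t + P (y t) * ax t)).
    - intro r. apply (is_derive_mult (fun t => P (y t)) vx r); auto. intros; apply Rmult_comm.
    - intro r. cbv beta. destruct (H r) as (_ & _ & _ & _ & _ & E & _). fold (y r) in E.
      pose proof (PP r). assert (ax r = - (dP (y r) / P (y r) * vx r * vy r)) as -> by lra.
      field. lra. }
  set (c := P (y 0) * vx 0) in *.
  assert (Evx : forall t, vx t = 2 * c * srate (cosh (y t))).
  { intro t. pose proof (PP t). assert (vx t = c / P (y t)) as ->.
    { rewrite <- (Ec t). field. lra. }
    rewrite P_sinh by auto. unfold srate. rewrite cosh_sq.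
    pose proof (sinh_pos _ (Hy t)). field. split; nra. }
  (* This is [du/ds]: [u' = sinh y * y'], divided by [ds/dt = 1 / (2 P)]. *)
  set (p := fun t => 2 * sinh (y t) * P (y t) * vy t).
  assert (Evy : forall t, vy t = p t * srate (cosh (y t)) / sinh (y t)).
  { intro t. unfold p. rewrite P_sinh by auto. unfold srate. rewrite cosh_sq.
    pose proof (sinh_pos _ (Hy t)). field. split; nra. }
  assert (En : forall t, P (y t) * vy t ^ 2 = 1 - c ^ 2 / P (y t)).
  { intro t. destruct (H t) as (_ & _ & _ & _ & _ & _ & _ & E). fold (y t) in E.
    rewrite <- (Ec t). pose proof (PP t).
    replace ((P (y t) * vx t) ^ 2 / P (y t)) with (P (y t) * vx t ^ 2) by (field; lra). lra. }
  exists c, p. split.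
  - intro t. fold (x t) (y t). pose proof (sinh_pos _ (Hy t)) as Hs. split; [|split; [|split; [|split]]].
    + now apply cosh_gt_1.
    + rewrite <- Evx. apply Dx.
    + apply is_derive_eq with (vy t * sinh (y t)).
      * apply (is_derive_comp cosh y); auto. apply is_derive_cosh.
      * rewrite Evy. field. lra.
    + apply is_derive_eq with ((2 * (vy t * cosh (y t)) * P (y t) +
          2 * sinh (y t) * (vy t * dP (y t))) * vy t + 2 * sinh (y t) * P (y t) * ay t).
      * apply (is_derive_mult (fun t => 2 * sinh (y t) * P (y t)) vy t);
          [|auto|intros; apply Rmult_comm].
        apply (is_derive_mult (fun t => 2 * sinh (y t)) (fun t => P (y t)) t);
          [|auto|intros; apply Rmult_comm].
        apply (is_derive_scal (fun t => sinh (y t)) t 2).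
        apply (is_derive_comp sinh y); auto. apply is_derive_sinh.
      * destruct (H t) as (_ & _ & _ & _ & _ & _ & E & N). fold (y t) in E, N.
        pose proof (PP t).
        assert (ay t = - (dP (y t) / (2 * P (y t)) * (vy t ^ 2 - vx t ^ 2))) as -> by lra.
        (* Regrouped so that the velocities enter only through [P * vy ^ 2] and the full squared
           speed, both of which are functions of [y] by unit speed and Clairaut. *)
        assert (EQ : (2 * (vy t * cosh (y t)) * P (y t) + 2 * sinh (y t) * (vy t * dP (y t))) * vy t +
          2 * sinh (y t) * P (y t) * - (dP (y t) / (2 * P (y t)) * (vy t ^ 2 - vx t ^ 2)) =
          2 * cosh (y t) * (P (y t) * vy t ^ 2) +
          sinh (y t) * dP (y t) / P (y t) * (P (y t) * (vx t ^ 2 + vy t ^ 2))).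
        { field. lra. }
        rewrite EQ, N, En, EP, P_sinh by auto. unfold srate, lam. rewrite cosh_sq.
        field. split; nra.
    + unfold p. replace ((2 * sinh (y t) * P (y t) * vy t) ^ 2) with
        (4 * sinh (y t) ^ 2 * P (y t) * (P (y t) * vy t ^ 2)) by ring.
      rewrite En, P_sinh by auto. unfold lam. rewrite cosh_sq. field. split; nra.
  - intro t. split; [apply Hy|]. fold (y t). rewrite <- Evy. apply Dy.
Qed.

Lemma flow_geodesic c x u p : flow c x u p -> geodesic (fun t => (x t, acosh (u t))).
Proof.
  intros H.
  assert (Dsig : forall t : R, is_derive (fun t => srate (u t)) t
     (12 * u t / (u t ^ 2 + 2) ^ 2 * (p t * srate (u t)))).
  { intro t. destruct (H t) as (H1 & _ & Du & _).
    apply is_derive_eq with ((p t * srate (u t)) * (12 * u t / (u t ^ 2 + 2) ^ 2)).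
    - apply (is_derive_comp srate u t); auto. unfold srate. auto_derive. nra. field. nra.
    - ring. }
  assert (Dr : forall t : R, is_derive (fun t => / sqrt (u t ^ 2 - 1)) t
     (- (u t * (p t * srate (u t))) / (sqrt (u t ^ 2 - 1) ^ 3))).
  { intro t. destruct (H t) as (H1 & _ & Du & _). assert (0 < u t ^ 2 - 1) by nra.
    pose proof (sqrt_lt_R0 _ H0).
    apply is_derive_eq with ((p t * srate (u t)) * (- u t / (sqrt (u t ^ 2 - 1) ^ 3))).
    - apply (is_derive_comp (fun u => / sqrt (u ^ 2 - 1)) u t); auto.
      auto_derive; simpl in *; replace (u t * (u t * 1) + - (1)) with (u t * (u t * 1) - 1) by ring.
      + repeat split; lra.
      + field. lra.
    - field. lra. }
  exists (fun y => - (3 / 2) * cosh y / sinh y ^ 3), (fun t => 2 * c * srate (u t)),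
    (fun t => p t * srate (u t) / sqrt (u t ^ 2 - 1)),
    (fun t => 2 * c * (12 * u t / (u t ^ 2 + 2) ^ 2 * (p t * srate (u t)))),
    (fun t => (lam c * u t * srate (u t) * srate (u t) +
               p t * (12 * u t / (u t ^ 2 + 2) ^ 2 * (p t * srate (u t)))) * / sqrt (u t ^ 2 - 1) +
              p t * srate (u t) * (- (u t * (p t * srate (u t))) / (sqrt (u t ^ 2 - 1) ^ 3))).
  split.
  { intros y Hy. apply is_derive_Reals, is_derive_P, Hy. }
  intro t. destruct (H t) as (H1 & Dx & Du & Dp & E). cbn [fst snd].
  assert (Hy : 0 < acosh (u t)) by now apply acosh_pos.
  assert (H0 : 0 < u t ^ 2 - 1) by nra. pose proof (sqrt_lt_R0 _ H0) as Hq.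
  assert (Q2 : sqrt (u t ^ 2 - 1) ^ 2 = u t ^ 2 - 1) by (apply pow2_sqrt; lra).
  rewrite (P_sinh _ Hy), sinh_acosh, cosh_acosh by lra.
  split; [auto|]. split; [now apply is_derive_Reals|]. split.
  { apply is_derive_Reals. apply (is_derive_comp acosh u t); auto. now apply is_derive_acosh. }
  split. { apply is_derive_Reals. apply (is_derive_scal (fun t => srate (u t)) t (2 * c)), Dsig. }
  split.
  { apply is_derive_Reals.
    apply (is_derive_mult (fun t => p t * srate (u t)) (fun t => / sqrt (u t ^ 2 - 1)) t);
      [|auto|intros; apply Rmult_comm].
    apply (is_derive_mult p (fun t => srate (u t)) t); [auto|auto|intros; apply Rmult_comm]. }
  unfold srate. set (q := sqrt (u t ^ 2 - 1)) in *. clearbody q.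
  assert (Q2' : u t ^ 2 = 1 + q ^ 2) by lra. rewrite Q2' in *.
  assert (Ec : c ^ 2 = (1 - lam c) / 4) by (unfold lam; field).
  set (l := lam c) in *. clearbody l. set (pp := p t) in *. clearbody pp. clear - Hq E Ec.
  set (uu := u t). clearbody uu. replace (1 + q ^ 2 - 1) with (q ^ 2) in * by ring.
  split; [|split].
  - field. repeat split; nra.
  - replace l with (1 - 4 * c ^ 2) in * by lra.
    (* The second geodesic equation is an explicit multiple of the defect in the energy law. *)
    transitivity (4 * uu * q ^ 3 / (3 + q ^ 2) ^ 3 * (3 + (1 - 4 * c ^ 2) * q ^ 2 - pp ^ 2)).
    + field. repeat split; nra.
    + rewrite E. ring.
  - transitivity ((4 * c ^ 2 * q ^ 2 + pp ^ 2) / (3 + q ^ 2)).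
    + field. repeat split; nra.
    + rewrite E, Ec. field. nra.
Qed.

(** * Long time behaviour of the system *)

Lemma derive_continuity (f df : R -> R) : (forall t : R, is_derive f t (df t)) -> continuity f.
Proof.
  intros H t. apply continuity_pt_filterlim, (ex_derive_continuous f t). now exists (df t).
Qed.

Lemma continuity_at (f : R -> R) m : continuity f -> forall e, 0 < e ->
  exists d, 0 < d /\ forall r, Rabs (r - m) < d -> Rabs (f r - f m) < e.
Proof.
  intros C e He. destruct (C m e He) as [d [Hd Hc]]. exists d. split; auto. intros r Hr.
  destruct (Req_dec r m) as [->|N]; [rewrite Rminus_eq_0, Rabs_R0; auto|].
  apply (Hc r). split; [split; [exact I|auto]|exact Hr].
Qed.

Lemma nonzero_keeps_neg (f : R -> R) a b : continuity f ->
  (forall t, Rmin a b <= t <= Rmax a b -> f t <> 0) -> f a < 0 -> f b < 0.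
Proof.
  intros Hc Hz Ha. destruct (Rlt_dec (f b) 0) as [|n]; auto.
  destruct (IVT_gen f a b 0 Hc) as [z [Hz1 Hz2]].
  - rewrite Rmin_left, Rmax_right by lra. lra.
  - now apply Hz in Hz1.
Qed.

Lemma nonzero_keeps_pos (f : R -> R) a b : continuity f ->
  (forall t, Rmin a b <= t <= Rmax a b -> f t <> 0) -> 0 < f a -> 0 < f b.
Proof.
  intros Hc Hz Ha. destruct (Rlt_dec 0 (f b)) as [|n]; auto.
  destruct (IVT_gen f a b 0 Hc) as [z [Hz1 Hz2]].
  - rewrite Rmin_right, Rmax_left by lra. lra.
  - now apply Hz in Hz1.
Qed.

Lemma is_derive_ln_comp (f : R -> R) (t df : R) : 0 < f t -> is_derive f t df ->
  is_derive (fun t => ln (f t)) t (df / f t).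
Proof.
  intros H D. apply is_derive_eq with (/ f t * df); [|unfold Rdiv; ring].
  apply is_derive_Reals, (derivable_pt_lim_comp f ln).
  - now apply is_derive_Reals.
  - apply derivable_pt_lim_ln, H.
Qed.

Lemma is_derive_const_R (k t : R) : is_derive (fun _ : R => k) t 0.
Proof. apply (is_derive_const k t). Qed.

Lemma is_derive_id_R (t : R) : is_derive (fun t : R => t) t 1.
Proof. apply (is_derive_id t). Qed.

Lemma is_derive_plus_R (f g : R -> R) (t df dg : R) : is_derive f t df -> is_derive g t dg ->
  is_derive (fun t => f t + g t) t (df + dg).
Proof. apply (is_derive_plus f g). Qed.

Lemma is_derive_minus_R (f g : R -> R) (t df dg : R) : is_derive f t df -> is_derive g t dg ->
  is_derive (fun t => f t - g t) t (df - dg).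
Proof. apply (is_derive_minus f g). Qed.

Lemma is_derive_scal_R (f : R -> R) (k t df : R) : is_derive f t df ->
  is_derive (fun t => k * f t) t (k * df).
Proof. apply (is_derive_scal f). Qed.

Lemma is_derive_mult_R (f g : R -> R) (t df dg : R) : is_derive f t df -> is_derive g t dg ->
  is_derive (fun t => f t * g t) t (df * g t + f t * dg).
Proof. intros. apply (is_derive_mult f g); auto. intros; apply Rmult_comm. Qed.

Lemma sqrt3_sq : sqrt 3 * sqrt 3 = 3.
Proof. apply sqrt_sqrt. lra. Qed.

Lemma sqrt3_pos : 0 < sqrt 3.
Proof. apply sqrt_lt_R0. lra. Qed.

Lemma sqrt3_bounds : 1 < sqrt 3 < 2.
Proof. pose proof sqrt3_sq. pose proof sqrt3_pos. split; nra. Qed.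

Lemma flow_gt1 c x u p : flow c x u p -> forall t, 1 < u t.
Proof. intros H t. apply H. Qed.

Lemma flow_x c x u p : flow c x u p -> forall t : R, is_derive x t (2 * c * srate (u t)).
Proof. intros H t. apply H. Qed.

Lemma flow_u c x u p : flow c x u p -> forall t : R, is_derive u t (p t * srate (u t)).
Proof. intros H t. apply H. Qed.

Lemma flow_p c x u p : flow c x u p -> forall t : R, is_derive p t (lam c * u t * srate (u t)).
Proof. intros H t. apply H. Qed.

Lemma flow_energy c x u p : flow c x u p -> forall t, p t ^ 2 = 3 + lam c * (u t ^ 2 - 1).
Proof. intros H t. apply H. Qed.

Lemma lam_le_1 c : lam c <= 1.
Proof. unfold lam. nra. Qed.

(** A difference of squares evaluated by the energy law, with [lam c <= 1]. It makes both logarithms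
    of [lag] meaningful and turns their product into a function of [u]. *)
Lemma energy_gap c u p : 1 < u -> p ^ 2 = 3 + lam c * (u ^ 2 - 1) ->
  0 < sqrt 3 * u + p /\ 0 < sqrt 3 * u - p /\
  (sqrt 3 * u + p) * (sqrt 3 * u - p) = (3 - lam c) * (u ^ 2 - 1).
Proof.
  intros Hu E. pose proof sqrt3_sq as E3. pose proof sqrt3_pos. pose proof (lam_le_1 c).
  assert (Ep : (sqrt 3 * u + p) * (sqrt 3 * u - p) = (3 - lam c) * (u ^ 2 - 1)).
  { replace ((sqrt 3 * u + p) * (sqrt 3 * u - p)) with (sqrt 3 * sqrt 3 * u ^ 2 - p ^ 2) by ring.
    rewrite E3, E. ring. }
  assert (0 < (sqrt 3 * u + p) * (sqrt 3 * u - p)).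
  { rewrite Ep. apply Rmult_lt_0_compat; nra. }
  assert (0 < sqrt 3 * u) by nra.
  repeat split; auto.
  - apply Rnot_le_lt; intro. nra.
  - apply Rnot_le_lt; intro. nra.
Qed.

(** Along a trajectory its derivative in [s] is [- 2 sqrt 3 / (u ^ 2 - 1)]. As
    [dt/ds = 1/2 + 3 / (2 (u ^ 2 - 1))], it integrates the part of the arc length that differs from
    [s / 2]. *)
Definition lag (u p : R) : R := ln (sqrt 3 * u + p) - ln (sqrt 3 * u - p).

(* The parameter [s], in closed form along a trajectory. *)
Definition stime (u p : R -> R) (t : R) : R :=
  2 * t + sqrt 3 / 2 * (lag (u t) (p t) - lag (u 0) (p 0)).

Lemma stime_0 u p : stime u p 0 = 0.
Proof. unfold stime. ring. Qed.

Lemma stime_derive c x u p : flow c x u p ->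
  forall t : R, is_derive (stime u p) t (srate (u t)).
Proof.
  intros H t. destruct (H t) as (Hu & _ & Du & Dp & E).
  destruct (energy_gap c (u t) (p t) Hu E) as (G1 & G2 & G).
  unfold stime, lag.
  apply is_derive_eq with (2 * 1 + sqrt 3 / 2 * (
    (sqrt 3 * (p t * srate (u t)) + lam c * u t * srate (u t)) / (sqrt 3 * u t + p t) -
    (sqrt 3 * (p t * srate (u t)) - lam c * u t * srate (u t)) / (sqrt 3 * u t - p t) - 0)).
  { apply is_derive_plus_R; [apply is_derive_scal_R, is_derive_id_R|].
    apply is_derive_scal_R, is_derive_minus_R; [|apply is_derive_const_R].
    apply is_derive_minus_R;
      [apply (is_derive_ln_comp (fun t => sqrt 3 * u t + p t))
      |apply (is_derive_ln_comp (fun t => sqrt 3 * u t - p t))]; auto.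
    - apply is_derive_plus_R; auto. now apply (is_derive_scal_R u).
    - apply is_derive_minus_R; auto. now apply (is_derive_scal_R u). }
  pose proof (lam_le_1 c).
  transitivity (2 - sqrt 3 * sqrt 3 * (p t * p t - lam c * u t * u t) * srate (u t) /
    ((sqrt 3 * u t + p t) * (sqrt 3 * u t - p t))).
  - field. split; lra.
  - rewrite G, sqrt3_sq. replace (p t * p t - lam c * u t * u t) with (3 - lam c) by nra.
    unfold srate. field. repeat split; nra.
Qed.

Lemma flow_x_stime c x u p : flow c x u p -> forall t, x t = x 0 + 2 * c * stime u p t.
Proof.
  intros H t.
  assert (E : x t - 2 * c * stime u p t = x 0 - 2 * c * stime u p 0).
  { apply (derive_0_const (fun t => x t - 2 * c * stime u p t)
      (fun t => 2 * c * srate (u t) - 2 * c * srate (u t))); [|intros; ring].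
    intro r. apply (is_derive_minus x (fun t => 2 * c * stime u p t) r).
    - apply (flow_x _ _ _ _ H).
    - apply (is_derive_scal (stime u p) r (2 * c)), (stime_derive _ _ _ _ H). }
  rewrite stime_0 in E. lra.
Qed.

(** If [lam c >= 0], the energy gives [p ^ 2 >= 3], so [p] cannot change sign and stays below [-1];
    if [lam c < 0], [p] decreases. *)
Lemma flow_neg_stays c x u p t1 d : flow c x u p -> 0 < d <= 1 -> p t1 <= - d ->
  forall t, t1 <= t -> p t <= - d.
Proof.
  intros H Hd Hp t Ht. pose proof (flow_energy _ _ _ _ H) as E.
  pose proof (flow_gt1 _ _ _ _ H) as U.
  destruct (Rle_dec 0 (lam c)) as [L|L].
  - assert (B : forall r, 3 <= p r ^ 2). { intro r. rewrite E. pose proof (U r).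
      assert (0 <= lam c * (u r ^ 2 - 1)) by (apply Rmult_le_pos; nra). lra. }
    assert (p t < 0).
    { apply (nonzero_keeps_neg p t1 t); [eapply derive_continuity, flow_p, H| |lra].
      intros r _ Z. pose proof (B r). rewrite Z in *. lra. }
    pose proof (B t). nra.
  - apply Rle_trans with (p t1); auto. apply Ropp_le_cancel.
    apply (derive_le (fun t => - p t) (fun t => - (lam c * u t * srate (u t)))); auto.
    + intros r _. apply (is_derive_opp p r), (flow_p _ _ _ _ H).
    + intros r _. pose proof (U r). pose proof (srate_pos _ (U r)).
      assert (0 < u r * srate (u r)) by nra. nra.
Qed.

Lemma flow_down_u c x u p t1 d : flow c x u p -> 0 < d <= 1 -> p t1 <= - d ->
  forall t t', t1 <= t -> t <= t' -> u t' <= u t.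
Proof.
  intros H Hd Hp t t' Ht Ht'. apply Ropp_le_cancel.
  apply (derive_le (fun t => - u t) (fun t => - (p t * srate (u t)))); auto.
  - intros r _. apply (is_derive_opp u r), (flow_u _ _ _ _ H).
  - intros r Hr. pose proof (flow_neg_stays _ _ _ _ _ _ H Hd Hp r ltac:(lra)).
    pose proof (srate_pos _ (flow_gt1 _ _ _ _ H r)). nra.
Qed.

(** On a descent [dx/du = 2 c / p], whose size is at most [2 |c| / d]; the drop in [u] thus controls
    the horizontal drift. The next lemma is the same for [ds/du = 1 / p]. *)
Lemma flow_down_x c x u p t1 d : flow c x u p -> 0 < d <= 1 -> p t1 <= - d ->
  forall t t', t1 <= t -> t <= t' -> Rabs (x t' - x t) <= 2 * Rabs c / d * (u t - u t').
Proof.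
  intros H Hd Hp t t' Ht Ht'. set (k := 2 * Rabs c / d).
  assert (G : forall e, (e = 1 \/ e = -1) -> e * x t - k * u t <= e * x t' - k * u t').
  { intros e He. apply (derive_le (fun t => e * x t - k * u t)
      (fun t => e * (2 * c * srate (u t)) - k * (p t * srate (u t)))); auto.
    - intros r _. apply (is_derive_minus (fun t => e * x t) (fun t => k * u t) r).
      + apply (is_derive_scal x r e), (flow_x _ _ _ _ H).
      + apply (is_derive_scal u r k), (flow_u _ _ _ _ H).
    - intros r Hr. pose proof (flow_neg_stays _ _ _ _ _ _ H Hd Hp r ltac:(lra)).
      pose proof (srate_pos _ (flow_gt1 _ _ _ _ H r)) as Hs.
      assert (Hk : 2 * Rabs c <= k * - p r).
      { apply Rle_trans with (k * d). unfold k. right; field; lra.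
        apply Rmult_le_compat_l; [|lra]. unfold k. apply Rle_mult_inv_pos; [|lra].
        pose proof (Rabs_pos c); lra. }
      assert (- (2 * Rabs c) <= e * (2 * c)).
      { pose proof (Rle_abs c). pose proof (Rle_abs (- c)). rewrite Rabs_Ropp in *.
        destruct He as [-> | ->]; lra. }
      replace (e * (2 * c * srate (u r)) - k * (p r * srate (u r))) with
        ((e * (2 * c) + k * - p r) * srate (u r)) by ring.
      apply Rmult_le_pos; lra. }
  pose proof (G 1 ltac:(auto)). pose proof (G (-1) ltac:(auto)).
  apply Rabs_le. lra.
Qed.

Lemma flow_down_s c x u p t1 d : flow c x u p -> 0 < d <= 1 -> p t1 <= - d ->
  forall t t', t1 <= t -> t <= t' -> 0 <= stime u p t' - stime u p t <= / d * (u t - u t').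
Proof.
  intros H Hd Hp t t' Ht Ht'. pose proof (stime_derive _ _ _ _ H) as DS. split.
  - enough (stime u p t <= stime u p t') by lra.
    apply (derive_le (stime u p) (fun t => srate (u t))); auto.
    intros r _. left. apply srate_pos, (flow_gt1 _ _ _ _ H).
  - enough (- / d * u t - stime u p t <= - / d * u t' - stime u p t') by lra.
    apply (derive_le (fun t => - / d * u t - stime u p t)
      (fun t => - / d * (p t * srate (u t)) - srate (u t))); auto.
    + intros r _. apply (is_derive_minus (fun t => - / d * u t) (stime u p) r); auto.
      apply (is_derive_scal u r (- / d)), (flow_u _ _ _ _ H).
    + intros r Hr. pose proof (flow_neg_stays _ _ _ _ _ _ H Hd Hp r ltac:(lra)).
      pose proof (srate_pos _ (flow_gt1 _ _ _ _ H r)) as Hs.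
      assert (1 <= / d * - p r).
      { apply Rle_trans with (/ d * d). right; field; lra.
        apply Rmult_le_compat_l; [|lra]. left. apply Rinv_0_lt_compat. lra. }
      nra.
Qed.

(** As long as [u >= 1 + e] it falls at rate at least [d * srate (1 + e)]; by the time [T] chosen
    here it would have fallen by [u t1], below zero. *)
Lemma flow_down_lim c x u p t1 d : flow c x u p -> 0 < d <= 1 -> p t1 <= - d ->
  forall e, 0 < e -> exists T, t1 <= T /\ forall t, T <= t -> u t < 1 + e.
Proof.
  intros H Hd Hp e He. pose proof (srate_pos (1 + e) ltac:(lra)) as Hs.
  pose proof (flow_gt1 _ _ _ _ H) as U.
  set (T := t1 + u t1 / (d * srate (1 + e))).
  assert (Hk : 0 < d * srate (1 + e)) by nra.
  assert (HT : t1 < T).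
  { unfold T. pose proof (U t1). assert (0 < u t1 / (d * srate (1 + e))); [|lra].
    apply Rdiv_lt_0_compat; lra. }
  exists T. split; [lra|]. intros t Ht.
  apply Rle_lt_trans with (u T). { eapply flow_down_u; eauto; lra. }
  apply Rnot_le_lt. intros Hu.
  assert (- (d * srate (1 + e)) * t1 - u t1 <= - (d * srate (1 + e)) * T - u T).
  { apply (derive_le (fun t => - (d * srate (1 + e)) * t - u t)
     (fun t => - (d * srate (1 + e)) * 1 - p t * srate (u t))); [| |lra].
    - intros r _. apply (is_derive_minus (fun t => - (d * srate (1 + e)) * t) u r).
      + apply is_derive_scal_R, is_derive_id_R.
      + apply (flow_u _ _ _ _ H).
    - intros r Hr. pose proof (flow_neg_stays _ _ _ _ _ _ H Hd Hp r ltac:(lra)).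
      assert (u T <= u r) by (eapply flow_down_u; eauto; lra).
      pose proof (srate_le (1 + e) (u r) ltac:(lra) ltac:(lra)). nra. }
  assert (d * srate (1 + e) * (T - t1) = u t1). { unfold T. field. lra. }
  pose proof (U T). lra.
Qed.

(** The drift still to come is bounded by the height [u - 1] that is left, so [x] is Cauchy along
    the times [t1 + n]. The explicit rate is kept for the later estimates. *)
Lemma flow_down_xlim c x u p t1 d : flow c x u p -> 0 < d <= 1 -> p t1 <= - d ->
  exists xi, forall t, t1 <= t -> Rabs (x t - xi) <= 2 * Rabs c / d * (u t - 1).
Proof.
  intros H Hd Hp. pose proof (flow_gt1 _ _ _ _ H) as U. set (k := 2 * Rabs c / d).
  assert (Hk : 0 <= k). { unfold k. apply Rle_mult_inv_pos; [|lra]. pose proof (Rabs_pos c); lra. }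
  assert (B : forall t t', t1 <= t -> t <= t' -> Rabs (x t' - x t) <= k * (u t - 1)).
  { intros t t' Ht Ht'. eapply Rle_trans; [eapply flow_down_x; eauto|].
    apply Rmult_le_compat_l; auto. pose proof (U t'). lra. }
  assert (C : ex_finite_lim_seq (fun n => x (t1 + INR n))).
  { apply ex_lim_seq_cauchy_corr. intros eps.
    destruct (flow_down_lim _ _ _ _ _ _ H Hd Hp (eps / (2 * (k + 1)))) as [T [HT1 HT]].
    { apply Rdiv_lt_0_compat; [apply cond_pos|lra]. }
    destruct (INR_unbounded (T - t1)) as [N HN].
    assert (Q : forall n m, (N <= n)%nat -> (n <= m)%nat ->
       Rabs (x (t1 + INR m) - x (t1 + INR n)) < eps).
    { intros n m Hn Hm. apply le_INR in Hn, Hm. pose proof (pos_INR n).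
      eapply Rle_lt_trans; [apply B; lra|].
      pose proof (HT (t1 + INR n) ltac:(lra)).
      pose proof (cond_pos eps).
      assert (k * (eps / (2 * (k + 1))) < eps).
      { apply (Rmult_lt_reg_r (2 * (k + 1))); [lra|].
        replace (k * (eps / (2 * (k + 1))) * (2 * (k + 1))) with (k * eps) by (field; lra). nra. }
      nra. }
    exists N. intros n m Hn Hm. destruct (Nat.le_ge_cases n m).
    - rewrite Rabs_minus_sym. apply Q; auto.
    - apply Q; auto. }
  destruct C as [xi Hxi]. exists xi. intros t Ht.
  assert (L : is_lim_seq (fun n => Rabs (x (t1 + INR n) - x t)) (Rabs (xi - x t))).
  { apply (is_lim_seq_abs (fun n => x (t1 + INR n) - x t) (Finite (xi - x t))).
    apply is_lim_seq_minus'; auto. apply is_lim_seq_const. }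
  rewrite Rabs_minus_sym.
  apply (is_lim_seq_le_loc (fun n => Rabs (x (t1 + INR n) - x t)) (fun _ => k * (u t - 1))
     (Rabs (xi - x t)) (k * (u t - 1))); auto; [|apply is_lim_seq_const].
  destruct (INR_unbounded (t - t1)) as [N HN]. exists N. intros n Hn. apply le_INR in Hn.
  apply B; lra.
Qed.

(** When [lam c < 0], a trajectory with [p >= 0] forever would keep [u >= u 0], so [p] would
    decrease at rate at least [k > 0] and be negative at time [(p 0 + 1) / k]. When [lam c >= 0],
    the sign of [p 0] decides, because [p 0 ^ 2 >= 3]. *)
Lemma flow_type c x u p : flow c x u p ->
  (0 <= lam c /\ 0 < p 0) \/ (exists t1 d, 0 <= t1 /\ 0 < d <= 1 /\ p t1 <= - d).
Proof.
  intros H. pose proof (flow_energy _ _ _ _ H) as E. pose proof (flow_gt1 _ _ _ _ H) as U.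
  destruct (Rle_dec 0 (lam c)) as [L|L].
  - destruct (Rlt_dec 0 (p 0)) as [|n]; [left; auto|right].
    exists 0, 1. split; [lra|]. split; [lra|].
    assert (3 <= p 0 ^ 2). { rewrite E. pose proof (U 0).
      assert (0 <= lam c * (u 0 ^ 2 - 1)) by (apply Rmult_le_pos; nra). lra. }
    nra.
  - right. destruct (Classical_Prop.classic (exists t, 0 <= t /\ p t < 0)) as [[t [Ht Hp]]|N].
    + exists t, (Rmin (- p t) 1). split; auto.
      pose proof (Rmin_l (- p t) 1). pose proof (Rmin_r (- p t) 1).
      assert (0 < Rmin (- p t) 1) by (apply Rmin_glb_lt; lra). lra.
    + exfalso. assert (Hp : forall t, 0 <= t -> 0 <= p t).
      { intros t Ht. apply Rnot_lt_le. intro. apply N. now exists t. }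
      pose proof (srate_pos _ (U 0)) as Hs.
      assert (Hu : forall t, 0 <= t -> u 0 <= u t).
      { intros t Ht. apply (derive_le u (fun t => p t * srate (u t))); auto.
        - intros r _. apply (flow_u _ _ _ _ H).
        - intros r Hr. apply Rmult_le_pos; [apply Hp; lra|left; apply srate_pos, U]. }
      set (k := - lam c * u 0 * srate (u 0)).
      assert (Hk : 0 < k). { unfold k. pose proof (U 0). apply Rmult_lt_0_compat; nra. }
      set (T := (p 0 + 1) / k).
      assert (HT : 0 <= T). { unfold T. apply Rle_mult_inv_pos; auto. pose proof (Hp 0 ltac:(lra)); lra. }
      assert (- p 0 - k * 0 <= - p T - k * T).
      { apply (derive_le (fun t => - p t - k * t) (fun t => - (lam c * u t * srate (u t)) - k * 1)); auto.
        - intros r _. apply (is_derive_minus (fun t => - p t) (fun t => k * t) r).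
          + apply (is_derive_opp p r), (flow_p _ _ _ _ H).
          + apply is_derive_scal_R, is_derive_id_R.
        - intros r Hr. pose proof (Hu r ltac:(lra)) as H1. pose proof (U 0).
          pose proof (srate_le _ _ (U 0) H1).
          assert (u 0 * srate (u 0) <= u r * srate (u r)) by (apply Rmult_le_compat; lra).
          unfold k. nra. }
      assert (k * T = p 0 + 1) by (unfold T; field; lra).
      pose proof (Hp T HT). lra.
Qed.

Lemma flow_up_p c x u p : flow c x u p -> 0 <= lam c -> 0 < p 0 -> forall t, 1 < p t.
Proof.
  intros H L Hp t. pose proof (flow_energy _ _ _ _ H) as E. pose proof (flow_gt1 _ _ _ _ H) as U.
  assert (B : forall r, 3 <= p r ^ 2). { intro r. rewrite E. pose proof (U r).
      assert (0 <= lam c * (u r ^ 2 - 1)) by (apply Rmult_le_pos; nra). lra. }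
  assert (0 < p t).
  { apply (nonzero_keeps_pos p 0 t); [eapply derive_continuity, flow_p, H| |lra].
    intros r _ Z. pose proof (B r). rewrite Z in *. lra. }
  pose proof (B t). nra.
Qed.

Lemma flow_rise_u c x u p T : flow c x u p -> (forall t, 0 <= t <= T -> 0 <= p t) ->
  forall t, 0 <= t <= T -> u 0 <= u t.
Proof.
  intros H Hp t Ht. apply (derive_le u (fun t => p t * srate (u t))); [| |lra].
  - intros r _. apply (flow_u _ _ _ _ H).
  - intros r Hr. apply Rmult_le_pos; [apply Hp; lra|].
    left. apply srate_pos, (flow_gt1 _ _ _ _ H).
Qed.

Lemma flow_up_u c x u p : flow c x u p -> 0 <= lam c -> 0 < p 0 ->
  forall t, 0 <= t -> u 0 + srate (u 0) * t <= u t.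
Proof.
  intros H L Hp t Ht. pose proof (flow_up_p _ _ _ _ H L Hp) as P1.
  pose proof (flow_gt1 _ _ _ _ H) as U. pose proof (srate_pos _ (U 0)).
  enough (u 0 - srate (u 0) * 0 <= u t - srate (u 0) * t) by lra.
  apply (derive_le (fun t => u t - srate (u 0) * t) (fun t => p t * srate (u t) - srate (u 0) * 1)); auto.
  - intros r _. apply (is_derive_minus u (fun t => srate (u 0) * t) r).
    + apply (flow_u _ _ _ _ H).
    + apply is_derive_scal_R, is_derive_id_R.
  - intros r Hr. assert (u 0 <= u r).
    { apply (flow_rise_u _ _ _ _ r H); [|lra]. intros q _. pose proof (P1 q). lra. }
    pose proof (srate_le _ _ (U 0) H1). pose proof (P1 r). nra.
Qed.

(* Bounds [s - 2 t] on all rising trajectories that start at height [u0]. *)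
Definition lag_bound (u0 : R) : R := ln (6 * u0 ^ 2 / (u0 ^ 2 - 1)).

(** By [energy_gap] the quotient of the two arguments is [(sqrt 3 u + p) ^ 2 / ((3 - lam c) (u ^ 2 -
    1))], at most [6 u ^ 2 / (u ^ 2 - 1)], which decreases in [u]. The bound is independent of [c],
    hence uniform over directions. *)
Lemma lag_le_bound c u0 u p : 1 < u0 -> u0 <= u -> 0 <= p -> p ^ 2 = 3 + lam c * (u ^ 2 - 1) ->
  0 <= lag u p <= lag_bound u0.
Proof.
  intros Hu0 Hu Hp E. destruct (energy_gap c u p ltac:(lra) E) as (G1 & G2 & G).
  pose proof (lam_le_1 c). pose proof sqrt3_sq as E3. pose proof sqrt3_pos.
  unfold lag, lag_bound. split.
  - assert (ln (sqrt 3 * u - p) <= ln (sqrt 3 * u + p)); [|lra]. apply ln_le; lra.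
  - rewrite <- ln_div by lra. apply ln_le. { apply Rdiv_lt_0_compat; lra. }
    assert (A : (sqrt 3 * u + p) / (sqrt 3 * u - p) = (sqrt 3 * u + p) ^ 2 / ((3 - lam c) * (u ^ 2 - 1))).
    { rewrite <- G. field. lra. }
    rewrite A. apply Rle_trans with (12 * u ^ 2 / (2 * (u ^ 2 - 1))).
    + apply Rmult_le_compat.
      * nra.
      * left. apply Rinv_0_lt_compat. apply Rmult_lt_0_compat; nra.
      * assert (p <= sqrt 3 * u) by lra. nra.
      * apply Rinv_le_contravar; [nra|]. apply Rmult_le_compat_r; nra.
    + apply (Rmult_le_reg_r ((u ^ 2 - 1) * (u0 ^ 2 - 1))). { apply Rmult_lt_0_compat; nra. }
      replace (12 * u ^ 2 / (2 * (u ^ 2 - 1)) * ((u ^ 2 - 1) * (u0 ^ 2 - 1))) with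
        (6 * u ^ 2 * (u0 ^ 2 - 1)) by (field; nra).
      replace (6 * u0 ^ 2 / (u0 ^ 2 - 1) * ((u ^ 2 - 1) * (u0 ^ 2 - 1))) with
        (6 * u0 ^ 2 * (u ^ 2 - 1)) by (field; nra). nra.
Qed.

Lemma flow_up_s c x u p : flow c x u p -> 0 <= lam c -> 0 < p 0 ->
  forall t, 0 <= t -> Rabs (stime u p t - 2 * t) <= lag_bound (u 0).
Proof.
  intros H L Hp t Ht. pose proof (flow_up_p _ _ _ _ H L Hp) as P1.
  pose proof (flow_gt1 _ _ _ _ H) as U. pose proof (flow_energy _ _ _ _ H) as E.
  assert (u 0 <= u t).
  { apply (flow_rise_u _ _ _ _ t H); [|lra]. intros q _. pose proof (P1 q). lra. }
  pose proof (P1 0). pose proof (P1 t).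
  pose proof (lag_le_bound c (u 0) (u 0) (p 0) (U 0) ltac:(lra) ltac:(lra) (E 0)).
  pose proof (lag_le_bound c (u 0) (u t) (p t) (U 0) ltac:(lra) ltac:(lra) (E t)).
  pose proof sqrt3_bounds. unfold stime. apply Rabs_le. nra.
Qed.

Lemma acosh_bounds u : 1 <= u -> ln u <= acosh u <= ln (2 * u).
Proof.
  intros H. unfold acosh. assert (sqrt (u ^ 2 - 1) <= u).
  { rewrite <- (sqrt_pow2 u) at 2 by lra. apply sqrt_le_1_alt. lra. }
  pose proof (sqrt_pos (u ^ 2 - 1)). split; apply ln_le; lra.
Qed.

(** With [k = sqrt (lam c)] the linear system gives [d(p + k u)/ds = k (p + k u)], so
    [ln (p + k u) - k s] is conserved; and [k u <= p + k u <= 3 u], while [acosh u] is [ln u] up to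
    [ln 2]. The bound degenerates as [lam c] tends to 0. *)
Lemma flow_up_y c x u p : flow c x u p -> 0 < lam c -> 0 < p 0 ->
  forall t, 0 <= t ->
  Rabs (acosh (u t) - sqrt (lam c) * stime u p t) <= ln (6 * u 0) - ln (sqrt (lam c)).
Proof.
  intros H L Hp t Ht. pose proof (flow_up_p _ _ _ _ H ltac:(lra) Hp) as P1.
  pose proof (flow_gt1 _ _ _ _ H) as U. pose proof (flow_energy _ _ _ _ H) as E.
  set (k := sqrt (lam c)). assert (Hk : 0 < k) by now apply sqrt_lt_R0.
  assert (Ek : k * k = lam c) by (apply sqrt_sqrt; lra). pose proof (lam_le_1 c).
  assert (Hk1 : k <= 1) by nra.
  assert (Hq : forall r, 0 < p r + k * u r). { intro r. pose proof (U r). pose proof (P1 r). nra. }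
  assert (C : ln (p t + k * u t) - k * stime u p t = ln (p 0 + k * u 0) - k * stime u p 0).
  { apply (derive_0_const (fun t => ln (p t + k * u t) - k * stime u p t)
     (fun t => k * srate (u t) - k * srate (u t))); [|intros; ring].
    intro r. apply (is_derive_minus (fun t => ln (p t + k * u t)) (fun t => k * stime u p t) r).
    - apply is_derive_eq with ((lam c * u r * srate (u r) + k * (p r * srate (u r))) / (p r + k * u r)).
      + apply (is_derive_ln_comp (fun t => p t + k * u t)); auto.
        apply is_derive_plus_R; [apply (flow_p _ _ _ _ H)|].
        apply (is_derive_scal_R u), (flow_u _ _ _ _ H).
      + rewrite <- Ek. pose proof (Hq r). field. lra.
    - apply (is_derive_scal (stime u p) r k), (stime_derive _ _ _ _ H). }
  rewrite stime_0, Rmult_0_r, Rminus_0_r in C.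
  assert (B : forall r, ln k + ln (u r) <= ln (p r + k * u r) <= ln 3 + ln (u r)).
  { intro r. pose proof (U r). pose proof (P1 r). pose proof (E r).
    rewrite <- !ln_mult by lra. split; apply ln_le; try nra.
    assert (lam c * (u r ^ 2 - 1) <= 1 * (u r ^ 2 - 1)) by (apply Rmult_le_compat_r; nra).
    assert (p r <= 2 * u r).
    { apply Rnot_lt_le. intro HH. clear - HH H1 H2 H3 H4.
      assert ((2 * u r) * (2 * u r) < p r * p r) by (apply Rmult_le_0_lt_compat; lra). nra. }
    nra. }
  pose proof (B 0). pose proof (B t). pose proof (acosh_bounds (u t) ltac:(pose proof (U t); lra)) as A.
  pose proof (U t). pose proof (U 0).
  rewrite ln_mult in A by lra. replace (6 * u 0) with (2 * (3 * u 0)) by ring.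
  rewrite ln_mult, ln_mult by lra.
  assert (0 < ln 2) by (rewrite <- ln_1; apply ln_increasing; lra).
  assert (0 < ln 3) by (rewrite <- ln_1; apply ln_increasing; lra).
  assert (ln 1 < ln (u 0)) by (apply ln_increasing; lra). rewrite ln_1 in *.
  assert (ln k <= 0) by (rewrite <- ln_1; apply ln_le; lra).
  apply Rabs_le. lra.
Qed.

(** * Compactification of the half plane *)

Definition Rad (x y : R) : R := sqrt (1 + x ^ 2 + y ^ 2).

(** Central projection of the plane at height 1 onto the unit hemisphere, followed by vertical
    projection onto the disk. *)
Definition Phi0 (q : R * R) : R * R :=
  (fst q / Rad (fst q) (snd q), snd q / Rad (fst q) (snd q)).

Lemma Rad_sq x y : Rad x y ^ 2 = 1 + x ^ 2 + y ^ 2.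
Proof. apply pow2_sqrt. nra. Qed.

Lemma Rad_pos x y : 0 < Rad x y.
Proof. apply sqrt_lt_R0. nra. Qed.

Lemma div_abs_le (a b m n : R) : 0 < n -> n <= b -> Rabs a <= m -> Rabs (a / b) <= m / n.
Proof.
  intros Hn Hb Ha. unfold Rdiv. rewrite Rabs_mult, Rabs_inv, (Rabs_right b) by lra.
  apply Rmult_le_compat; auto using Rabs_pos.
  - left. apply Rinv_0_lt_compat. lra.
  - apply Rinv_le_contravar; lra.
Qed.

Lemma abs_le_inv a b : Rabs a <= b -> - b <= a <= b.
Proof. intros H. pose proof (Rle_abs a). pose proof (Rle_abs (- a)). rewrite Rabs_Ropp in *. lra. Qed.

(** If [(X, Y)] is within [K] of [2 t (C, L)] in each coordinate, then [Rad X Y] differs from [2 t]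
    by at most [1 + 4 K]; dividing gives the numerator [K + (1 + 4 K)]. *)
Lemma Phi0_far_direction C L K t X Y : C ^ 2 + L ^ 2 = 1 -> 0 <= K -> 2 * K < t ->
  Rabs (X - 2 * t * C) <= K -> Rabs (Y - 2 * t * L) <= K ->
  Rabs (X / Rad X Y - C) <= (1 + 5 * K) / (2 * t - 4 * K) /\
  Rabs (Y / Rad X Y - L) <= (1 + 5 * K) / (2 * t - 4 * K).
Proof.
  intros E HK Ht HX HY. apply abs_le_inv in HX, HY.
  assert (HC : -1 <= C <= 1) by nra. assert (HL : -1 <= L <= 1) by nra.
  set (a := X - 2 * t * C) in *. set (b := Y - 2 * t * L) in *.
  pose proof (Rad_pos X Y) as Rp. pose proof (Rad_sq X Y) as R2.
  assert (EX : X ^ 2 + Y ^ 2 = 4 * t ^ 2 + 4 * t * (C * a + L * b) + a ^ 2 + b ^ 2).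
  { replace X with (2 * t * C + a) by (unfold a; ring).
    replace Y with (2 * t * L + b) by (unfold b; ring).
    replace (4 * t ^ 2) with (4 * t ^ 2 * (C ^ 2 + L ^ 2)) by (rewrite E; ring). ring. }
  assert (Hd : - (2 * K) <= C * a + L * b <= 2 * K) by (split; nra).
  assert (a ^ 2 <= K ^ 2) by nra. assert (b ^ 2 <= K ^ 2) by nra.
  assert (U : Rad X Y <= 1 + 2 * t + 2 * K).
  { apply Rnot_lt_le. intro. assert ((1 + 2 * t + 2 * K) ^ 2 < Rad X Y ^ 2) by nra.
    assert (t * (C * a + L * b) <= t * (2 * K)) by (apply Rmult_le_compat_l; lra). nra. }
  assert (Lo : 2 * t - 4 * K <= Rad X Y).
  { apply Rnot_lt_le. intro. assert (Rad X Y ^ 2 < (2 * t - 4 * K) ^ 2) by nra.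
    assert (t * - (2 * K) <= t * (C * a + L * b)) by (apply Rmult_le_compat_l; lra).
    assert (K * (2 * K) <= K * t) by (apply Rmult_le_compat_l; lra). nra. }
  assert (Hr : - (1 + 4 * K) <= 2 * t - Rad X Y <= 1 + 4 * K) by lra.
  split.
  - replace (X / Rad X Y - C) with ((a + C * (2 * t - Rad X Y)) / Rad X Y) by (unfold a; field; lra).
    apply div_abs_le; [lra|auto|]. apply Rabs_le. nra.
  - replace (Y / Rad X Y - L) with ((b + L * (2 * t - Rad X Y)) / Rad X Y) by (unfold b; field; lra).
    apply div_abs_le; [lra|auto|]. apply Rabs_le. nra.
Qed.

Lemma lam_nonneg_abs c : 0 <= lam c -> Rabs (2 * c) <= 1.
Proof. unfold lam. intros H. apply Rabs_le. nra. Qed.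

Lemma flow_up_x_linear c x u p : flow c x u p -> 0 <= lam c -> 0 < p 0 ->
  forall t, 0 <= t -> Rabs (x t - 2 * t * (2 * c)) <= Rabs (x 0) + lag_bound (u 0).
Proof.
  intros H L Hp t Ht. rewrite (flow_x_stime _ _ _ _ H t).
  replace (x 0 + 2 * c * stime u p t - 2 * t * (2 * c)) with
    (x 0 + (2 * c) * (stime u p t - 2 * t)) by ring.
  eapply Rle_trans; [apply Rabs_triang|]. apply Rplus_le_compat_l. rewrite Rabs_mult.
  pose proof (flow_up_s _ _ _ _ H L Hp t Ht). pose proof (lam_nonneg_abs c L).
  pose proof (Rabs_pos (2 * c)). pose proof (Rabs_pos (stime u p t - 2 * t)). nra.
Qed.

Lemma flow_up_y_linear c x u p : flow c x u p -> 0 < lam c -> 0 < p 0 ->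
  forall t, 0 <= t -> Rabs (acosh (u t) - 2 * t * sqrt (lam c)) <=
    ln (6 * u 0) - ln (sqrt (lam c)) + lag_bound (u 0).
Proof.
  intros H L Hp t Ht.
  replace (acosh (u t) - 2 * t * sqrt (lam c)) with
    ((acosh (u t) - sqrt (lam c) * stime u p t) + sqrt (lam c) * (stime u p t - 2 * t)) by ring.
  eapply Rle_trans; [apply Rabs_triang|]. apply Rplus_le_compat.
  - now apply (flow_up_y _ _ _ _ H).
  - rewrite Rabs_mult. pose proof (flow_up_s _ _ _ _ H ltac:(lra) Hp t Ht).
    rewrite (Rabs_right (sqrt _)) by (apply Rle_ge, sqrt_pos).
    assert (sqrt (lam c) <= 1). { rewrite <- sqrt_1. apply sqrt_le_1_alt, lam_le_1. }
    pose proof (sqrt_pos (lam c)). pose proof (Rabs_pos (stime u p t - 2 * t)). nra.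
Qed.

(** * Slope barrier for trajectories near the critical one *)

(** Let [m] be the last time with [W <= B]. After [m] the derivative is nonpositive, so the mean
    value theorem on [[m, b]] forbids [W b > B]. *)
Lemma barrier (W dW : R -> R) B a b : (forall t : R, is_derive W t (dW t)) ->
  (forall t, a <= t <= b -> B < W t -> dW t <= 0) -> a <= b -> W a <= B -> W b <= B.
Proof.
  intros D H Hab Ha. apply Rnot_lt_le. intro Hb.
  pose proof (derive_continuity W dW D) as Cont.
  destruct (completeness (fun t => a <= t <= b /\ W t <= B)) as [m [Hm1 Hm2]].
  { exists b. intros t [Ht _]. lra. }
  { exists a. split; auto. lra. }
  assert (am : a <= m). { apply Hm1. split; auto; lra. }
  assert (mb : m <= b). { apply Hm2. intros t [Ht _]. lra. }
  assert (Wm : W m <= B).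
  { apply Rnot_lt_le. intro HW.
    destruct (continuity_at W m Cont (W m - B) ltac:(lra)) as (al & Hal & Hc).
    assert (m <= m - al); [|lra]. apply Hm2. intros t [Ht1 Ht2].
    apply Rnot_lt_le. intro Hlt. assert (t <= m) by (apply Hm1; auto).
    specialize (Hc t ltac:(apply Rabs_def1; lra)). apply Rabs_def2 in Hc. lra. }
  assert (Hlt : m < b). { destruct mb as [|E]; auto. rewrite E in Wm. lra. }
  destruct (MVT_cor2 W dW m b Hlt) as [z [Ez Hz]].
  { intros z _. apply is_derive_Reals, D. }
  assert (Wz : B < W z).
  { apply Rnot_le_lt. intro. assert (z <= m); [apply Hm1; split; auto; lra|lra]. }
  pose proof (H z ltac:(lra) Wz). nra.
Qed.

Lemma flow_reflect c x u p : flow c x u p -> flow (- c) (fun t => - x t) u p.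
Proof.
  intros H t. destruct (H t) as (H1 & H2 & H3 & H4 & H5).
  assert (lam (- c) = lam c) as -> by (unfold lam; ring).
  split; [auto|split; [|auto]]. apply is_derive_eq with (- (2 * c * srate (u t))); [|ring].
  apply (is_derive_opp x t), H2.
Qed.

Lemma flow_x_incr c x u p : flow c x u p -> 0 <= c -> forall t t', t <= t' -> x t <= x t'.
Proof.
  intros H Hc t t' Ht. apply (derive_le x (fun t => 2 * c * srate (u t))); auto.
  - intros r _. apply (flow_x _ _ _ _ H).
  - intros r _. pose proof (srate_pos _ (flow_gt1 _ _ _ _ H r)). nra.
Qed.

Lemma flow_y c x u p : flow c x u p -> forall t : R,
  is_derive (fun t => acosh (u t)) t (p t * srate (u t) / sqrt (u t ^ 2 - 1)).
Proof.
  intros H t. apply (is_derive_comp acosh u t (/ sqrt (u t ^ 2 - 1)) (p t * srate (u t))).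
  - apply is_derive_acosh, (flow_gt1 _ _ _ _ H).
  - apply (flow_u _ _ _ _ H).
Qed.

(** The height with [e ^ 2 sinh y ^ 2 = 12], above which the 3 of the energy law is at most
    [e ^ 2 sinh y ^ 2 / 4]. *)
Definition crit_height (e : R) : R := acosh (sqrt (1 + 12 / e ^ 2)).

(* Above [crit_height e] every trajectory with [lam] close to 0 has slope at most [e]. *)
Lemma flow_crit_y c x u p e : flow c x u p -> 0 < c -> 0 < e ->
  Rabs (lam c) <= 1 / 2 -> Rabs (lam c) <= e ^ 2 / 4 ->
  forall t, 0 <= t ->
  acosh (u t) <= Rmax (crit_height e) (acosh (u 0)) + e * (x t - x 0).
Proof.
  intros H Hc He L1 L2 t Ht. apply abs_le_inv in L1, L2.
  enough (acosh (u t) - e * x t <= Rmax (crit_height e) (acosh (u 0)) - e * x 0) by lra.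
  apply (barrier (fun t => acosh (u t) - e * x t)
    (fun t => p t * srate (u t) / sqrt (u t ^ 2 - 1) - e * (2 * c * srate (u t))) _ 0 t); auto.
  - intro r. apply is_derive_minus_R; [apply (flow_y _ _ _ _ H)|].
    apply (is_derive_scal_R x), (flow_x _ _ _ _ H).
  - intros r Hr HW. pose proof (flow_gt1 _ _ _ _ H r) as U.
    pose proof (flow_x_incr _ _ _ _ H ltac:(lra) 0 r ltac:(lra)).
    assert (HM : crit_height e < acosh (u r)).
    { pose proof (Rmax_l (crit_height e) (acosh (u 0))).
      assert (0 <= e * (x r - x 0)) by (apply Rmult_le_pos; lra). lra. }
    assert (Hq : 0 < 12 / e ^ 2). { apply Rdiv_lt_0_compat; [lra|]. clear - He. nra. }
    assert (Hs1 : 1 <= sqrt (1 + 12 / e ^ 2)). { rewrite <- sqrt_1 at 1. apply sqrt_le_1_alt. lra. }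
    assert (HU : sqrt (1 + 12 / e ^ 2) < u r).
    { rewrite <- (cosh_acosh (sqrt (1 + 12 / e ^ 2))), <- (cosh_acosh (u r)) by lra.
      apply cosh_lt; auto. unfold acosh. rewrite <- ln_1. apply ln_le; [lra|].
      apply acosh_arg, Hs1. }
    assert (HS : 12 / e ^ 2 < u r ^ 2 - 1).
    { pose proof (pow2_sqrt (1 + 12 / e ^ 2) ltac:(lra)) as Z. clear - Z HU Hs1. nra. }
    assert (HS' : 12 < e ^ 2 * (u r ^ 2 - 1)).
    { apply (Rmult_lt_compat_l (e ^ 2)) in HS; [|nra].
      replace (e ^ 2 * (12 / e ^ 2)) with 12 in HS by (field; lra). exact HS. }
    set (q := sqrt (u r ^ 2 - 1)). assert (Hq0 : 0 < q) by (apply sqrt_lt_R0; nra).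
    assert (Q2 : q ^ 2 = u r ^ 2 - 1) by (apply pow2_sqrt; nra).
    pose proof (flow_energy _ _ _ _ H r) as E. rewrite <- Q2 in E, HS'.
    (* The slope [dy/dx] is [p / (2 c q)] with [q = sinh y]. Here [p ^ 2 = 3 + lam c q ^ 2 <= e ^ 2
       q ^ 2 / 2], and [4 c ^ 2 = 1 - lam c >= 1/2]. *)
    assert (Hp : p r <= 2 * c * e * q).
    { apply Rnot_lt_le. intro.
      assert ((2 * c * e * q) ^ 2 < p r ^ 2).
      { assert (0 < 2 * c * e * q) by (repeat apply Rmult_lt_0_compat; lra). nra. }
      replace ((2 * c * e * q) ^ 2) with ((1 - lam c) * (e ^ 2 * q ^ 2)) in * by (unfold lam; ring).
      assert (lam c * q ^ 2 <= e ^ 2 / 4 * q ^ 2) by (apply Rmult_le_compat_r; nra). nra. }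
    pose proof (srate_pos _ U).
    assert (p r * srate (u r) / q <= e * (2 * c * srate (u r))); [|lra].
    apply (Rmult_le_reg_r q); auto. unfold Rdiv. rewrite Rmult_assoc, Rinv_l by lra. nra.
  - pose proof (Rmax_r (crit_height e) (acosh (u 0))). lra.
Qed.

(** Since [1], [M] are at most [e x], one has [y <= 2 e x] and [x <= Rad x y <= 1 + x + y], so both
    errors are at most [3 e x] before division by [Rad x y >= x]. *)
Lemma Phi0_near_corner e M X x y : 0 < e -> 1 <= e * X -> M <= e * X -> X <= x -> 0 <= y ->
  y <= M + e * x -> Rabs (x / Rad x y - 1) <= 3 * e /\ Rabs (y / Rad x y) <= 3 * e.
Proof.
  intros He H1 HM HX Hy HyM. pose proof (Rad_pos x y). pose proof (Rad_sq x y).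
  assert (0 < X) by nra. assert (e * X <= e * x) by nra.
  assert (Lo : x <= Rad x y) by (apply Rnot_lt_le; intro; nra).
  assert (Up : Rad x y <= 1 + x + y).
  { apply Rnot_lt_le; intro. assert ((1 + x + y) ^ 2 < Rad x y ^ 2) by nra. nra. }
  split.
  - replace (x / Rad x y - 1) with ((x - Rad x y) / Rad x y) by (field; lra).
    apply Rle_trans with ((3 * e * x) / x); [|right; field; lra].
    apply div_abs_le; try lra. apply Rabs_le. lra.
  - apply Rle_trans with ((3 * e * x) / x); [|right; field; lra].
    apply div_abs_le; try lra. apply Rabs_le. nra.
Qed.

Lemma Phi0_reflect x y : Phi0 (- x, y) = (- fst (Phi0 (x, y)), snd (Phi0 (x, y))).
Proof.
  unfold Phi0, Rad; simpl. replace (- x * (- x * 1)) with (x * (x * 1)) by ring.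
  f_equal. unfold Rdiv. ring.
Qed.

Definition squash (xi : R) : R := xi / Rad xi 0.

Lemma Phi0_continuous a b e : 0 < e -> exists d, 0 < d /\
  forall x y, Rabs (x - a) < d -> Rabs (y - b) < d ->
    Rabs (fst (Phi0 (x, y)) - fst (Phi0 (a, b))) < e /\
    Rabs (snd (Phi0 (x, y)) - snd (Phi0 (a, b))) < e.
Proof.
  (* [Rad >= 1] and [Rad] changes by at most [|x - a| + |y - b|], so a coordinate of [Phi0] moves by
     less than three times [e / 4]. *)
  intros He. exists (e / 4). split; [lra|]. intros x y Hx Hy. apply Rabs_def2 in Hx, Hy.
  unfold Phi0; cbn [fst snd]. set (r := Rad x y). set (q := Rad a b).
  pose proof (Rad_pos x y : 0 < r). pose proof (Rad_pos a b : 0 < q).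
  pose proof (Rad_sq x y : r ^ 2 = _). pose proof (Rad_sq a b : q ^ 2 = _).
  assert (1 <= r) by nra. assert (1 <= q) by nra.
  assert (Rabs x <= r). { apply Rabs_le. split; apply Rnot_lt_le; intro; nra. }
  assert (Rabs a <= q). { apply Rabs_le. split; apply Rnot_lt_le; intro; nra. }
  assert (Rabs y <= r). { apply Rabs_le. split; apply Rnot_lt_le; intro; nra. }
  assert (Rabs b <= q). { apply Rabs_le. split; apply Rnot_lt_le; intro; nra. }
  assert (Hrq : Rabs (q - r) <= Rabs (x - a) + Rabs (y - b)).
  { assert (Eq : (q - r) * (q + r) = (a - x) * (a + x) + (b - y) * (b + y)) by nra.
    apply (Rmult_le_reg_r (q + r)); [lra|].
    rewrite <- (Rabs_right (q + r)) at 1 by lra. rewrite <- Rabs_mult, Eq.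
    eapply Rle_trans; [apply Rabs_triang|]. rewrite !Rabs_mult.
    rewrite (Rabs_minus_sym a x), (Rabs_minus_sym b y), Rmult_plus_distr_r.
    apply Rplus_le_compat; apply Rmult_le_compat_l; try apply Rabs_pos;
      (eapply Rle_trans; [apply Rabs_triang|lra]). }
  assert (Rabs (x - a) < e / 4) by (apply Rabs_def1; lra).
  assert (Rabs (y - b) < e / 4) by (apply Rabs_def1; lra).
  assert (G : forall z w, Rabs (z - w) < e / 4 -> Rabs w <= q -> Rabs (z / r - w / q) < e).
  { intros z w Hz Hw.
    replace (z / r - w / q) with (((z - w) + w / q * (q - r)) / r) by (field; lra).
    apply Rle_lt_trans with (3 * (e / 4) / 1); [|lra].
    apply div_abs_le; try lra. eapply Rle_trans; [apply Rabs_triang|]. rewrite Rabs_mult.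
    assert (Rabs (w / q) <= 1).
    { apply Rle_trans with (q / q); [apply div_abs_le; lra|]. right; field; lra. }
    pose proof (Rabs_pos (w / q)). pose proof (Rabs_pos (q - r)). nra. }
  split; apply G; auto.
Qed.

(** * Continuous dependence on the initial direction *)

Lemma srate_lipschitz a b : 1 < a -> 1 < b -> Rabs (srate a - srate b) <= 2 * Rabs (a - b).
Proof.
  intros Ha Hb.
  assert (D : 0 < (a ^ 2 + 2) * (b ^ 2 + 2)) by nra.
  assert (E : srate a - srate b = (a - b) * (6 * (a + b) / ((a ^ 2 + 2) * (b ^ 2 + 2)))).
  { unfold srate. field. split; nra. }
  rewrite E, Rabs_mult, (Rmult_comm 2). apply Rmult_le_compat_l; [apply Rabs_pos|].
  rewrite Rabs_right.
  - apply (Rmult_le_reg_r ((a ^ 2 + 2) * (b ^ 2 + 2))); auto.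
    unfold Rdiv. rewrite Rmult_assoc, Rinv_l by lra.
    assert (3 * (a ^ 2 + 2) <= (a ^ 2 + 2) * (b ^ 2 + 2))
      by (rewrite (Rmult_comm 3); apply Rmult_le_compat_l; nra).
    assert (3 * (b ^ 2 + 2) <= (a ^ 2 + 2) * (b ^ 2 + 2)) by (apply Rmult_le_compat_r; nra).
    nra.
  - apply Rle_ge, Rle_mult_inv_pos; nra.
Qed.

Lemma flow_p_lt c x u p : flow c x u p -> forall t, Rabs (p t) < 2 * u t.
Proof.
  intros H t. destruct (energy_gap c (u t) (p t)) as (G1 & G2 & _); try apply H.
  pose proof sqrt3_bounds. pose proof (flow_gt1 _ _ _ _ H t). apply Rabs_def1; nra.
Qed.

Lemma flow_u_exp c x u p : flow c x u p -> forall t, 0 <= t -> u t <= u 0 * exp (4 * t).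
Proof.
  intros H t Ht. pose proof (flow_gt1 _ _ _ _ H) as U.
  assert (G : - (u 0 * exp (-4 * 0)) <= - (u t * exp (-4 * t))).
  { apply (derive_le (fun t => - (u t * exp (-4 * t)))
      (fun t => - ((p t * srate (u t)) * exp (-4 * t) + u t * (-4 * exp (-4 * t))))); auto.
    - intros r _. apply (is_derive_opp (fun t => u t * exp (-4 * t)) r).
      apply (is_derive_mult_R u (fun t => exp (-4 * t))); [apply (flow_u _ _ _ _ H)|].
      auto_derive; auto. ring.
    - intros r _. pose proof (flow_p_lt _ _ _ _ H r) as Hp. apply Rabs_def2 in Hp.
      pose proof (srate_pos _ (U r)). pose proof (srate_lt_2 (u r)). pose proof (exp_pos (-4 * r)).
      pose proof (U r).
      assert (p r * srate (u r) <= 4 * u r) by nra. nra. }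
  rewrite Rmult_0_r, exp_0 in G.
  assert (E : exp (-4 * t) * exp (4 * t) = 1).
  { rewrite <- exp_plus. replace (-4 * t + 4 * t) with 0 by ring. apply exp_0. }
  pose proof (exp_pos (4 * t)).
  assert (u t = u t * exp (-4 * t) * exp (4 * t)) as -> by (rewrite Rmult_assoc, E; ring).
  apply Rmult_le_compat_r; lra.
Qed.

(** The pointwise inequality for Gronwall, freed from functions of time: [a], [b], [e], [dl], [dc],
    [w] are the differences of [u], [p], [x], [lam], [c], [srate]. Each difference of velocities is
    at most [4 N ^ 2] times [|a| + |b| + |dl| + |dc|], and the resulting products cost a factor 10
    of the sum of squares. *)
Lemma gronwall_quadratic N s1 s2 u v p q l m c k a b e w dl dc :
  1 <= N -> Rabs v <= N -> Rabs q <= N -> Rabs l <= N -> Rabs m <= N -> Rabs k <= N ->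
  a = u - v -> b = p - q -> dl = l - m -> dc = c - k -> w = s1 - s2 ->
  0 < s1 < 2 -> Rabs w <= 2 * Rabs a ->
  2 * a * (p * s1 - q * s2) + 2 * b * (l * u * s1 - m * v * s2) +
    2 * e * (2 * c * s1 - 2 * k * s2) <=
  40 * N ^ 2 * (a ^ 2 + b ^ 2 + e ^ 2 + dl ^ 2 + dc ^ 2).
Proof.
  intros HN Hv Hq Hl Hm Hk Ea Eb El Ec Ew Hs Hw.
  assert (T1 : Rabs (p * s1 - q * s2) <= 4 * N ^ 2 * (Rabs a + Rabs b + Rabs dl + Rabs dc)).
  { replace (p * s1 - q * s2) with (b * s1 + q * w) by (rewrite Eb, Ew; ring).
    eapply Rle_trans; [apply Rabs_triang|]. rewrite !Rabs_mult, (Rabs_right s1) by lra.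
    pose proof (Rabs_pos a). pose proof (Rabs_pos b). pose proof (Rabs_pos q). pose proof (Rabs_pos w).
    pose proof (Rabs_pos dl). pose proof (Rabs_pos dc).
    assert (Rabs b * s1 <= 2 * Rabs b) by nra.
    assert (Rabs q * Rabs w <= N * (2 * Rabs a)) by (apply Rmult_le_compat; auto).
    assert (N <= N ^ 2) by nra.
    assert (N * Rabs a <= N ^ 2 * Rabs a) by (apply Rmult_le_compat_r; auto).
    assert (1 * Rabs b <= N ^ 2 * Rabs b) by (apply Rmult_le_compat_r; nra).
    assert (0 <= N ^ 2 * Rabs dl) by (apply Rmult_le_pos; nra).
    assert (0 <= N ^ 2 * Rabs dc) by (apply Rmult_le_pos; nra). nra. }
  assert (T2 : Rabs (l * u * s1 - m * v * s2) <= 4 * N ^ 2 * (Rabs a + Rabs b + Rabs dl + Rabs dc)).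
  { replace (l * u * s1 - m * v * s2) with (l * s1 * a + dl * v * s1 + m * v * w)
      by (rewrite Ea, El, Ew; ring).
    eapply Rle_trans; [apply Rabs_triang|].
    eapply Rle_trans; [apply Rplus_le_compat_r, Rabs_triang|].
    rewrite !Rabs_mult, (Rabs_right s1) by lra.
    pose proof (Rabs_pos a). pose proof (Rabs_pos b). pose proof (Rabs_pos l). pose proof (Rabs_pos w).
    pose proof (Rabs_pos dl). pose proof (Rabs_pos dc). pose proof (Rabs_pos m). pose proof (Rabs_pos v).
    assert (Rabs l * s1 * Rabs a <= N * 2 * Rabs a) by (apply Rmult_le_compat_r; nra).
    assert (Rabs dl * Rabs v * s1 <= Rabs dl * N * 2) by (apply Rmult_le_compat; nra).
    assert (Rabs m * Rabs v * Rabs w <= N * N * (2 * Rabs a)) by (apply Rmult_le_compat; nra).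
    assert (N <= N ^ 2) by nra.
    assert (N * Rabs a <= N ^ 2 * Rabs a) by (apply Rmult_le_compat_r; auto).
    assert (N * Rabs dl <= N ^ 2 * Rabs dl) by (apply Rmult_le_compat_r; auto).
    assert (0 <= N ^ 2 * Rabs b) by (apply Rmult_le_pos; nra).
    assert (0 <= N ^ 2 * Rabs dl) by (apply Rmult_le_pos; nra).
    assert (0 <= N ^ 2 * Rabs dc) by (apply Rmult_le_pos; nra). nra. }
  assert (T3 : Rabs (2 * c * s1 - 2 * k * s2) <= 4 * N ^ 2 * (Rabs a + Rabs b + Rabs dl + Rabs dc)).
  { replace (2 * c * s1 - 2 * k * s2) with (2 * (dc * s1) + 2 * (k * w)) by (rewrite Ec, Ew; ring).
    eapply Rle_trans; [apply Rabs_triang|]. rewrite !Rabs_mult, (Rabs_right s1), (Rabs_right 2) by lra.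
    pose proof (Rabs_pos a). pose proof (Rabs_pos b). pose proof (Rabs_pos k). pose proof (Rabs_pos w).
    pose proof (Rabs_pos dl). pose proof (Rabs_pos dc).
    assert (Rabs dc * s1 <= 2 * Rabs dc) by nra.
    assert (Rabs k * Rabs w <= N * (2 * Rabs a)) by (apply Rmult_le_compat; auto).
    assert (N <= N ^ 2) by nra.
    assert (N * Rabs a <= N ^ 2 * Rabs a) by (apply Rmult_le_compat_r; auto).
    assert (1 * Rabs dc <= N ^ 2 * Rabs dc) by (apply Rmult_le_compat_r; nra).
    assert (0 <= N ^ 2 * Rabs dl) by (apply Rmult_le_pos; nra).
    assert (0 <= N ^ 2 * Rabs b) by (apply Rmult_le_pos; nra). nra. }
  set (S := Rabs a + Rabs b + Rabs dl + Rabs dc) in *.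
  assert (G : forall z X, Rabs X <= 4 * N ^ 2 * S -> 2 * z * X <= 2 * Rabs z * (4 * N ^ 2 * S)).
  { intros z X HX. pose proof (Rle_abs (z * X)) as HH. rewrite Rabs_mult in HH.
    pose proof (Rabs_pos z). nra. }
  pose proof (G a _ T1). pose proof (G b _ T2). pose proof (G e _ T3).
  assert (F : 2 * (Rabs a + Rabs b + Rabs e) * S <=
     10 * (a ^ 2 + b ^ 2 + e ^ 2 + dl ^ 2 + dc ^ 2)).
  { rewrite <- (pow2_abs a), <- (pow2_abs b), <- (pow2_abs e),
      <- (pow2_abs dl), <- (pow2_abs dc). unfold S.
    generalize (Rabs a) (Rabs b) (Rabs e) (Rabs dl) (Rabs dc). intros A B E2 DL DC.
    pose proof (pow2_ge_0 (A - B)). pose proof (pow2_ge_0 (A - E2)). pose proof (pow2_ge_0 (A - DL)).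
    pose proof (pow2_ge_0 (A - DC)). pose proof (pow2_ge_0 (B - E2)). pose proof (pow2_ge_0 (B - DL)).
    pose proof (pow2_ge_0 (B - DC)). pose proof (pow2_ge_0 (E2 - DL)). pose proof (pow2_ge_0 (E2 - DC)).
    nra. }
  assert (0 <= N ^ 2) by nra. nra.
Qed.

(** The constant differences of [lam] and [c] are included in the squared distance, so that a change
    of parameter is treated like a change of initial data. Only the reference trajectory has to be
    bounded by [N], so the estimate is uniform in the perturbed one. *)
Lemma flow_gronwall c x u p k z v q N t1 : flow c x u p -> flow k z v q ->
  0 <= t1 -> 1 <= N -> Rabs (lam c) <= N -> Rabs (lam k) <= N -> Rabs k <= N ->
  (forall t, 0 <= t <= t1 -> Rabs (v t) <= N /\ Rabs (q t) <= N) ->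
  (u t1 - v t1) ^ 2 + (p t1 - q t1) ^ 2 + (x t1 - z t1) ^ 2 + (lam c - lam k) ^ 2 + (c - k) ^ 2 <=
  ((u 0 - v 0) ^ 2 + (p 0 - q 0) ^ 2 + (x 0 - z 0) ^ 2 + (lam c - lam k) ^ 2 + (c - k) ^ 2) *
   exp (40 * N ^ 2 * t1).
Proof.
  intros H H' Ht HN Hl Hl' Hk HB. set (K := 40 * N ^ 2).
  set (D := fun t => (u t - v t) ^ 2 + (p t - q t) ^ 2 + (x t - z t) ^ 2 +
                     (lam c - lam k) ^ 2 + (c - k) ^ 2).
  set (dD := fun t => 2 * (u t - v t) * (p t * srate (u t) - q t * srate (v t)) +
       2 * (p t - q t) * (lam c * u t * srate (u t) - lam k * v t * srate (v t)) +
       2 * (x t - z t) * (2 * c * srate (u t) - 2 * k * srate (v t))).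
  assert (DD : forall t : R, is_derive D t (dD t)).
  { intro t. unfold D, dD.
    assert (Sq : forall (f : R -> R) df, is_derive f t df -> is_derive (fun t => f t ^ 2) t (2 * f t * df)).
    { intros f df Hf. apply is_derive_ext with (fun t => f t * f t); [intros; simpl; ring|].
      apply is_derive_eq with (df * f t + f t * df); [now apply is_derive_mult_R|ring]. }
    apply is_derive_eq with (2 * (u t - v t) * (p t * srate (u t) - q t * srate (v t)) +
       2 * (p t - q t) * (lam c * u t * srate (u t) - lam k * v t * srate (v t)) +
       2 * (x t - z t) * (2 * c * srate (u t) - 2 * k * srate (v t)) + 0 + 0); [|ring].
    repeat apply is_derive_plus_R; try apply is_derive_const_R.
    - apply (Sq (fun t => u t - v t)), is_derive_minus_R; eapply flow_u; eauto.
    - apply (Sq (fun t => p t - q t)), is_derive_minus_R; eapply flow_p; eauto.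
    - apply (Sq (fun t => x t - z t)), is_derive_minus_R; eapply flow_x; eauto. }
  assert (HD : forall t, 0 <= t <= t1 -> dD t <= K * D t).
  { intros t Htt. destruct (HB t Htt). unfold dD, D, K.
    apply (gronwall_quadratic N (srate (u t)) (srate (v t)) (u t) (v t) (p t) (q t) (lam c) (lam k) c k
      (u t - v t) (p t - q t) (x t - z t) (srate (u t) - srate (v t)) (lam c - lam k) (c - k)); auto.
    - split; [apply srate_pos, (flow_gt1 _ _ _ _ H)|apply srate_lt_2].
    - apply srate_lipschitz; eapply flow_gt1; eauto. }
  fold (D t1). fold (D 0).
  assert (G : - (D 0 * exp (- K * 0)) <= - (D t1 * exp (- K * t1))).
  { apply (derive_le (fun t => - (D t * exp (- K * t)))
      (fun t => - (dD t * exp (- K * t) + D t * (- K * exp (- K * t))))); auto.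
    - intros r _. apply (is_derive_opp (fun t => D t * exp (- K * t)) r).
      apply (is_derive_mult_R D (fun t => exp (- K * t))); auto. auto_derive; auto. ring.
    - intros r Hr. pose proof (HD r Hr). pose proof (exp_pos (- K * r)). nra. }
  rewrite Rmult_0_r, exp_0 in G.
  assert (E : exp (- K * t1) * exp (K * t1) = 1).
  { rewrite <- exp_plus. replace (- K * t1 + K * t1) with 0 by ring. apply exp_0. }
  pose proof (exp_pos (K * t1)).
  assert (D t1 = D t1 * exp (- K * t1) * exp (K * t1)) as -> by (rewrite Rmult_assoc, E; ring).
  apply Rmult_le_compat_r; lra.
Qed.

Lemma lam_close c k d : Rabs (c - k) < d -> d <= 1 -> Rabs (lam c - lam k) <= 4 * (2 * Rabs k + 1) * d.
Proof.
  intros H Hd. replace (lam c - lam k) with (4 * ((k - c) * (c - k + 2 * k))) by (unfold lam; ring).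
  rewrite !Rabs_mult, (Rabs_right 4), (Rabs_minus_sym k c) by lra.
  assert (Rabs (c - k + 2 * k) <= 2 * Rabs k + 1).
  { eapply Rle_trans; [apply Rabs_triang|]. rewrite Rabs_mult, (Rabs_right 2) by lra. lra. }
  pose proof (Rabs_pos (c - k)). pose proof (Rabs_pos (c - k + 2 * k)).
  assert (Rabs (c - k) * Rabs (c - k + 2 * k) <= d * (2 * Rabs k + 1)) by (apply Rmult_le_compat; lra).
  lra.
Qed.

Lemma flow_dependence k z v q t1 e : flow k z v q -> 0 <= t1 -> 0 < e ->
  exists d, 0 < d /\ forall c x u p, flow c x u p -> x 0 = z 0 -> u 0 = v 0 ->
    Rabs (c - k) < d -> Rabs (p 0 - q 0) < d ->
    Rabs (x t1 - z t1) < e /\ Rabs (u t1 - v t1) < e /\ Rabs (p t1 - q t1) < e.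
Proof.
  intros H Ht He.
  set (L := 4 * (2 * Rabs k + 1)). assert (HL : 4 <= L) by (unfold L; pose proof (Rabs_pos k); lra).
  (* The last summand bounds [v] and [q] up to time [t1], because [v <= v 0 * exp (4 t)] and
     [|q| < 2 v]; the summand [L] covers [lam c] for [|c - k| < 1]. *)
  set (N := 1 + Rabs (lam k) + L + Rabs k + 2 * (v 0 * exp (4 * t1))).
  pose proof (flow_gt1 _ _ _ _ H) as V.
  assert (HB : forall t, 0 <= t <= t1 -> Rabs (v t) <= N /\ Rabs (q t) <= N).
  { intros t Htt. pose proof (flow_u_exp _ _ _ _ H t ltac:(lra)). pose proof (flow_p_lt _ _ _ _ H t).
    assert (exp (4 * t) <= exp (4 * t1)).
    { destruct (proj2 Htt) as [Hlt| ->]; [left; apply exp_increasing; lra|lra]. }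
    pose proof (V t). pose proof (V 0). pose proof (Rabs_pos (lam k)). pose proof (Rabs_pos k).
    assert (v 0 * exp (4 * t) <= v 0 * exp (4 * t1)) by (apply Rmult_le_compat_l; lra).
    rewrite (Rabs_right (v t)) by lra. unfold N. split; lra. }
  assert (HN : 1 <= N).
  { unfold N. pose proof (V 0). pose proof (exp_pos (4 * t1)). pose proof (Rabs_pos (lam k)).
    pose proof (Rabs_pos k). nra. }
  set (X := exp (40 * N ^ 2 * t1)). assert (HX : 0 < X) by apply exp_pos.
  set (Z := (L ^ 2 + 2) * X). assert (HZ : 0 < Z) by (unfold Z; apply Rmult_lt_0_compat; nra).
  exists (Rmin 1 (e ^ 2 / (4 * Z))). 
  set (d := Rmin 1 (e ^ 2 / (4 * Z))).
  assert (Hd1 : d <= 1) by apply Rmin_l.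
  assert (Hd2 : d <= e ^ 2 / (4 * Z)) by apply Rmin_r.
  assert (Hd : 0 < d).
  { apply Rmin_glb_lt; [lra|]. apply Rdiv_lt_0_compat; nra. }
  split; auto. intros c x u p F Ex Eu Hc Hp.
  pose proof (lam_close c k d Hc Hd1) as Hl. fold L in Hl.
  assert (Hlc : Rabs (lam c) <= N).
  { replace (lam c) with (lam c - lam k + lam k) by ring.
    eapply Rle_trans; [apply Rabs_triang|]. pose proof (V 0). pose proof (exp_pos (4 * t1)).
    pose proof (Rabs_pos k).
    assert (0 < v 0 * exp (4 * t1)) by (apply Rmult_lt_0_compat; lra). unfold N. nra. }
  assert (G := flow_gronwall c x u p k z v q N t1 F H Ht HN Hlc).
  assert (Hk2 : Rabs (lam k) <= N /\ Rabs k <= N).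
  { pose proof (V 0). pose proof (exp_pos (4 * t1)).
    assert (0 < v 0 * exp (4 * t1)) by (apply Rmult_lt_0_compat; lra).
    pose proof (Rabs_pos k). pose proof (Rabs_pos (lam k)). unfold N. lra. }
  specialize (G (proj1 Hk2) (proj2 Hk2) HB). fold X in G.
  rewrite Ex, Eu in G.
  assert (A1 : (p 0 - q 0) ^ 2 <= d ^ 2) by (apply Rabs_def2 in Hp; nra).
  assert (A2 : (c - k) ^ 2 <= d ^ 2) by (apply Rabs_def2 in Hc; nra).
  assert (A3 : (lam c - lam k) ^ 2 <= L ^ 2 * d ^ 2).
  { rewrite <- Rpow_mult_distr. apply abs_le_inv in Hl. nra. }
  assert (T : (u t1 - v t1) ^ 2 + (p t1 - q t1) ^ 2 + (x t1 - z t1) ^ 2 <= Z * d ^ 2).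
  { assert (((v 0 - v 0) ^ 2 + (p 0 - q 0) ^ 2 + (z 0 - z 0) ^ 2 + (lam c - lam k) ^ 2 +
       (c - k) ^ 2) * X <= ((L ^ 2 + 2) * d ^ 2) * X) by (apply Rmult_le_compat_r; nra).
    pose proof (pow2_ge_0 (lam c - lam k)). pose proof (pow2_ge_0 (c - k)). unfold Z. nra. }
  assert (T2 : Z * d ^ 2 < e ^ 2).
  { assert (Z * d <= Z * (e ^ 2 / (4 * Z))) by (apply Rmult_le_compat_l; lra).
    replace (Z * (e ^ 2 / (4 * Z))) with (e ^ 2 / 4) in H0 by (field; lra).
    assert (Z * d ^ 2 <= Z * d) by (apply Rmult_le_compat_l; [lra|]; clear - Hd Hd1; nra).
    assert (0 < e ^ 2) by (clear - He; nra). lra. }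
  pose proof (pow2_ge_0 (u t1 - v t1)). pose proof (pow2_ge_0 (p t1 - q t1)).
  pose proof (pow2_ge_0 (x t1 - z t1)).
  assert (Q : forall r, r ^ 2 < e ^ 2 -> Rabs r < e).
  { intros r Hr. apply Rabs_def1; clear - Hr He; apply Rnot_le_lt; intro; nra. }
  repeat split; apply Q; lra.
Qed.

(** * Uniform convergence in cones *)

(** Uniform convergence in a cone: one time [T] serves all trajectories from the same point whose
    direction, encoded by [c] and [p 0], is close to the reference. This is what a truncated cone
    asks for. *)
Definition cone_limit (k : R) (z v q : R -> R) (w : R * R) : Prop :=
  forall e, 0 < e -> exists d T, 0 < d /\
    forall c x u p, flow c x u p -> x 0 = z 0 -> u 0 = v 0 ->
      Rabs (c - k) < d -> Rabs (p 0 - q 0) < d -> forall t, T <= t ->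
      Rabs (fst (Phi0 (x t, acosh (u t))) - fst w) < e /\
      Rabs (snd (Phi0 (x t, acosh (u t))) - snd w) < e.

Lemma cone_limit_conv k z v q w : flow k z v q -> cone_limit k z v q w ->
  conv_to (fun t => Phi0 (z t, acosh (v t))) w.
Proof.
  intros F H e He. destruct (H e He) as (d & T & Hd & HT). exists T.
  apply (HT k z v q); auto; rewrite Rminus_eq_0, Rabs_R0; auto.
Qed.

Lemma acosh_lt u e : 1 <= u -> 0 < e -> u < cosh e -> acosh u < e.
Proof. intros Hu He H. apply cosh_lt_inv; [lra|]. rewrite cosh_acosh; auto. Qed.

Lemma sqrt_close a b d : 0 < b -> 0 <= a -> Rabs (a - b) <= d -> Rabs (sqrt a - sqrt b) <= d / sqrt b.
Proof.
  intros Hb Ha H. pose proof (sqrt_lt_R0 _ Hb). pose proof (sqrt_pos a).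
  replace (sqrt a - sqrt b) with ((a - b) / (sqrt a + sqrt b)).
  - apply div_abs_le; lra.
  - rewrite <- (sqrt_sqrt a) at 1 by lra. rewrite <- (sqrt_sqrt b) at 1 by lra. field. lra.
Qed.

Lemma lag_bound_nonneg a : 1 < a -> 0 <= lag_bound a.
Proof.
  intros Ha. unfold lag_bound. rewrite <- ln_1. apply ln_le; [lra|].
  apply (Rmult_le_reg_r (a ^ 2 - 1)); [nra|].
  unfold Rdiv. rewrite Rmult_assoc, Rinv_l by nra. nra.
Qed.

(** Near a direction with [lam k > 0] one still has [lam c >= lam k / 2], so the linear asymptotics
    hold with a common constant [K]; Gronwall is not called for. *)
Lemma cone_limit_up k z v q : flow k z v q -> 0 < lam k -> 0 < q 0 ->
  cone_limit k z v q (2 * k, sqrt (lam k)).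
Proof.
  intros F L Hq e He. pose proof (flow_gt1 _ _ _ _ F 0) as V.
  set (K := Rabs (z 0) + (ln (6 * v 0) - ln (sqrt (lam k / 2))) + lag_bound (v 0)).
  set (M := 4 * (2 * Rabs k + 1)). assert (HM : 4 <= M) by (unfold M; pose proof (Rabs_pos k); lra).
  pose proof (sqrt_lt_R0 _ L) as Ls.
  (* The bounds keep in turn: [lam_close] applicable, [p 0 > 0], [lam c >= lam k / 2],
     [2 |c - k| <= e / 4], and the two square roots within [e / 4]. *)
  set (d := Rmin (Rmin 1 (q 0)) (Rmin (lam k / (2 * M)) (Rmin (e / 8) (e * sqrt (lam k) / (4 * M))))).
  assert (Hd : 0 < d).
  { unfold d. repeat apply Rmin_glb_lt; try lra; apply Rdiv_lt_0_compat; try lra; nra. }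
  assert (Hd1 : d <= 1 /\ d <= q 0).
  { split; (eapply Rle_trans; [apply Rmin_l|]); [apply Rmin_l|apply Rmin_r]. }
  assert (Hd3 : d <= lam k / (2 * M)). { eapply Rle_trans; [apply Rmin_r|apply Rmin_l]. }
  assert (Hd4 : d <= e / 8).
  { eapply Rle_trans; [apply Rmin_r|]. eapply Rle_trans; [apply Rmin_r|apply Rmin_l]. }
  assert (Hd5 : d <= e * sqrt (lam k) / (4 * M)).
  { eapply Rle_trans; [apply Rmin_r|]. eapply Rle_trans; [apply Rmin_r|apply Rmin_r]. }
  assert (HLn : 0 <= ln (6 * v 0) - ln (sqrt (lam k / 2))).
  { assert (ln 1 <= ln (6 * v 0)) by (apply ln_le; lra). rewrite ln_1 in *.
    assert (ln (sqrt (lam k / 2)) <= ln 1); [|rewrite ln_1 in *; lra].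
    apply ln_le; [apply sqrt_lt_R0; lra|]. rewrite <- sqrt_1. apply sqrt_le_1_alt.
    pose proof (lam_le_1 k). lra. }
  assert (HK : 0 <= K).
  { unfold K. pose proof (Rabs_pos (z 0)). pose proof (lag_bound_nonneg _ V). lra. }
  set (T := 2 * K + (1 + 5 * K) / e + 1).
  exists d, T. split; auto.
  intros c x u p Fc Ex Eu Hc Hp t Ht.
  assert (Hfrac : 0 < (1 + 5 * K) / e) by (apply Rdiv_lt_0_compat; lra).
  assert (Ht0 : 0 <= t) by (unfold T in Ht; lra).
  pose proof (lam_close c k d Hc (proj1 Hd1)) as Hl. fold M in Hl.
  assert (HMd : M * d <= lam k / 2).
  { apply Rle_trans with (M * (lam k / (2 * M))); [apply Rmult_le_compat_l; lra|right; field; lra]. }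
  pose proof Hl as Hl'. apply abs_le_inv in Hl'.
  assert (Lc : lam k / 2 <= lam c) by lra.
  assert (Pc : 0 < p 0). { apply Rabs_def2 in Hp. lra. }
  destruct (Phi0_far_direction (2 * c) (sqrt (lam c)) K t (x t) (acosh (u t))) as [B1 B2].
  - rewrite pow2_sqrt by lra. unfold lam. ring.
  - exact HK.
  - unfold T in Ht. lra.
  - eapply Rle_trans; [apply (flow_up_x_linear _ _ _ _ Fc); lra|]. rewrite Ex, Eu. unfold K. lra.
  - eapply Rle_trans; [apply (flow_up_y_linear _ _ _ _ Fc); lra|]. rewrite Eu. unfold K.
    assert (ln (sqrt (lam k / 2)) <= ln (sqrt (lam c))).
    { apply ln_le; [apply sqrt_lt_R0; lra|]. apply sqrt_le_1_alt. lra. }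
    pose proof (Rabs_pos (z 0)). lra.
  - assert (Hb : (1 + 5 * K) / (2 * t - 4 * K) <= e / 2).
    { apply (Rmult_le_reg_r (2 * t - 4 * K)); [unfold T in Ht; lra|].
      unfold Rdiv at 1. rewrite Rmult_assoc, Rinv_l by (unfold T in Ht; lra).
      assert (e / 2 * (2 * ((1 + 5 * K) / e)) <= e / 2 * (2 * t - 4 * K)).
      { apply Rmult_le_compat_l; unfold T in Ht; lra. }
      replace (e / 2 * (2 * ((1 + 5 * K) / e))) with (1 + 5 * K) in H by (field; lra). lra. }
    unfold Phi0; cbn [fst snd]. split.
    + replace (x t / Rad (x t) (acosh (u t)) - 2 * k) with
        ((x t / Rad (x t) (acosh (u t)) - 2 * c) + 2 * (c - k)) by ring.
      eapply Rle_lt_trans; [apply Rabs_triang|]. rewrite (Rabs_mult 2), (Rabs_right 2) by lra. lra.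
    + replace (acosh (u t) / Rad (x t) (acosh (u t)) - sqrt (lam k)) with
        ((acosh (u t) / Rad (x t) (acosh (u t)) - sqrt (lam c)) + (sqrt (lam c) - sqrt (lam k))) by ring.
      eapply Rle_lt_trans; [apply Rabs_triang|].
      pose proof (sqrt_close (lam c) (lam k) (M * d) L ltac:(lra) Hl) as Hs.
      assert (M * d / sqrt (lam k) <= e / 4).
      { apply (Rmult_le_reg_r (sqrt (lam k))); auto. unfold Rdiv. rewrite Rmult_assoc, Rinv_l by lra.
        assert (M * d <= M * (e * sqrt (lam k) / (4 * M))) by (apply Rmult_le_compat_l; lra).
        replace (M * (e * sqrt (lam k) / (4 * M))) with (e * / 4 * sqrt (lam k)) in H by (field; lra).
        lra. }
      lra.
Qed.

(** The reference is followed until [z] exceeds [X + 1]; by continuous dependence a neighbour then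
    has [x > X]. From there [x] never decreases and [flow_crit_y] bounds the slope, so the neighbour
    stays near the corner whether it rises or falls. *)
Lemma cone_limit_crit_pos k z v q : flow k z v q -> lam k = 0 -> 0 < k -> 0 < q 0 ->
  cone_limit k z v q (2 * k, 0).
Proof.
  intros F L Hk Hq e He. pose proof (flow_gt1 _ _ _ _ F 0) as V.
  assert (k = 1 / 2) by (unfold lam in L; nra).
  set (e' := Rmin 1 (e / 4)).
  assert (He' : 0 < e') by (apply Rmin_glb_lt; lra).
  assert (He1 : e' <= e / 4) by apply Rmin_r.
  set (B := Rmax (crit_height e') (acosh (v 0))).
  set (X := (1 + Rabs B + Rabs (z 0) + 1) / e').
  set (t1 := Rabs (X + 1) + Rabs (z 0) + lag_bound (v 0) + 1).
  assert (Hlag : 0 <= lag_bound (v 0)).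
  { now apply lag_bound_nonneg. }
  assert (Ht1 : 0 <= t1). { unfold t1. pose proof (Rabs_pos (X + 1)). pose proof (Rabs_pos (z 0)). lra. }
  assert (Hz : X + 1 < z t1).
  { pose proof (flow_up_x_linear _ _ _ _ F ltac:(lra) Hq t1 Ht1) as HH. apply abs_le_inv in HH.
    subst k. unfold t1 in *. pose proof (Rle_abs (X + 1)). pose proof (Rabs_pos (X + 1)).
    pose proof (Rabs_pos (z 0)). lra. }
  destruct (flow_dependence k z v q t1 1 F Ht1 ltac:(lra)) as (d1 & Hd1 & Dep).
  set (d := Rmin d1 (Rmin (1 / 64) (e' ^ 2 / 64))).
  assert (Hd : 0 < d). { unfold d. repeat apply Rmin_glb_lt; try lra. nra. }
  assert (D1 : d <= d1) by apply Rmin_l.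
  assert (D2 : d <= 1 / 64). { eapply Rle_trans; [apply Rmin_r|apply Rmin_l]. }
  assert (D3 : d <= e' ^ 2 / 64). { eapply Rle_trans; [apply Rmin_r|apply Rmin_r]. }
  exists d, t1. split; auto. intros c x u p Fc Ex Eu Hc Hp t Ht.
  pose proof (lam_close c k d Hc ltac:(lra)) as Hl. rewrite L, Rminus_0_r in Hl.
  rewrite (Rabs_right k) in Hl by lra. replace (4 * (2 * k + 1) * d) with (8 * d) in Hl by (subst k; field).
  destruct (Dep c x u p Fc Ex Eu ltac:(lra) ltac:(lra)) as (Dx & _ & _). apply Rabs_def2 in Dx.
  assert (Hc0 : 0 < c). { apply Rabs_def2 in Hc. lra. }
  pose proof (flow_x_incr _ _ _ _ Fc ltac:(lra) t1 t Ht).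
  assert (HX : e' * X = 1 + Rabs B + Rabs (z 0) + 1) by (unfold X; field; lra).
  pose proof (Rabs_pos B). pose proof (Rle_abs B). pose proof (Rabs_pos (z 0)).
  pose proof (Rle_abs (- z 0)) as Hz0. rewrite Rabs_Ropp in Hz0.
  assert (He2 : e' <= 1) by apply Rmin_l.
  destruct (Phi0_near_corner e' (B - e' * z 0) X (x t) (acosh (u t))) as [B1 B2]; auto; try nra.
  - left. apply acosh_pos, (flow_gt1 _ _ _ _ Fc).
  - replace (B - e' * z 0 + e' * x t) with (B + e' * (x t - x 0)) by (rewrite Ex; ring).
    unfold B. rewrite <- Eu. apply (flow_crit_y _ _ _ _ e' Fc); auto; lra.
  - unfold Phi0; cbn [fst snd]. rewrite Rminus_0_r. replace (2 * k) with 1 by lra. lra.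
Qed.

Lemma cone_limit_crit k z v q : flow k z v q -> lam k = 0 -> 0 < q 0 ->
  cone_limit k z v q (2 * k, 0).
Proof.
  intros F L Hq. destruct (Rlt_dec 0 k) as [Hk|Hk]; [now apply cone_limit_crit_pos|].
  assert (k = - (1 / 2)) by (unfold lam in L; nra).
  assert (C : cone_limit (- k) (fun t => - z t) v q (2 * - k, 0)).
  { apply cone_limit_crit_pos; auto; [now apply flow_reflect| |lra].
    unfold lam in *. nra. }
  intros e He. destruct (C e He) as (d & T & Hd & HT). exists d, T. split; auto.
  intros c x u p Fc Ex Eu Hc Hp t Ht.
  destruct (HT (- c) (fun t => - x t) u p (flow_reflect _ _ _ _ Fc) ltac:(lra) Eu) with (t := t)
    as [A B]; auto.
  { replace (- c - - k) with (- (c - k)) by ring. now rewrite Rabs_Ropp. }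
  rewrite Phi0_reflect in A, B. cbn [fst snd] in A, B |- *. split; auto.
  rewrite <- Rabs_Ropp. replace (- (fst (Phi0 (x t, acosh (u t))) - 2 * k)) with
    (- fst (Phi0 (x t, acosh (u t))) - 2 * - k) by ring. exact A.
Qed.

Lemma flow_down_conv c x u p t1 d xi : flow c x u p -> 0 < d <= 1 -> p t1 <= - d ->
  (forall t, t1 <= t -> Rabs (x t - xi) <= 2 * Rabs c / d * (u t - 1)) ->
  conv_to (fun t => (x t, acosh (u t))) (xi, 0).
Proof.
  intros F Hd Hp Hx e He. pose proof (flow_gt1 _ _ _ _ F) as U.
  set (k := 2 * Rabs c / d) in *.
  assert (Hk : 0 <= k). { unfold k. apply Rle_mult_inv_pos; [|lra]. pose proof (Rabs_pos c); lra. }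
  pose proof (cosh_gt_1 e He) as Ch.
  set (eta := Rmin (cosh e - 1) (e / (k + 1))).
  assert (Heta : 0 < eta). { apply Rmin_glb_lt; [lra|]. apply Rdiv_lt_0_compat; lra. }
  assert (H1 : eta <= cosh e - 1) by apply Rmin_l.
  assert (H2 : eta <= e / (k + 1)) by apply Rmin_r.
  destruct (flow_down_lim _ _ _ _ _ _ F Hd Hp eta Heta) as (T & HT1 & HT).
  exists T. intros t Ht. cbn [fst snd]. pose proof (HT t Ht). pose proof (U t). split.
  - eapply Rle_lt_trans; [apply Hx; lra|].
    apply Rle_lt_trans with (k * eta); [apply Rmult_le_compat_l; lra|].
    apply Rle_lt_trans with (k * (e / (k + 1))); [apply Rmult_le_compat_l; lra|].
    apply (Rmult_lt_reg_r (k + 1)); [lra|].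
    replace (k * (e / (k + 1)) * (k + 1)) with (k * e) by (field; lra). nra.
  - pose proof (acosh_pos (u t) (U t)). rewrite Rminus_0_r, Rabs_right by lra.
    apply acosh_lt; lra.
Qed.

Lemma Phi0_bottom xi : Phi0 (xi, 0) = (squash xi, 0).
Proof. unfold Phi0, squash; simpl. f_equal. unfold Rdiv. ring. Qed.

Lemma conv_to_Phi0 g xi : conv_to g (xi, 0) -> conv_to (fun t => Phi0 (g t)) (squash xi, 0).
Proof.
  intros H e He. destruct (Phi0_continuous xi 0 e He) as (d & Hd & HC).
  destruct (H d Hd) as [T HT]. exists T. intros t Ht. destruct (HT t Ht) as [A B].
  rewrite <- Phi0_bottom. destruct (g t) as [a b]. cbn [fst snd] in *. now apply HC.
Qed.

(** At a late time [T] the reference is close to [(xi, 0)] and still falling, hence so is a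
    neighbour. From then on the neighbour is trapped: its height only decreases and its drift is at
    most [K * eta]. *)
Lemma cone_limit_down k z v q t1 d xi : flow k z v q -> 0 <= t1 -> 0 < d <= 1 -> q t1 <= - d ->
  (forall t, t1 <= t -> Rabs (z t - xi) <= 2 * Rabs k / d * (v t - 1)) ->
  cone_limit k z v q (squash xi, 0).
Proof.
  intros F Ht1 Hd Hq Hx e He. pose proof (flow_gt1 _ _ _ _ F) as V.
  destruct (Phi0_continuous xi 0 e He) as (r & Hr & HC).
  (* The drift constant of [flow_down_x] for all neighbours at once, with [|c| <= |k| + 1] and
     [p T <= - d / 2]. *)
  set (K := 2 * (Rabs k + 1) / (d / 2)).
  assert (HK : 0 < K). { unfold K. apply Rdiv_lt_0_compat; [|lra]. pose proof (Rabs_pos k); lra. }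
  pose proof (cosh_gt_1 r Hr) as Ch.
  set (eta := Rmin (cosh r - 1) (r / (4 * K))).
  assert (Heta : 0 < eta). { apply Rmin_glb_lt; [lra|]. apply Rdiv_lt_0_compat; lra. }
  assert (E1 : eta <= cosh r - 1) by apply Rmin_l.
  assert (E2 : eta <= r / (4 * K)) by apply Rmin_r.
  destruct (flow_down_lim _ _ _ _ _ _ F Hd Hq (eta / 2) ltac:(lra)) as (T1 & HT1 & HT1').
  destruct (flow_down_conv _ _ _ _ _ _ _ F Hd Hq Hx (r / 2) ltac:(lra)) as (T2 & HT2).
  set (T := Rmax T1 T2). assert (T1 <= T) by apply Rmax_l. assert (T2 <= T) by apply Rmax_r.
  set (e1 := Rmin (d / 2) (Rmin (eta / 2) (r / 4))).
  assert (He1 : 0 < e1) by (unfold e1; repeat apply Rmin_glb_lt; lra).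
  assert (F1 : e1 <= d / 2) by apply Rmin_l.
  assert (F2 : e1 <= eta / 2). { eapply Rle_trans; [apply Rmin_r|apply Rmin_l]. }
  assert (F3 : e1 <= r / 4). { eapply Rle_trans; [apply Rmin_r|apply Rmin_r]. }
  destruct (flow_dependence k z v q T e1 F ltac:(lra) He1) as (d1 & Hd1 & Dep).
  exists (Rmin d1 1), T. assert (Rmin d1 1 <= d1) by apply Rmin_l. assert (Rmin d1 1 <= 1) by apply Rmin_r.
  split. { apply Rmin_glb_lt; lra. }
  intros c x u p Fc Ex Eu Hc Hp t Ht. pose proof (flow_gt1 _ _ _ _ Fc) as U.
  destruct (Dep c x u p Fc Ex Eu ltac:(lra) ltac:(lra)) as (Dx & Du & Dp).
  apply Rabs_def2 in Du, Dp, Dx.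
  pose proof (flow_neg_stays _ _ _ _ _ _ F Hd Hq T ltac:(lra)).
  assert (HpT : p T <= - (d / 2)) by lra.
  assert (HuT : u T < 1 + eta). { pose proof (HT1' T ltac:(lra)). lra. }
  pose proof (flow_down_u _ _ _ _ T (d / 2) Fc ltac:(lra) HpT T t ltac:(lra) Ht).
  pose proof (flow_down_x _ _ _ _ T (d / 2) Fc ltac:(lra) HpT T t ltac:(lra) Ht) as DX.
  assert (DX' : Rabs (x t - x T) <= r / 4).
  { eapply Rle_trans; [exact DX|].
    apply Rle_trans with (K * eta).
    - apply Rmult_le_compat.
      + apply Rle_mult_inv_pos; [|lra]. pose proof (Rabs_pos c); lra.
      + lra.
      + unfold K. apply Rmult_le_compat_r; [left; apply Rinv_0_lt_compat; lra|].
        assert (Rabs c <= Rabs k + 1); [|lra]. replace c with (k + (c - k)) by ring.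
        eapply Rle_trans; [apply Rabs_triang|]. lra.
      + pose proof (U t). lra.
    - apply Rle_trans with (K * (r / (4 * K))); [apply Rmult_le_compat_l; lra|right; field; lra]. }
  destruct (HT2 T ltac:(lra)) as [Hz _]. cbn [fst] in Hz. apply Rabs_def2 in Hz.
  apply abs_le_inv in DX'. rewrite <- Phi0_bottom. apply HC.
  - apply Rabs_def1; lra.
  - pose proof (acosh_pos (u t) (U t)). rewrite Rminus_0_r, Rabs_right by lra.
    pose proof (U t). apply acosh_lt; lra.
Qed.

(** * Distance estimates *)

Lemma sinh_ge_id y : 0 <= y -> y <= sinh y.
Proof.
  intros Hy. assert (sinh 0 - 0 <= sinh y - y); [|rewrite sinh_0 in *; lra].
  apply (derive_le (fun y => sinh y - y) (fun y => cosh y - 1)); auto.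
  - intros t _. apply is_derive_minus_R; [apply is_derive_sinh|apply is_derive_id_R].
  - intros t _. pose proof (cosh_ge_1 t). lra.
Qed.

Lemma sinh_le_id_cosh y : 0 <= y -> sinh y <= y * cosh y.
Proof.
  intros Hy. assert (0 * cosh 0 - sinh 0 <= y * cosh y - sinh y); [|rewrite sinh_0 in *; lra].
  apply (derive_le (fun y => y * cosh y - sinh y) (fun y => 1 * cosh y + y * sinh y - cosh y)); auto.
  - intros t _. apply is_derive_minus_R; [|apply is_derive_sinh].
    apply (is_derive_mult_R (fun y => y) cosh); [apply is_derive_id_R|apply is_derive_cosh].
  - intros t [Ht _]. assert (0 <= sinh t); [|nra].
    destruct Ht as [H|<-]; [left; now apply sinh_pos|rewrite sinh_0; lra].
Qed.

Lemma P_split y : 0 < y -> P y = 1 / 4 + 3 / 4 * / sinh y ^ 2.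
Proof. intros H. rewrite P_sinh by auto. pose proof (sinh_pos y H). field. lra. Qed.

Lemma P_ge_quarter y : 0 < y -> 1 / 4 <= P y.
Proof.
  intros H. rewrite P_split by auto. pose proof (sinh_pos y H).
  assert (0 < / sinh y ^ 2) by (apply Rinv_0_lt_compat; nra). lra.
Qed.

(** From [sinh y <= y cosh y] follows [sinh y ^ 2 <= y ^ 2 (1 + sinh y ^ 2)]. This comparison makes
    half of [ln y] and half of a hyperbolic Busemann function 1-Lipschitz. *)
Lemma P_ge_hyperbolic y : 0 < y -> / (4 * y ^ 2) <= P y.
Proof.
  intros H. rewrite P_sinh by auto. pose proof (sinh_pos y H) as Hs.
  pose proof (sinh_le_id_cosh y ltac:(lra)) as Hc. pose proof (cosh_sq y) as E.
  set (s := sinh y) in *. set (c := cosh y) in *.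
  assert (Hs2 : 0 < s ^ 2) by nra. assert (Hy2 : 0 < y ^ 2) by nra.
  assert (s ^ 2 <= y ^ 2 * (1 + s ^ 2)).
  { rewrite <- E. replace (y ^ 2 * c ^ 2) with ((y * c) ^ 2) by ring. nra. }
  apply (Rmult_le_reg_r (4 * y ^ 2 * s ^ 2)); [nra|].
  replace (/ (4 * y ^ 2) * (4 * y ^ 2 * s ^ 2)) with (s ^ 2) by (field; lra).
  replace ((3 + s ^ 2) / (4 * s ^ 2) * (4 * y ^ 2 * s ^ 2)) with ((3 + s ^ 2) * y ^ 2) by (field; lra).
  nra.
Qed.

Lemma P_le_sq y : 0 < y -> P y <= (1 / 2 + / y) ^ 2.
Proof.
  intros H. rewrite P_split by auto. pose proof (sinh_ge_id y ltac:(lra)).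
  assert (0 < / y) by now apply Rinv_0_lt_compat.
  assert (/ sinh y ^ 2 <= (/ y) ^ 2).
  { rewrite <- pow_inv.
    assert (/ sinh y <= / y) by (apply Rinv_le_contravar; lra).
    assert (0 < / sinh y) by (apply Rinv_0_lt_compat; lra). nra. }
  nra.
Qed.

Lemma continuity_pt_speed (c : R -> R * R) (d1 d2 : R -> R) s :
  0 < snd (c s) -> continuity_pt (fun u => snd (c u)) s -> continuity_pt d1 s -> continuity_pt d2 s ->
  continuity_pt (fun s => sqrt (P (snd (c s)) * (d1 s ^ 2 + d2 s ^ 2))) s.
Proof.
  intros Hy Hc H1 H2.
  assert (Sq : forall d, continuity_pt d s -> continuity_pt (fun s => d s ^ 2) s).
  { intros d Hd. apply (continuity_pt_comp d (fun x => x ^ 2)); auto.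
    apply derivable_continuous_pt, derivable_pt_pow. }
  apply (continuity_pt_comp (fun s => P (snd (c s)) * (d1 s ^ 2 + d2 s ^ 2)) sqrt).
  - apply (continuity_pt_mult (fun s => P (snd (c s))) (fun s => d1 s ^ 2 + d2 s ^ 2)).
    + apply (continuity_pt_comp (fun s => snd (c s)) P); auto.
      apply continuity_pt_filterlim, (ex_derive_continuous P). eexists. now apply is_derive_P.
    + apply (continuity_pt_plus (fun s => d1 s ^ 2) (fun s => d2 s ^ 2)); auto.
  - apply continuity_pt_sqrt. pose proof (P_ge_quarter _ Hy). apply Rmult_le_pos; nra.
Qed.

Lemma integral_ge_increment (f phi dphi : R -> R) (pr : Riemann_integrable f 0 1) :
  (forall s, 0 <= s <= 1 -> continuity_pt f s) ->
  (forall s : R, 0 <= s <= 1 -> is_derive phi s (dphi s) /\ dphi s <= f s) ->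
  phi 1 - phi 0 <= RiemannInt pr.
Proof.
  intros Hf Hphi.
  (* The integrand is continued outside [[0, 1]] to a function continuous everywhere, so that its
     integral is differentiable at the end points too. *)
  destruct (C0_extension_le (T := R_UniformSpace) f 0 1) as [h [Hh Eh]].
  { intros c Hc. apply continuity_pt_filterlim. auto. }
  rewrite <- RInt_Reals.
  rewrite (RInt_ext f h 0 1).
  2:{ intros x Hx. rewrite Rmin_left, Rmax_right in Hx by lra. symmetry. apply Eh; lra. }
  assert (DI : forall s : R, is_derive (fun s => RInt h 0 s) s (h s)).
  { intro s. apply (is_derive_RInt h (fun s => RInt h 0 s) 0 s); [|apply Hh].
    apply filter_forall. intro b. apply (@RInt_correct R_CompleteNormedModule).
    apply (@ex_RInt_continuous R_CompleteNormedModule). intros z _. apply Hh. }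
  assert (G : RInt h 0 0 - phi 0 <= RInt h 0 1 - phi 1).
  { apply (derive_le (fun s => RInt h 0 s - phi s) (fun s => h s - dphi s)); [| |lra].
    - intros t Ht. apply is_derive_minus_R; [apply DI|apply Hphi, Ht].
    - intros t Ht. rewrite (Eh t Ht). pose proof (proj2 (Hphi t Ht)). lra. }
  rewrite (RInt_point 0 h) in G. unfold zero in G; simpl in G. lra.
Qed.

(* 1-Lipschitz for the metric, tested along curves. *)
Definition short (F : R * R -> R) : Prop :=
  forall (c : R -> R * R) (s d1 d2 : R), 0 < snd (c s) ->
    is_derive (fun u => fst (c u)) s d1 -> is_derive (fun u => snd (c u)) s d2 ->
    exists A B, is_derive (fun u => F (c u)) s (A * d1 + B * d2) /\ A ^ 2 + B ^ 2 <= P (snd (c s)).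

Lemma short_dist F q1 q2 r : short F -> dist_le q1 q2 r -> F q2 - F q1 <= r.
Proof.
  intros HF Hd. apply le_epsilon. intros e He.
  destruct (Hd e He) as (c & d1 & d2 & E0 & E1 & Hc & pr & Hpr).
  eapply Rle_trans; [|exact Hpr]. rewrite <- E0, <- E1.
  assert (Cs : forall s, 0 <= s <= 1 -> continuity_pt
     (fun s => sqrt (P (snd (c s)) * (d1 s ^ 2 + d2 s ^ 2))) s).
  { intros s Hs. destruct (Hc s Hs) as (Hy & D1 & D2 & C1 & C2). apply continuity_pt_speed; auto.
    apply derivable_continuous_pt. exists (d2 s). exact D2. }
  apply (integral_ge_increment _ (fun s => F (c s)) (fun s => Derive (fun s => F (c s)) s) pr Cs).
  intros s Hs. destruct (Hc s Hs) as (Hy & D1 & D2 & _ & _).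
  destruct (HF c s (d1 s) (d2 s) Hy) as (A & B & DF & AB).
  { now apply is_derive_Reals. } { now apply is_derive_Reals. }
  assert (EQ : Derive (fun s => F (c s)) s = A * d1 s + B * d2 s) by (apply is_derive_unique, DF).
  rewrite EQ. split; auto.
  apply Rle_trans with (Rabs (A * d1 s + B * d2 s)); [apply Rle_abs|].
  rewrite <- sqrt_Rsqr_abs. apply sqrt_le_1_alt. unfold Rsqr.
  pose proof (pow2_ge_0 (A * d2 s - B * d1 s)).
  assert ((A ^ 2 + B ^ 2) * (d1 s ^ 2 + d2 s ^ 2) <= P (snd (c s)) * (d1 s ^ 2 + d2 s ^ 2))
    by (apply Rmult_le_compat_r; nra). nra.
Qed.

Lemma short_x k : Rabs k <= 1 / 2 -> short (fun q => k * fst q).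
Proof.
  intros Hk c s d1 d2 Hy D1 D2. exists k, 0. apply abs_le_inv in Hk. split.
  - apply is_derive_eq with (k * d1); [now apply (is_derive_scal_R (fun u => fst (c u)))|ring].
  - pose proof (P_ge_quarter _ Hy). nra.
Qed.

Lemma short_y k : Rabs k <= 1 / 2 -> short (fun q => k * snd q).
Proof.
  intros Hk c s d1 d2 Hy D1 D2. exists 0, k. apply abs_le_inv in Hk. split.
  - apply is_derive_eq with (k * d2); [now apply (is_derive_scal_R (fun u => snd (c u)))|ring].
  - pose proof (P_ge_quarter _ Hy). nra.
Qed.

Lemma short_ln_y k : Rabs k <= 1 / 2 -> short (fun q => k * ln (snd q)).
Proof.
  intros Hk c s d1 d2 Hy D1 D2. exists 0, (k / snd (c s)). apply abs_le_inv in Hk. split.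
  - apply is_derive_eq with (k * (d2 / snd (c s))); [|field; lra].
    apply (is_derive_scal_R (fun u => ln (snd (c u)))).
    now apply (is_derive_ln_comp (fun u => snd (c u))).
  - eapply Rle_trans; [|now apply P_ge_hyperbolic].
    replace (/ (4 * snd (c s) ^ 2)) with ((1 / 4) * (/ snd (c s)) ^ 2) by (field; lra).
    unfold Rdiv. rewrite Rpow_mult_distr. pose proof (pow2_ge_0 (/ snd (c s))).
    assert (k ^ 2 <= 1 / 4) by nra. nra.
Qed.

(* Half the Busemann function of the hyperbolic half plane at the boundary point [(xi, 0)]. *)
Definition busemann (xi : R) (q : R * R) : R :=
  1 / 2 * (ln ((fst q - xi) ^ 2 + snd q ^ 2) - ln (snd q)).

(** The Euclidean length of the gradient is exactly [1 / (2 y)], at every point and for every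
    [xi]. *)
Lemma short_busemann xi : short (busemann xi).
Proof.
  intros c s d1 d2 Hy D1 D2. set (x := fst (c s) - xi). set (y := snd (c s)) in *.
  assert (Hr : 0 < x ^ 2 + y ^ 2) by nra.
  exists (x / (x ^ 2 + y ^ 2)), (y / (x ^ 2 + y ^ 2) - 1 / 2 * / y). split.
  - apply is_derive_eq with (1 / 2 * ((2 * x * d1 + 2 * y * d2) / (x ^ 2 + y ^ 2) - d2 / y));
      [|field; split; lra].
    unfold busemann. apply is_derive_scal_R, is_derive_minus_R.
    + apply (is_derive_ln_comp (fun u => (fst (c u) - xi) ^ 2 + snd (c u) ^ 2)); auto.
      apply is_derive_plus_R.
      * apply is_derive_ext with (fun u => (fst (c u) - xi) * (fst (c u) - xi)); [intros; simpl; ring|].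
        apply is_derive_eq with ((d1 - 0) * x + x * (d1 - 0)); [|ring].
        apply (is_derive_mult_R (fun u => fst (c u) - xi) (fun u => fst (c u) - xi));
          apply is_derive_minus_R; auto; apply is_derive_const_R.
      * apply is_derive_ext with (fun u => snd (c u) * snd (c u)); [intros; simpl; ring|].
        apply is_derive_eq with (d2 * y + y * d2); [|ring].
        now apply (is_derive_mult_R (fun u => snd (c u)) (fun u => snd (c u))).
    + now apply (is_derive_ln_comp (fun u => snd (c u))).
  - eapply Rle_trans; [|now apply P_ge_hyperbolic]. fold y. right. field. split; lra.
Qed.

Lemma dist_le_x q1 q2 r : dist_le q1 q2 r -> Rabs (fst q2 - fst q1) <= 2 * r.
Proof.
  intros H.
  pose proof (short_dist _ _ _ _ (short_x (1 / 2) ltac:(rewrite Rabs_right; lra)) H).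
  pose proof (short_dist _ _ _ _ (short_x (- (1 / 2)) ltac:(rewrite Rabs_Ropp, Rabs_right; lra)) H).
  apply Rabs_le. simpl in *. lra.
Qed.

Lemma dist_le_y q1 q2 r : dist_le q1 q2 r -> Rabs (snd q2 - snd q1) <= 2 * r.
Proof.
  intros H.
  pose proof (short_dist _ _ _ _ (short_y (1 / 2) ltac:(rewrite Rabs_right; lra)) H).
  pose proof (short_dist _ _ _ _ (short_y (- (1 / 2)) ltac:(rewrite Rabs_Ropp, Rabs_right; lra)) H).
  apply Rabs_le. simpl in *. lra.
Qed.

Lemma dist_le_ln_y q1 q2 r : dist_le q1 q2 r -> Rabs (ln (snd q2) - ln (snd q1)) <= 2 * r.
Proof.
  intros H.
  pose proof (short_dist _ _ _ _ (short_ln_y (1 / 2) ltac:(rewrite Rabs_right; lra)) H).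
  pose proof (short_dist _ _ _ _ (short_ln_y (- (1 / 2)) ltac:(rewrite Rabs_Ropp, Rabs_right; lra)) H).
  apply Rabs_le. simpl in *. lra.
Qed.

Lemma RiemannInt_le_cst (f : R -> R) (L : R) (pr : Riemann_integrable f 0 1) :
  (forall s, 0 < s < 1 -> f s <= L) -> RiemannInt pr <= L.
Proof.
  intros H. assert (pr2 : Riemann_integrable (fct_cte L) 0 1) by apply RiemannInt_P14.
  apply Rle_trans with (RiemannInt pr2); [apply RiemannInt_P19; auto; lra|].
  rewrite RiemannInt_P15. lra.
Qed.

(** The straight segment stays above height [m], where [sqrt (P y) <= 1/2 + 1/m]. *)
Lemma segment_dist q1 q2 m B : 0 < m -> m <= snd q1 -> m <= snd q2 ->
  (1 / 2 + / m) * (Rabs (fst q2 - fst q1) + Rabs (snd q2 - snd q1)) <= B -> dist_le q1 q2 B.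
Proof.
  intros Hm H1 H2 HB e He. destruct q1 as [x1 y1], q2 as [x2 y2]. cbn [fst snd] in *.
  set (c := fun s => (x1 + s * (x2 - x1), y1 + s * (y2 - y1))).
  assert (Hy : forall s, 0 <= s <= 1 -> m <= snd (c s)). { intros s Hs. unfold c; simpl. nra. }
  assert (D1 : forall s : R, is_derive (fun s => fst (c s)) s (x2 - x1)).
  { intro s. unfold c; simpl. auto_derive; auto. ring. }
  assert (D2 : forall s : R, is_derive (fun s => snd (c s)) s (y2 - y1)).
  { intro s. unfold c; simpl. auto_derive; auto. ring. }
  assert (Cc : forall k s, continuity_pt (fun _ : R => k) s).
  { intros k s. apply continuity_pt_const. intros a b. reflexivity. }
  exists c, (fun _ => x2 - x1), (fun _ => y2 - y1).
  split; [unfold c; f_equal; ring|]. split; [unfold c; f_equal; ring|]. split.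
  { intros s Hs. pose proof (Hy s Hs). repeat split; auto; try lra; apply is_derive_Reals; auto. }
  assert (pr : Riemann_integrable
     (fun s => sqrt (P (snd (c s)) * ((x2 - x1) ^ 2 + (y2 - y1) ^ 2))) 0 1).
  { apply continuity_implies_RiemannInt; [lra|]. intros s Hs. pose proof (Hy s Hs).
    apply (continuity_pt_speed c (fun _ => x2 - x1) (fun _ => y2 - y1)); auto; try lra.
    apply (derive_continuity _ _ D2). }
  exists pr. apply Rle_trans with B; [|lra]. apply RiemannInt_le_cst. intros s Hs.
  eapply Rle_trans; [|exact HB]. pose proof (Hy s ltac:(lra)) as Hys.
  set (y := snd (c s)) in *. assert (0 < / y) by (apply Rinv_0_lt_compat; lra).
  assert (/ y <= / m) by (apply Rinv_le_contravar; lra).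
  pose proof (Rabs_pos (x2 - x1)) as A1. pose proof (Rabs_pos (y2 - y1)) as A2.
  apply Rle_trans with (sqrt (((1 / 2 + / m) * (Rabs (x2 - x1) + Rabs (y2 - y1))) ^ 2)).
  - apply sqrt_le_1_alt. rewrite Rpow_mult_distr. pose proof (P_le_sq y ltac:(lra)).
    pose proof (P_ge_quarter y ltac:(lra)).
    apply Rmult_le_compat; [lra|apply Rplus_le_le_0_compat; apply pow2_ge_0| |].
    { apply Rle_trans with ((1 / 2 + / y) ^ 2); [lra|]. apply pow_incr; lra. }
    rewrite <- (pow2_abs (x2 - x1)), <- (pow2_abs (y2 - y1)). nra.
  - rewrite sqrt_pow2; [lra|]. apply Rmult_le_pos; lra.
Qed.

(** This inequality reads the truncation of cones: a point of a ray from [p0] at distance more than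
    [T] from [p0] is reached after time [T]. *)
Lemma geodesic_dist g T : geodesic g -> 0 <= T -> dist_le (g 0) (g T) T.
Proof.
  intros (dP & vx & vy & ax & ay & HP & H) HT e He.
  set (c := fun s => g (T * s)).
  assert (CM : forall (f df : R -> R) s, (forall t, derivable_pt_lim f t (df t)) ->
     derivable_pt_lim (fun s => f (T * s)) s (T * df (T * s))).
  { intros f df s Hf. apply is_derive_Reals.
    apply (is_derive_comp f (fun s => T * s) s (df (T * s)) T).
    - apply is_derive_Reals, Hf.
    - apply is_derive_eq with (T * 1); [apply is_derive_scal_R, is_derive_id_R|ring]. }
  assert (CC : forall v a s, (forall t, derivable_pt_lim v t (a t)) ->
      continuity_pt (fun s => T * v (T * s)) s).
  { intros v a s Hv. apply derivable_continuous_pt. exists (T * (T * a (T * s))).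
    apply (derivable_pt_lim_scal (fun s => v (T * s))). now apply CM. }
  exists c, (fun s => T * vx (T * s)), (fun s => T * vy (T * s)).
  split; [unfold c; f_equal; ring|]. split; [unfold c; f_equal; ring|].
  assert (Hc : forall s, 0 < snd (c s) /\
      derivable_pt_lim (fun u => fst (c u)) s (T * vx (T * s)) /\
      derivable_pt_lim (fun u => snd (c u)) s (T * vy (T * s)) /\
      continuity_pt (fun s => T * vx (T * s)) s /\ continuity_pt (fun s => T * vy (T * s)) s).
  { intro s. split; [apply H|]. split; [apply (CM (fun t => fst (g t))); apply H|].
    split; [apply (CM (fun t => snd (g t))); apply H|].
    split; [apply (CC vx ax)|apply (CC vy ay)]; apply H. }
  split; [intros; apply Hc|].
  assert (pr : Riemann_integrable
     (fun s => sqrt (P (snd (c s)) * ((T * vx (T * s)) ^ 2 + (T * vy (T * s)) ^ 2))) 0 1).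
  { apply continuity_implies_RiemannInt; [lra|]. intros s _. destruct (Hc s) as (Hy & _ & D2 & C1 & C2).
    apply continuity_pt_speed; auto. apply derivable_continuous_pt. now exists (T * vy (T * s)). }
  exists pr. apply Rle_trans with T; [|lra]. apply RiemannInt_le_cst. intros s _.
  destruct (H (T * s)) as (_ & _ & _ & _ & _ & _ & _ & E). unfold c.
  replace (P (snd (g (T * s))) * ((T * vx (T * s)) ^ 2 + (T * vy (T * s)) ^ 2)) with (T ^ 2).
  - rewrite sqrt_pow2 by auto. lra.
  - replace (P (snd (g (T * s))) * ((T * vx (T * s)) ^ 2 + (T * vy (T * s)) ^ 2)) with
      (T ^ 2 * (P (snd (g (T * s))) * (vx (T * s) ^ 2 + vy (T * s) ^ 2))) by ring.
    rewrite E. ring.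
Qed.

(** * Asymptotic rays *)

Lemma ln_le_inv x y : 0 < x -> 0 < y -> ln x <= ln y -> x <= y.
Proof.
  intros Hx Hy H. apply Rnot_lt_le. intro. pose proof (ln_increasing y x Hy H0). lra.
Qed.

Definition gflow (g : R -> R * R) (c : R) (p : R -> R) : Prop :=
  flow c (fun t => fst (g t)) (fun t => cosh (snd (g t))) p /\ forall t, 0 < snd (g t).

Lemma geodesic_gflow g : geodesic g -> exists c p, gflow g c p.
Proof.
  intros H. destruct (geodesic_flow g H) as (c & p & F & Hy). exists c, p. split; auto.
  intro t. apply Hy.
Qed.

Definition ascends (c : R) (p : R -> R) : Prop := 0 <= lam c /\ 0 < p 0.

(** It records the rate of approach to [xi] besides the end: the rate is what bounds the distance
    between two rays with the same [xi]. *)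
Definition descends (g : R -> R * R) (c : R) (p : R -> R) (t1 d xi : R) : Prop :=
  0 <= t1 /\ 0 < d <= 1 /\ p t1 <= - d /\
  forall t, t1 <= t -> Rabs (fst (g t) - xi) <= 2 * Rabs c / d * (cosh (snd (g t)) - 1).

Lemma up_or_down g c p : gflow g c p -> ascends c p \/ exists t1 d xi, descends g c p t1 d xi.
Proof.
  intros [F _]. destruct (flow_type _ _ _ _ F) as [U|(t1 & d & H1 & H2 & H3)]; [now left|right].
  destruct (flow_down_xlim _ _ _ _ _ _ F H2 H3) as [xi Hxi]. exists t1, d, xi. repeat split; auto; lra.
Qed.

Lemma conv_to_ext g1 g2 w : (forall t, g1 t = g2 t) -> conv_to g1 w -> conv_to g2 w.
Proof. intros E H e He. destruct (H e He) as [T HT]. exists T. intros t Ht. rewrite <- E. auto. Qed.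

Lemma gflow_point g c p : gflow g c p -> forall t, (fst (g t), acosh (cosh (snd (g t)))) = g t.
Proof. intros [_ Hy] t. rewrite acosh_cosh by auto. now destruct (g t). Qed.

Lemma gflow_cone_up g c p : gflow g c p -> ascends c p ->
  cone_limit c (fun t => fst (g t)) (fun t => cosh (snd (g t))) p (2 * c, sqrt (lam c)).
Proof.
  intros [F _] [L Hp]. destruct L as [L|L]; [now apply cone_limit_up|].
  rewrite <- L, sqrt_0. apply cone_limit_crit; auto.
Qed.

Lemma gflow_up_end g c p : gflow g c p -> ascends c p ->
  conv_to (fun t => Phi0 (g t)) (2 * c, sqrt (lam c)).
Proof.
  intros G U. pose proof (cone_limit_conv _ _ _ _ _ (proj1 G) (gflow_cone_up g c p G U)) as C.
  eapply conv_to_ext; [|exact C]. intro t. cbv beta. f_equal. apply (gflow_point g c p G).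
Qed.

Lemma gflow_down_conv g c p t1 d xi : gflow g c p -> descends g c p t1 d xi -> conv_to g (xi, 0).
Proof.
  intros G (H1 & H2 & H3 & H4).
  pose proof (flow_down_conv _ _ _ _ _ _ _ (proj1 G) H2 H3 H4) as C.
  eapply conv_to_ext; [|exact C]. intro t. apply (gflow_point g c p G).
Qed.

Lemma gflow_down_end g c p t1 d xi : gflow g c p -> descends g c p t1 d xi ->
  conv_to (fun t => Phi0 (g t)) (squash xi, 0).
Proof. intros G D. apply conv_to_Phi0. eapply gflow_down_conv; eauto. Qed.

Lemma conv_to_unique g w w' : conv_to g w -> conv_to g w' -> w = w'.
Proof.
  intros H H'. destruct w as [a b], w' as [a' b'].
  assert (Q : forall r, (forall e, 0 < e -> Rabs r < e) -> r = 0).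
  { intros r Hr. destruct (Req_dec r 0); auto. pose proof (Hr (Rabs r) (Rabs_pos_lt _ H0)). lra. }
  assert (forall e, 0 < e -> Rabs (a - a') < e /\ Rabs (b - b') < e).
  { intros e He. destruct (H (e / 2) ltac:(lra)) as [T HT]. destruct (H' (e / 2) ltac:(lra)) as [T' HT'].
    destruct (HT (Rmax T T') (Rmax_l _ _)) as [A B]. destruct (HT' (Rmax T T') (Rmax_r _ _)) as [A' B'].
    simpl in *. apply Rabs_def2 in A, B, A', B'. split; apply Rabs_def1; lra. }
  assert (a - a' = 0) by (apply Q; intros; now apply H0).
  assert (b - b' = 0) by (apply Q; intros; now apply H0). f_equal; lra.
Qed.

Lemma gflow_up_y_infty g c p : gflow g c p -> ascends c p -> y_to_infty g.
Proof.
  intros [F Hy] [L Hp] M. pose proof (flow_gt1 _ _ _ _ F 0) as U. cbv beta in U.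
  pose proof (srate_pos _ U) as Hs. set (s := srate (cosh (snd (g 0)))) in *.
  exists (cosh (Rmax M 0) / s). intros t Ht. pose proof (cosh_ge_1 (Rmax M 0)).
  assert (0 < cosh (Rmax M 0) / s) by (apply Rdiv_lt_0_compat; lra).
  pose proof (flow_up_u _ _ _ _ F L Hp t ltac:(lra)) as B. cbv beta in B. fold s in B.
  assert (cosh (Rmax M 0) <= s * t).
  { apply Rle_trans with (s * (cosh (Rmax M 0) / s)); [right; field; lra|].
    apply Rmult_le_compat_l; lra. }
  pose proof (Rmax_l M 0). pose proof (Rmax_r M 0).
  assert (Rmax M 0 < snd (g t)); [|lra]. apply cosh_lt_inv; [specialize (Hy t); lra|lra].
Qed.

Lemma down_not_y_infty g xi : conv_to g (xi, 0) -> ~ y_to_infty g.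
Proof.
  intros C Y. destruct (C 1 ltac:(lra)) as [T HT]. destruct (Y 1) as [T' HT'].
  destruct (HT (Rmax T T') (Rmax_l _ _)) as [_ A]. pose proof (HT' (Rmax T T') (Rmax_r _ _)).
  simpl in A. apply Rabs_def2 in A. lra.
Qed.

Lemma squash_bounds xi : -1 < squash xi < 1.
Proof.
  unfold squash. pose proof (Rad_pos xi 0) as Hp. pose proof (Rad_sq xi 0) as H2.
  assert (- Rad xi 0 < xi < Rad xi 0) by (split; apply Rnot_le_lt; intro; nra).
  split; apply (Rmult_lt_reg_r (Rad xi 0)); auto; unfold Rdiv; rewrite ?Rmult_assoc, Rinv_l; lra.
Qed.

Lemma squash_inj a b : squash a = squash b -> a = b.
Proof.
  unfold squash. intros E. pose proof (Rad_pos a 0) as Ha. pose proof (Rad_pos b 0) as Hb.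
  pose proof (Rad_sq a 0) as A2. pose proof (Rad_sq b 0) as B2.
  assert (E1 : a * Rad b 0 = b * Rad a 0).
  { apply (f_equal (fun z => z * (Rad a 0 * Rad b 0))) in E.
    replace (a / Rad a 0 * (Rad a 0 * Rad b 0)) with (a * Rad b 0) in E by (field; lra).
    replace (b / Rad b 0 * (Rad a 0 * Rad b 0)) with (b * Rad a 0) in E by (field; lra). exact E. }
  assert (E2 : a ^ 2 = b ^ 2).
  { assert ((a * Rad b 0) ^ 2 = (b * Rad a 0) ^ 2) by now rewrite E1.
    rewrite !Rpow_mult_distr, A2, B2 in H. nra. }
  assert (Rad a 0 = Rad b 0) by (unfold Rad; now rewrite E2). rewrite H in E1.
  apply Rmult_eq_reg_r in E1; lra.
Qed.

(** A value of [squash] is strictly between -1 and 1, and for such a [2 c] the number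
    [lam c = 1 - (2 c) ^ 2] is positive. *)
Lemma ends_disjoint c xi : (2 * c, sqrt (lam c)) <> (squash xi, 0).
Proof.
  intros E. injection E as E1 E2. pose proof (squash_bounds xi).
  assert (L : 0 < lam c) by (unfold lam; nra). pose proof (sqrt_lt_R0 _ L). lra.
Qed.

Lemma dist_le_mono q1 q2 r r' : dist_le q1 q2 r -> r <= r' -> dist_le q1 q2 r'.
Proof.
  intros H Hr e He. destruct (H e He) as (c & d1 & d2 & E0 & E1 & Hc & pr & Hpr).
  exists c, d1, d2. repeat (split; auto). exists pr. lra.
Qed.

Lemma geodesic_stays g T : geodesic g -> 0 <= T -> forall t, 0 <= t <= T ->
  Rabs (fst (g t) - fst (g 0)) <= 2 * T /\ Rabs (snd (g t) - snd (g 0)) <= 2 * T /\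
  snd (g 0) * exp (- (2 * T)) <= snd (g t).
Proof.
  intros H HT t Ht. pose proof (geodesic_dist g t H ltac:(lra)) as D.
  destruct (geodesic_gflow g H) as (c & p & _ & Hy).
  pose proof (dist_le_x _ _ _ D). pose proof (dist_le_y _ _ _ D). pose proof (dist_le_ln_y _ _ _ D) as L.
  split; [lra|]. split; [lra|]. apply abs_le_inv in L.
  rewrite <- (exp_ln (snd (g t))), <- (exp_ln (snd (g 0))) by auto. rewrite <- exp_plus.
  assert (X : ln (snd (g 0)) + - (2 * T) <= ln (snd (g t))) by lra.
  destruct X as [X|X]; [left; now apply exp_increasing|rewrite X; lra].
Qed.

(** Up to time [T] the height of each ray shrinks at most by the factor [exp (- 2 T)], because half
    of [ln y] is 1-Lipschitz; straight segments above the height [m] then join the two rays with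
    bounded length. *)
Lemma asymptotic_eventually g1 g2 T B : geodesic g1 -> geodesic g2 -> 0 <= T ->
  (forall t, T <= t -> dist_le (g1 t) (g2 t) B) -> asymptotic g1 g2.
Proof.
  intros H1 H2 HT HB. destruct (geodesic_gflow g1 H1) as (c1 & p1 & _ & Y1).
  destruct (geodesic_gflow g2 H2) as (c2 & p2 & _ & Y2).
  set (m := Rmin (snd (g1 0)) (snd (g2 0)) * exp (- (2 * T))).
  pose proof (exp_pos (- (2 * T))) as Ex.
  assert (Hm : 0 < m). { apply Rmult_lt_0_compat; auto. apply Rmin_glb_lt; auto. }
  set (B' := (1 / 2 + / m) * ((Rabs (fst (g2 0) - fst (g1 0)) + 4 * T) +
     (Rabs (snd (g2 0) - snd (g1 0)) + 4 * T))).
  exists (Rmax B B'). intros t Ht. destruct (Rle_dec T t) as [HTt|HTt].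
  - apply dist_le_mono with B; auto. apply Rmax_l.
  - apply dist_le_mono with B'; [|apply Rmax_r].
    destruct (geodesic_stays g1 T H1 HT t ltac:(lra)) as (A1 & A2 & A3).
    destruct (geodesic_stays g2 T H2 HT t ltac:(lra)) as (C1 & C2 & C3).
    assert (M : Rmin (snd (g1 0)) (snd (g2 0)) <= snd (g1 0) /\
                Rmin (snd (g1 0)) (snd (g2 0)) <= snd (g2 0)).
    { split; [apply Rmin_l|apply Rmin_r]. }
    apply (segment_dist _ _ m); auto.
    + eapply Rle_trans; [|exact A3]. apply Rmult_le_compat_r; lra.
    + eapply Rle_trans; [|exact C3]. apply Rmult_le_compat_r; lra.
    + assert (0 < / m) by now apply Rinv_0_lt_compat.
      apply Rmult_le_compat_l; [lra|].
      assert (G : forall a b a0 b0, Rabs (a - a0) <= 2 * T -> Rabs (b - b0) <= 2 * T ->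
         Rabs (b - a) <= Rabs (b0 - a0) + 4 * T).
      { intros a b a0 b0 Ha Hb. replace (b - a) with ((b0 - a0) + (b - b0) + (a0 - a)) by ring.
        eapply Rle_trans; [apply Rabs_triang|].
        eapply Rle_trans; [apply Rplus_le_compat_r, Rabs_triang|].
        rewrite (Rabs_minus_sym a0 a). lra. }
      apply Rplus_le_compat; eapply G; eauto.
Qed.

Lemma linear_diff_eq a b K : (forall t, 0 <= t -> Rabs (a * t - b * t) <= K) -> a = b.
Proof.
  intros H. destruct (Req_dec a b) as [|N]; auto. exfalso.
  assert (0 < Rabs (a - b)) by (apply Rabs_pos_lt; lra).
  set (t := (Rabs K + 1) / Rabs (a - b)).
  assert (0 <= t). { apply Rle_mult_inv_pos; auto. pose proof (Rabs_pos K); lra. }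
  pose proof (H t H1). replace (a * t - b * t) with ((a - b) * t) in H2 by ring.
  rewrite Rabs_mult, (Rabs_right t) in H2 by lra. unfold t in H2.
  replace (Rabs (a - b) * ((Rabs K + 1) / Rabs (a - b))) with (Rabs K + 1) in H2 by (field; lra).
  pose proof (Rle_abs K). lra.
Qed.

Lemma asymptotic_up_up g1 c1 p1 g2 c2 p2 : gflow g1 c1 p1 -> gflow g2 c2 p2 -> ascends c1 p1 -> ascends c2 p2 ->
  asymptotic g1 g2 -> c1 = c2.
Proof.
  intros [F1 _] [F2 _] [L1 P1] [L2 P2] [B HB].
  (* A rising ray has [x = x 0 + 2 c s] with [s - 2 t] bounded, so [x] grows like [4 c t]. *)
  enough (4 * c1 = 4 * c2) by lra.
  apply (linear_diff_eq _ _ (2 * B + (Rabs (fst (g1 0)) + lag_bound (cosh (snd (g1 0)))) +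
     (Rabs (fst (g2 0)) + lag_bound (cosh (snd (g2 0)))))).
  intros t Ht. pose proof (flow_up_x_linear _ _ _ _ F1 L1 P1 t Ht) as A.
  pose proof (flow_up_x_linear _ _ _ _ F2 L2 P2 t Ht) as C. cbv beta in A, C.
  pose proof (dist_le_x _ _ _ (HB t Ht)) as D. apply abs_le_inv in A, C, D. apply Rabs_le. lra.
Qed.

Lemma asymptotic_up_down g1 c1 p1 g2 xi : gflow g1 c1 p1 -> ascends c1 p1 -> conv_to g2 (xi, 0) ->
  (asymptotic g1 g2 \/ asymptotic g2 g1) -> False.
Proof.
  intros G U C A. pose proof (gflow_up_y_infty _ _ _ G U) as Y.
  assert (Q : exists B, forall t, 0 <= t -> Rabs (snd (g1 t) - snd (g2 t)) <= 2 * B).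
  { destruct A as [[B HB]|[B HB]]; exists B; intros t Ht; pose proof (dist_le_y _ _ _ (HB t Ht)); auto.
    now rewrite Rabs_minus_sym. }
  destruct Q as [B HB]. destruct (C 1 ltac:(lra)) as [T HT]. destruct (Y (2 * B + 1)) as [T' HT'].
  set (t := Rmax 0 (Rmax T T')). assert (0 <= t) by apply Rmax_l.
  assert (T <= t). { eapply Rle_trans; [apply Rmax_l|apply Rmax_r]. }
  assert (T' <= t). { eapply Rle_trans; [apply Rmax_r|apply Rmax_r]. }
  pose proof (HB t H) as D. destruct (HT t H0) as [_ E]. pose proof (HT' t H1).
  simpl in E. apply Rabs_def2 in E. apply abs_le_inv in D. lra.
Qed.

Lemma sinh_le_cosh y : sinh y <= cosh y.
Proof. unfold sinh, cosh. pose proof (exp_pos (- y)). lra. Qed.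

Lemma down_u_bound g c p t1 d xi : gflow g c p -> descends g c p t1 d xi ->
  forall t, t1 <= t -> cosh (snd (g t)) <= cosh (snd (g t1)).
Proof.
  intros [F _] (H1 & H2 & H3 & _) t Ht. apply (flow_down_u _ _ _ _ t1 d F H2 H3 t1 t); lra.
Qed.

Lemma cosh_minus_1_le y U : 0 < y -> cosh y <= U -> cosh y - 1 <= U ^ 2 * y.
Proof.
  intros Hy HU. pose proof (cosh_sq y). pose proof (cosh_gt_1 y Hy). pose proof (sinh_pos y Hy).
  pose proof (sinh_le_id_cosh y ltac:(lra)). pose proof (sinh_le_cosh y).
  assert (sinh y * sinh y <= U * (U * y)).
  { apply Rmult_le_compat; try lra. apply Rle_trans with (y * cosh y); auto.
    rewrite (Rmult_comm U). apply Rmult_le_compat_l; lra. }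
  nra.
Qed.

Lemma down_x_rate g c p t1 d xi : gflow g c p -> descends g c p t1 d xi ->
  exists M, 0 < M /\ forall t, t1 <= t -> Rabs (fst (g t) - xi) <= M * snd (g t).
Proof.
  intros G D. pose proof (down_u_bound _ _ _ _ _ _ G D) as UB. destruct G as [F Hy].
  destruct D as (H1 & H2 & H3 & H4). set (K := 2 * Rabs c / d) in *. set (U := cosh (snd (g t1))) in *.
  assert (HK : 0 <= K). { unfold K. apply Rle_mult_inv_pos; [|lra]. pose proof (Rabs_pos c); lra. }
  pose proof (cosh_ge_1 (snd (g t1)) : 1 <= U).
  exists (K * U ^ 2 + 1). split; [assert (0 <= K * U ^ 2) by (apply Rmult_le_pos; nra); lra|].
  intros t Ht. eapply Rle_trans; [apply H4, Ht|]. pose proof (Hy t).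
  pose proof (cosh_minus_1_le (snd (g t)) U (Hy t) (UB t Ht)).
  assert (K * (cosh (snd (g t)) - 1) <= K * (U ^ 2 * snd (g t))) by (apply Rmult_le_compat_l; auto).
  nra.
Qed.

(** The Busemann function of [xi1] stays bounded above along [g1], since [|x - xi1| <= M y], and
    tends to infinity along [g2], where [y] tends to 0 while [x] stays away from [xi1]. A
    1-Lipschitz function cannot do this on rays at bounded distance. *)
Lemma asymptotic_down_down g1 c1 p1 t1 d1 xi1 g2 c2 p2 t2 d2 xi2 :
  gflow g1 c1 p1 -> gflow g2 c2 p2 -> descends g1 c1 p1 t1 d1 xi1 -> descends g2 c2 p2 t2 d2 xi2 ->
  asymptotic g1 g2 -> xi1 = xi2.
Proof.
  intros G1 G2 D1 D2 [B HB]. destruct (Req_dec xi1 xi2) as [|N]; auto. exfalso.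
  destruct (down_x_rate _ _ _ _ _ _ G1 D1) as (M & HM & R1).
  pose proof (gflow_down_conv _ _ _ _ _ _ G1 D1) as C1.
  pose proof (gflow_down_conv _ _ _ _ _ _ G2 D2) as C2.
  set (D := Rabs (xi2 - xi1)). assert (HD : 0 < D) by (apply Rabs_pos_lt; lra).
  (* The first bound keeps [g2] at horizontal distance [D / 2] from [xi1]; the second makes the gap
     of the Busemann values exceed [B]. *)
  set (eta := Rmin (D / 2) (D ^ 2 / 4 / ((M ^ 2 + 1) * exp (2 * B)))).
  pose proof (exp_pos (2 * B)) as Ex.
  assert (Heta : 0 < eta).
  { apply Rmin_glb_lt; [lra|]. apply Rdiv_lt_0_compat; [nra|]. apply Rmult_lt_0_compat; nra. }
  destruct (C1 1 ltac:(lra)) as [T1 HT1]. destruct (C2 eta Heta) as [T2 HT2].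
  set (t := Rmax (Rmax 0 t1) (Rmax T1 T2)).
  assert (Ht0 : 0 <= t) by (eapply Rle_trans; [apply Rmax_l|apply Rmax_l]).
  assert (Htt : t1 <= t) by (eapply Rle_trans; [apply Rmax_r|apply Rmax_l]).
  destruct (HT1 t) as [_ A1]; [eapply Rle_trans; [apply Rmax_l|apply Rmax_r]|].
  destruct (HT2 t) as [A2 A3]; [eapply Rle_trans; [apply Rmax_r|apply Rmax_r]|].
  pose proof (short_dist _ _ _ _ (short_busemann xi1) (HB t Ht0)) as S.
  pose proof (R1 t Htt) as R1'. pose proof (proj2 G1 t) as Y1. pose proof (proj2 G2 t) as Y2.
  unfold busemann in S. set (x1 := fst (g1 t)) in *. set (x2 := fst (g2 t)) in *.
  set (y1 := snd (g1 t)) in *. set (y2 := snd (g2 t)) in *. cbn [fst snd] in *.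
  apply Rabs_def2 in A1, A3. apply abs_le_inv in R1'.
  assert (Hx2 : D ^ 2 / 4 <= (x2 - xi1) ^ 2).
  { assert (D / 2 <= Rabs (x2 - xi1)).
    { assert (eta <= D / 2) by apply Rmin_l.
      assert (D <= Rabs (x2 - xi2) + Rabs (x2 - xi1)); [|lra].
      unfold D. replace (xi2 - xi1) with (- (x2 - xi2) + (x2 - xi1)) by ring.
      eapply Rle_trans; [apply Rabs_triang|]. rewrite Rabs_Ropp. lra. }
    rewrite <- (pow2_abs (x2 - xi1)). nra. }
  assert (Up : ln ((x1 - xi1) ^ 2 + y1 ^ 2) - ln y1 <= ln (M ^ 2 + 1)).
  { assert (Q1 : 0 < (x1 - xi1) ^ 2 + y1 ^ 2).
    { pose proof (pow2_ge_0 (x1 - xi1)). assert (0 < y1 ^ 2) by (apply pow_lt; lra). lra. }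
    rewrite <- ln_div by lra. apply ln_le; [apply Rdiv_lt_0_compat; lra|].
    apply (Rmult_le_reg_r y1); auto. unfold Rdiv. rewrite Rmult_assoc, Rinv_l by lra.
    assert ((x1 - xi1) ^ 2 <= (M * y1) ^ 2) by (clear - R1'; nra).
    assert (y1 ^ 2 <= y1) by (clear - Y1 A1; nra).
    assert ((M ^ 2 + 1) * y1 ^ 2 <= (M ^ 2 + 1) * y1) by (apply Rmult_le_compat_l; nra). lra. }
  assert (Lo : ln (D ^ 2 / 4) - ln y2 <= ln ((x2 - xi1) ^ 2 + y2 ^ 2) - ln y2).
  { apply Rplus_le_compat_r. apply ln_le; nra. }
  assert (L : ln (D ^ 2 / 4) <= ln ((M ^ 2 + 1) * exp (2 * B) * y2)).
  { rewrite !ln_mult by (try apply Rmult_lt_0_compat; nra). rewrite ln_exp. lra. }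
  apply ln_le_inv in L; [|nra|repeat apply Rmult_lt_0_compat; nra].
  assert (y2 < D ^ 2 / 4 / ((M ^ 2 + 1) * exp (2 * B))).
  { apply Rlt_le_trans with eta; [lra|apply Rmin_r]. }
  apply (Rmult_lt_compat_l ((M ^ 2 + 1) * exp (2 * B))) in H; [|apply Rmult_lt_0_compat; nra].
  replace ((M ^ 2 + 1) * exp (2 * B) * (D ^ 2 / 4 / ((M ^ 2 + 1) * exp (2 * B)))) with (D ^ 2 / 4) in H
    by (field; split; nra). lra.
Qed.

(** The [x] coordinates share the linear term [4 c t]. For [lam c > 0] the heights share the term
    [2 t sqrt (lam c)]. In the critical case [p = sqrt 3] throughout, so [u = u 0 + sqrt 3 s] and
    the two values of [u] differ by a bounded amount. *)
Lemma up_up_asymptotic g1 p1 g2 p2 c : geodesic g1 -> geodesic g2 ->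
  gflow g1 c p1 -> gflow g2 c p2 -> ascends c p1 -> ascends c p2 -> asymptotic g1 g2.
Proof.
  intros H1 H2 [F1 Y1] [F2 Y2] [L P1] [_ P2].
  assert (YB : exists K, forall t, 0 <= t -> Rabs (snd (g2 t) - snd (g1 t)) <= K).
  { destruct L as [L|L].
    - exists ((ln (6 * cosh (snd (g1 0))) - ln (sqrt (lam c)) + lag_bound (cosh (snd (g1 0)))) +
              (ln (6 * cosh (snd (g2 0))) - ln (sqrt (lam c)) + lag_bound (cosh (snd (g2 0))))).
      intros t Ht. pose proof (flow_up_y_linear _ _ _ _ F1 L P1 t Ht) as A.
      pose proof (flow_up_y_linear _ _ _ _ F2 L P2 t Ht) as B. cbv beta in A, B.
      rewrite acosh_cosh in A, B by auto. apply abs_le_inv in A, B. apply Rabs_le. lra.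
    - assert (Lin : forall g p, flow c (fun t => fst (g t)) (fun t => cosh (snd (g t))) p -> 0 < p 0 ->
         forall t, cosh (snd (g t)) =
           cosh (snd (g 0)) + sqrt 3 * stime (fun t => cosh (snd (g t))) p t).
      { intros g p F Hp t. set (u := fun t => cosh (snd (g t))) in *.
        assert (Ep : forall r, p r = sqrt 3).
        { intro r. pose proof (flow_up_p _ _ _ _ F ltac:(lra) Hp r).
          pose proof (flow_energy _ _ _ _ F r) as E. rewrite <- L in E.
          pose proof sqrt3_sq. pose proof sqrt3_pos. nra. }
        assert (E : u t - sqrt 3 * stime u p t = u 0 - sqrt 3 * stime u p 0).
        { apply (derive_0_const (fun t => u t - sqrt 3 * stime u p t)
            (fun t => p t * srate (u t) - sqrt 3 * srate (u t))).
          - intro r. apply is_derive_minus_R; [apply (flow_u _ _ _ _ F)|].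
            apply (is_derive_scal_R (stime u p)), (stime_derive _ _ _ _ F).
          - intro r. rewrite Ep. ring. }
        rewrite stime_0 in E. unfold u in *. lra. }
      set (M := cosh (snd (g1 0)) + cosh (snd (g2 0)) + 2 * lag_bound (cosh (snd (g1 0))) +
                2 * lag_bound (cosh (snd (g2 0)))).
      pose proof (lag_bound_nonneg _ (flow_gt1 _ _ _ _ F1 0)) as La1.
      pose proof (lag_bound_nonneg _ (flow_gt1 _ _ _ _ F2 0)) as La2. cbv beta in La1, La2.
      assert (HM : 0 <= M).
      { unfold M. pose proof (cosh_ge_1 (snd (g1 0))). pose proof (cosh_ge_1 (snd (g2 0))). lra. }
      exists (ln (2 * (1 + M))). intros t Ht.
      pose proof (flow_up_s _ _ _ _ F1 ltac:(lra) P1 t Ht) as S1.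
      pose proof (flow_up_s _ _ _ _ F2 ltac:(lra) P2 t Ht) as S2. cbv beta in S1, S2.
      pose proof (Lin g1 p1 F1 P1 t) as E1. pose proof (Lin g2 p2 F2 P2 t) as E2.
      pose proof sqrt3_bounds as S3.
      set (u1 := cosh (snd (g1 t))) in *. set (u2 := cosh (snd (g2 t))) in *.
      pose proof (cosh_ge_1 (snd (g1 t)) : 1 <= u1). pose proof (cosh_ge_1 (snd (g2 t)) : 1 <= u2).
      set (s1 := stime (fun t => cosh (snd (g1 t))) p1 t) in *.
      set (s2 := stime (fun t => cosh (snd (g2 t))) p2 t) in *.
      assert (Du : Rabs (u1 - u2) <= M).
      { apply abs_le_inv in S1, S2. unfold M.
        set (l1 := lag_bound (cosh (snd (g1 0)))) in *. set (l2 := lag_bound (cosh (snd (g2 0)))) in *.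
        pose proof (cosh_ge_1 (snd (g1 0))). pose proof (cosh_ge_1 (snd (g2 0))).
        assert (- (l1 + l2) <= s1 - s2 <= l1 + l2) by lra.
        assert (- (2 * (l1 + l2)) <= sqrt 3 * (s1 - s2) <= 2 * (l1 + l2)) by (split; nra).
        apply Rabs_le. lra. }
      apply abs_le_inv in Du.
      (* A bounded difference gives a bounded ratio, as [b >= 1], and [acosh] is [ln] up to
         [ln 2]. *)
      assert (Q : forall a b, 1 <= a -> 1 <= b -> a <= b + M -> acosh a <= acosh b + ln (2 * (1 + M))).
      { intros a b Ha Hb Hab. pose proof (acosh_bounds a Ha). pose proof (acosh_bounds b Hb).
        assert (ln (2 * a) <= ln (b * (2 * (1 + M)))) by (apply ln_le; nra).
        rewrite (ln_mult b) in H5 by lra. lra. }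
      pose proof (Q u1 u2 ltac:(lra) ltac:(lra) ltac:(lra)) as Q1.
      pose proof (Q u2 u1 ltac:(lra) ltac:(lra) ltac:(lra)) as Q2.
      unfold u1, u2 in Q1, Q2. rewrite !acosh_cosh in Q1, Q2 by auto. apply Rabs_le. lra. }
  destruct YB as [K HK].
  set (m := Rmin (snd (g1 0)) (snd (g2 0))). assert (Hm : 0 < m) by (apply Rmin_glb_lt; auto).
  assert (Inv : 0 < / m) by now apply Rinv_0_lt_compat.
  set (X := (Rabs (fst (g1 0)) + lag_bound (cosh (snd (g1 0)))) +
            (Rabs (fst (g2 0)) + lag_bound (cosh (snd (g2 0))))).
  exists ((1 / 2 + / m) * (X + K)). intros t Ht.
  assert (Mono : forall g p, flow c (fun t => fst (g t)) (fun t => cosh (snd (g t))) p -> 0 < p 0 ->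
     (forall t, 0 < snd (g t)) -> snd (g 0) <= snd (g t)).
  { intros g p F Hp Y. apply Rnot_lt_le. intro Hlt.
    pose proof (flow_up_u _ _ _ _ F L Hp t Ht) as Hu. cbv beta in Hu.
    pose proof (cosh_lt (snd (g t)) (snd (g 0)) ltac:(specialize (Y t); lra) Hlt).
    pose proof (srate_pos _ (flow_gt1 _ _ _ _ F 0)) as Hs. cbv beta in Hs. nra. }
  apply (segment_dist _ _ m); auto.
  - eapply Rle_trans; [apply Rmin_l|]. eapply Mono; eauto.
  - eapply Rle_trans; [apply Rmin_r|]. eapply Mono; eauto.
  - apply Rmult_le_compat_l; [lra|]. apply Rplus_le_compat; [|now apply HK].
    pose proof (flow_up_x_linear _ _ _ _ F1 L P1 t Ht) as A.
    pose proof (flow_up_x_linear _ _ _ _ F2 L P2 t Ht) as B. cbv beta in A, B.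
    apply abs_le_inv in A, B. unfold X. apply Rabs_le. lra.
Qed.

(** The two logarithms in [lag] have sum [ln (3 - lam c) + 2 ln (sinh y)] by [energy_gap], and
    difference [lag], which is [2 / sqrt 3 * (s - 2 t)] up to a constant. On a descent [s] and the
    logarithm of [sqrt 3 u - p] are bounded, which leaves [- 2 t / sqrt 3], the rate of the
    hyperbolic metric scaled by [sqrt 3 / 2]. *)
Lemma down_ln_sinh g c p t1 d xi : gflow g c p -> descends g c p t1 d xi ->
  exists K, forall t, t1 <= t -> Rabs (ln (sinh (snd (g t))) + 2 / sqrt 3 * t) <= K.
Proof.
  intros G D. pose proof (down_u_bound _ _ _ _ _ _ G D) as UB. destruct G as [F Hy].
  destruct D as (H1 & H2 & H3 & H4). pose proof sqrt3_bounds as S3. pose proof sqrt3_sq as S33.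
  set (u := fun t => cosh (snd (g t))) in *. set (U := u t1).
  assert (HU : 1 < U) by apply (flow_gt1 _ _ _ _ F).
  set (s1 := stime u p t1). pose proof (lam_le_1 c) as L1.
  set (A := ln (3 - lam c)). set (L0 := lag (u 0) (p 0)).
  exists (Rabs A + Rabs L0 + Rabs s1 + / d * U + ln (4 * U)). intros t Ht.
  pose proof (flow_down_s _ _ _ _ _ _ F H2 H3 t1 t ltac:(lra) Ht) as DS.
  fold U s1 in DS. pose proof (flow_gt1 _ _ _ _ F t) as Ut. pose proof (UB t Ht) as UBt.
  destruct (energy_gap c (u t) (p t) Ut (flow_energy _ _ _ _ F t)) as (G1 & G2 & G3).
  pose proof (flow_neg_stays _ _ _ _ _ _ F H2 H3 t Ht) as Pt.
  pose proof (flow_p_lt _ _ _ _ F t) as Pl. apply Rabs_def2 in Pl.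
  assert (E1 : ln (sqrt 3 * u t + p t) + ln (sqrt 3 * u t - p t) = A + 2 * ln (sinh (snd (g t)))).
  { pose proof (sinh_pos _ (Hy t)). rewrite <- ln_mult, G3 by auto. unfold A, u. rewrite cosh_sq.
    replace (1 + sinh (snd (g t)) ^ 2 - 1) with (sinh (snd (g t)) * sinh (snd (g t))) by ring.
    rewrite ln_mult; [|lra|nra]. rewrite ln_mult by auto. ring. }
  assert (E2 : lag (u t) (p t) = L0 + 2 / sqrt 3 * (stime u p t - 2 * t)).
  { unfold stime. fold L0. field. lra. }
  unfold lag in E2.
  assert (B1 : 0 <= ln (sqrt 3 * u t - p t) <= ln (4 * U)).
  { split; [rewrite <- ln_1; apply ln_le; nra|]. apply ln_le; [auto|].
    change (u t <= U) in UBt. nra. }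
  assert (D2 : 0 < / d) by (apply Rinv_0_lt_compat; lra).
  assert (Es : Rabs (stime u p t) <= Rabs s1 + / d * U).
  { replace (stime u p t) with (s1 + (stime u p t - s1)) by ring.
    eapply Rle_trans; [apply Rabs_triang|]. rewrite (Rabs_right (stime u p t - s1)) by lra. nra. }
  assert (I3 : 0 < / sqrt 3 < 1).
  { split; [apply Rinv_0_lt_compat; lra|]. rewrite <- Rinv_1. apply Rinv_lt_contravar; lra. }
  set (s := stime u p t) in *. set (l := ln (sinh (snd (g t)))) in *.
  assert (E3 : l + 2 / sqrt 3 * t =
     ln (sqrt 3 * u t - p t) - A / 2 + L0 / 2 + / sqrt 3 * s).
  { unfold Rdiv in *. lra. }
  rewrite E3. pose proof (Rle_abs A). pose proof (Rle_abs (- A)). rewrite Rabs_Ropp in *.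
  pose proof (Rle_abs L0). pose proof (Rle_abs (- L0)). rewrite Rabs_Ropp in *.
  assert (Z : Rabs (/ sqrt 3 * s) <= Rabs s1 + / d * U).
  { rewrite Rabs_mult, (Rabs_right (/ sqrt 3)) by lra. pose proof (Rabs_pos s). nra. }
  apply abs_le_inv in Z. apply Rabs_le. pose proof (Rabs_pos A). pose proof (Rabs_pos L0). lra.
Qed.

(** By [down_ln_sinh] the heights of the two rays have bounded ratio, and the horizontal gap is at
    most a multiple of the lower height [m]. The factor [1 / m] in the length of the segment is
    thereby compensated. *)
Lemma down_down_asymptotic g1 c1 p1 t1 d1 g2 c2 p2 t2 d2 xi : geodesic g1 -> geodesic g2 ->
  gflow g1 c1 p1 -> gflow g2 c2 p2 -> descends g1 c1 p1 t1 d1 xi -> descends g2 c2 p2 t2 d2 xi ->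
  asymptotic g1 g2.
Proof.
  intros H1 H2 G1 G2 D1 D2.
  destruct (down_x_rate _ _ _ _ _ _ G1 D1) as (M1 & HM1 & R1).
  destruct (down_x_rate _ _ _ _ _ _ G2 D2) as (M2 & HM2 & R2).
  destruct (down_ln_sinh _ _ _ _ _ _ G1 D1) as (K1 & S1).
  destruct (down_ln_sinh _ _ _ _ _ _ G2 D2) as (K2 & S2).
  pose proof (down_u_bound _ _ _ _ _ _ G1 D1) as U1.
  pose proof (down_u_bound _ _ _ _ _ _ G2 D2) as U2.
  set (U := cosh (snd (g1 t1)) + cosh (snd (g2 t2))).
  pose proof (cosh_ge_1 (snd (g1 t1))). pose proof (cosh_ge_1 (snd (g2 t2))).
  set (E := exp (K1 + K2)). assert (HE : 0 < E) by apply exp_pos.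
  set (M := E * U). assert (HM : 0 < M) by (unfold M, U; nra).
  set (T := Rmax t1 t2). assert (t1 <= T) by apply Rmax_l. assert (t2 <= T) by apply Rmax_r.
  assert (Ht1 : 0 <= t1) by apply D1.
  apply (asymptotic_eventually g1 g2 T
    (1 / 2 * ((M1 + M2) * (M + 1) + (M + 1)) * U + ((M1 + M2) * (M + 1) + (M + 1)))); auto; [lra|].
  intros t Ht. pose proof (proj2 G1 t) as Y1. pose proof (proj2 G2 t) as Y2.
  pose proof (R1 t ltac:(lra)) as X1. pose proof (R2 t ltac:(lra)) as X2.
  pose proof (S1 t ltac:(lra)) as L1. pose proof (S2 t ltac:(lra)) as L2.
  pose proof (U1 t ltac:(lra)) as V1. pose proof (U2 t ltac:(lra)) as V2.
  set (x1 := fst (g1 t)) in *. set (y1 := snd (g1 t)) in *.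
  set (x2 := fst (g2 t)) in *. set (y2 := snd (g2 t)) in *.
  apply abs_le_inv in L1, L2, X1, X2.
  assert (Comp : forall a b, 0 < a -> 0 < b -> cosh b <= U -> ln (sinh a) <= ln (sinh b) + (K1 + K2) ->
     a <= M * b).
  { intros a b Ha Hb Hu Hl. pose proof (sinh_pos a Ha). pose proof (sinh_pos b Hb).
    pose proof (sinh_ge_id a ltac:(lra)). pose proof (sinh_le_id_cosh b ltac:(lra)).
    assert (sinh a <= sinh b * E).
    { apply ln_le_inv; auto; [nra|]. rewrite ln_mult by auto. unfold E. rewrite ln_exp. lra. }
    assert (sinh b <= b * U). { eapply Rle_trans; eauto. apply Rmult_le_compat_l; lra. }
    assert (sinh b * E <= b * U * E) by (apply Rmult_le_compat_r; lra). unfold M. lra. }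
  assert (A12 : y1 <= M * y2) by (apply Comp; auto; unfold U in *; lra).
  assert (A21 : y2 <= M * y1) by (apply Comp; auto; unfold U in *; lra).
  set (m := Rmin y1 y2). assert (Hm : 0 < m) by (apply Rmin_glb_lt; auto).
  assert (B1 : y1 <= (M + 1) * m).
  { unfold m, Rmin. destruct (Rle_dec y1 y2); nra. }
  assert (B2 : y2 <= (M + 1) * m).
  { unfold m, Rmin. destruct (Rle_dec y1 y2); nra. }
  assert (m1 : m <= y1) by apply Rmin_l. assert (m2 : m <= y2) by apply Rmin_r.
  apply (segment_dist _ _ m); auto. fold x1 x2 y1 y2.
  assert (DX : Rabs (x2 - x1) <= (M1 + M2) * (M + 1) * m).
  { apply Rabs_le. assert (M1 * y1 <= M1 * ((M + 1) * m)) by (apply Rmult_le_compat_l; lra).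
    assert (M2 * y2 <= M2 * ((M + 1) * m)) by (apply Rmult_le_compat_l; lra). lra. }
  assert (DY : Rabs (y2 - y1) <= (M + 1) * m) by (apply Rabs_le; lra).
  set (C := (M1 + M2) * (M + 1) + (M + 1)).
  assert (HC : 0 < C) by (unfold C; nra).
  assert (0 < / m) by now apply Rinv_0_lt_compat.
  apply Rle_trans with ((1 / 2 + / m) * (C * m)).
  - apply Rmult_le_compat_l; [lra|]. unfold C. lra.
  - replace ((1 / 2 + / m) * (C * m)) with (1 / 2 * C * m + C) by (field; lra).
    apply Rplus_le_compat_r. apply Rmult_le_compat_l; [lra|].
    pose proof (sinh_ge_id y1 ltac:(lra)). pose proof (sinh_le_cosh y1). unfold U. lra.
Qed.

Theorem asymptotic_iff_same_end g1 g2 w1 w2 : geodesic g1 -> geodesic g2 ->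
  conv_to (fun t => Phi0 (g1 t)) w1 -> conv_to (fun t => Phi0 (g2 t)) w2 ->
  (w1 = w2 <-> asymptotic g1 g2).
Proof.
  intros H1 H2 W1 W2.
  destruct (geodesic_gflow g1 H1) as (c1 & p1 & G1). destruct (geodesic_gflow g2 H2) as (c2 & p2 & G2).
  destruct (up_or_down _ _ _ G1) as [U1|(t1 & d1 & xi1 & D1)];
    destruct (up_or_down _ _ _ G2) as [U2|(t2 & d2 & xi2 & D2)].
  - pose proof (conv_to_unique _ _ _ W1 (gflow_up_end _ _ _ G1 U1)) as ->.
    pose proof (conv_to_unique _ _ _ W2 (gflow_up_end _ _ _ G2 U2)) as ->. split.
    + intros E. injection E as E1 E2. assert (c1 = c2) by lra. subst c2.
      eapply up_up_asymptotic; eauto.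
    + intros A. assert (c1 = c2) as <-; [exact (asymptotic_up_up _ _ _ _ _ _ G1 G2 U1 U2 A)|reflexivity].
  - pose proof (conv_to_unique _ _ _ W1 (gflow_up_end _ _ _ G1 U1)) as ->.
    pose proof (conv_to_unique _ _ _ W2 (gflow_down_end _ _ _ _ _ _ G2 D2)) as ->. split.
    + intros E. now apply ends_disjoint in E.
    + intros A. exfalso. apply (asymptotic_up_down g1 c1 p1 g2 xi2); auto. apply (gflow_down_conv _ _ _ _ _ _ G2 D2).
  - pose proof (conv_to_unique _ _ _ W1 (gflow_down_end _ _ _ _ _ _ G1 D1)) as ->.
    pose proof (conv_to_unique _ _ _ W2 (gflow_up_end _ _ _ G2 U2)) as ->. split.
    + intros E. symmetry in E. now apply ends_disjoint in E.
    + intros A. exfalso. apply (asymptotic_up_down g2 c2 p2 g1 xi1); auto. apply (gflow_down_conv _ _ _ _ _ _ G1 D1).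
  - pose proof (conv_to_unique _ _ _ W1 (gflow_down_end _ _ _ _ _ _ G1 D1)) as ->.
    pose proof (conv_to_unique _ _ _ W2 (gflow_down_end _ _ _ _ _ _ G2 D2)) as ->. split.
    + intros E. injection E as E. apply squash_inj in E. subst xi2. eapply down_down_asymptotic; eauto.
    + intros A. assert (xi1 = xi2) as <-; [exact (asymptotic_down_down _ _ _ _ _ _ _ _ _ _ _ _ G1 G2 D1 D2 A)|reflexivity].
Qed.

(** * Existence of geodesics *)

Definition lin_sol (l : R) (U Q : R -> R) : Prop :=
  forall s : R, is_derive U s (Q s) /\ is_derive Q s (l * U s).

Lemma lin_sol_exists l u0 q0 : exists U Q, lin_sol l U Q /\ U 0 = u0 /\ Q 0 = q0.
Proof.
  destruct (Rtotal_order l 0) as [L|[L|L]].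
  - set (n := sqrt (- l)). assert (Hn : 0 < n) by (apply sqrt_lt_R0; lra).
    assert (En : n * n = - l) by (apply sqrt_sqrt; lra).
    exists (fun s => u0 * cos (n * s) + q0 / n * sin (n * s)),
           (fun s => - u0 * n * sin (n * s) + q0 * cos (n * s)).
    split; [|rewrite Rmult_0_r, cos_0, sin_0; split; ring].
    intro s. split.
    + auto_derive; auto. field. lra.
    + replace l with (- (n * n)) by lra. auto_derive; auto. field. lra.
  - exists (fun s => u0 + q0 * s), (fun s => q0). split; [|split; ring].
    intro s. subst l. split; auto_derive; auto; ring.
  - set (n := sqrt l). assert (Hn : 0 < n) by (apply sqrt_lt_R0; lra).
    assert (En : n * n = l) by (apply sqrt_sqrt; lra).
    exists (fun s => u0 * cosh (n * s) + q0 / n * sinh (n * s)),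
           (fun s => u0 * n * sinh (n * s) + q0 * cosh (n * s)).
    split; [|rewrite Rmult_0_r, cosh_0, sinh_0; split; ring].
    intro s. rewrite <- En. split; auto_derive; auto; field; lra.
Qed.

Lemma lin_sol_energy l U Q : lin_sol l U Q -> Q 0 ^ 2 = 3 + l * (U 0 ^ 2 - 1) ->
  forall s, Q s ^ 2 = 3 + l * (U s ^ 2 - 1).
Proof.
  intros H E s.
  assert (C : Q s * Q s - l * (U s * U s) = Q 0 * Q 0 - l * (U 0 * U 0)).
  { apply (derive_0_const (fun s => Q s * Q s - l * (U s * U s))
      (fun s => (l * U s * Q s + Q s * (l * U s)) - l * (Q s * U s + U s * Q s))); [|intros; ring].
    intro r. destruct (H r) as [HU HQ]. apply is_derive_minus_R.
    - now apply is_derive_mult_R.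
    - apply (is_derive_scal_R (fun s => U s * U s)). now apply is_derive_mult_R. }
  nra.
Qed.

Lemma lin_sol_rev l U Q : lin_sol l U Q -> lin_sol l (fun s => U (- s)) (fun s => - Q (- s)).
Proof.
  intros H s. destruct (H (- s)) as [HU HQ].
  assert (D : forall (f : R -> R) df, is_derive f (- s) df -> is_derive (fun s => f (- s)) s (- df)).
  { intros f df Hf. apply is_derive_eq with (-1 * df); [|ring].
    apply (is_derive_comp f (fun s => - s) s df (-1)); auto. auto_derive; auto. }
  split; [now apply D|]. apply is_derive_eq with (- - (l * U (- s))); [|ring].
  apply (is_derive_opp (fun s => Q (- s)) s). now apply D.
Qed.

(* The unit speed parameter [t] as a function of [s]. *)
Definition clock (U Q : R -> R) (s : R) : R := s / 2 - sqrt 3 / 4 * lag (U s) (Q s).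

Lemma clock_derive c U Q s : lin_sol (lam c) U Q -> 1 < U s ->
  Q s ^ 2 = 3 + lam c * (U s ^ 2 - 1) -> is_derive (clock U Q) s (/ srate (U s)).
Proof.
  intros H Hu E. destruct (H s) as [DU DQ].
  destruct (energy_gap c (U s) (Q s) Hu E) as (G1 & G2 & G). unfold clock, lag.
  apply is_derive_eq with (/ 2 * 1 - sqrt 3 / 4 * (
    (sqrt 3 * Q s + lam c * U s) / (sqrt 3 * U s + Q s) -
    (sqrt 3 * Q s - lam c * U s) / (sqrt 3 * U s - Q s))).
  { apply is_derive_minus_R.
    - apply is_derive_ext with (fun s => / 2 * s); [intros; unfold Rdiv; apply Rmult_comm|].
      apply is_derive_scal_R, is_derive_id_R.
    - apply (is_derive_scal_R (fun s => ln (sqrt 3 * U s + Q s) - ln (sqrt 3 * U s - Q s))).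
      apply is_derive_minus_R;
      [apply (is_derive_ln_comp (fun t => sqrt 3 * U t + Q t))
      |apply (is_derive_ln_comp (fun t => sqrt 3 * U t - Q t))]; auto.
      + apply is_derive_plus_R; auto. now apply (is_derive_scal_R U).
      + apply is_derive_minus_R; auto. now apply (is_derive_scal_R U). }
  pose proof (lam_le_1 c).
  transitivity (/ 2 + sqrt 3 * sqrt 3 / 2 * (Q s * Q s - lam c * U s * U s) /
    ((sqrt 3 * U s + Q s) * (sqrt 3 * U s - Q s))).
  - field. split; lra.
  - rewrite G, sqrt3_sq. replace (Q s * Q s - lam c * U s * U s) with (3 - lam c) by nra.
    unfold srate. field. repeat split; nra.
Qed.

Lemma inv_srate_ge u : 1 < u -> 1 / 2 <= / srate u.
Proof.
  intros H. pose proof (srate_pos u H). pose proof (srate_lt_2 u).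
  assert (/ 2 <= / srate u) by (apply Rinv_le_contravar; lra). lra.
Qed.

(** Because [srate < 2], the clock runs at rate at least 1/2. So its inverse is 2-Lipschitz, and it
    is unbounded when [U] never comes down to 1. *)
Lemma clock_expands c U Q a b : lin_sol (lam c) U Q ->
  (forall s, Q s ^ 2 = 3 + lam c * (U s ^ 2 - 1)) ->
  (forall r, a <= r <= b -> 1 < U r) -> a <= b ->
  (b - a) / 2 <= clock U Q b - clock U Q a.
Proof.
  intros H E HU Hab.
  enough (clock U Q a - / 2 * a <= clock U Q b - / 2 * b) by lra.
  apply (derive_le (fun s => clock U Q s - / 2 * s) (fun s => / srate (U s) - / 2 * 1)); auto.
  - intros r Hr. apply is_derive_minus_R; [eapply clock_derive; eauto|].
    apply is_derive_scal_R, is_derive_id_R.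
  - intros r Hr. pose proof (inv_srate_ge (U r) (HU r Hr)). lra.
Qed.

Lemma lin_sol_continuity l U Q : lin_sol l U Q -> continuity U /\ continuity Q.
Proof.
  intros H. split; [apply (derive_continuity U Q)|apply (derive_continuity Q (fun s => l * U s))];
    intro; apply H.
Qed.

Lemma first_exit (U : R -> R) b : continuity U -> 1 < U 0 -> 0 <= b -> U b <= 1 ->
  exists m, 0 < m <= b /\ U m = 1 /\ forall r, 0 <= r < m -> 1 < U r.
Proof.
  intros C U0 Hb HUb.
  destruct (completeness (fun s => 0 <= s /\ forall r, 0 <= r <= s -> 1 < U r)) as [m [M1 M2]].
  { exists b. intros s [Hs Hr]. apply Rnot_lt_le. intro. pose proof (Hr b ltac:(lra)). lra. }
  { exists 0. split; [lra|]. intros r Hr. replace r with 0 by lra. auto. }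
  assert (m0 : 0 <= m). { apply M1. split; [lra|]. intros r Hr. replace r with 0 by lra. auto. }
  assert (Below : forall r, 0 <= r < m -> 1 < U r).
  { intros r Hr. apply Rnot_le_lt. intro Hle. assert (m <= r); [|lra].
    apply M2. intros s [Hs Hs']. apply Rnot_lt_le. intro. pose proof (Hs' r ltac:(lra)). lra. }
  pose proof (continuity_at U m C) as Cont.
  assert (Hge : 1 <= U m).
  { destruct m0 as [m0|<-]; [|lra]. apply Rnot_lt_le. intro Hlt.
    destruct (Cont (1 - U m) ltac:(lra)) as (d & Hd & HC).
    set (r := Rmax 0 (m - d / 2)).
    assert (0 <= r) by apply Rmax_l. assert (m - d / 2 <= r) by apply Rmax_r.
    assert (r < m) by (apply Rmax_lub_lt; lra).
    pose proof (HC r ltac:(apply Rabs_def1; lra)) as A. apply Rabs_def2 in A.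
    pose proof (Below r ltac:(lra)). lra. }
  assert (Hle : U m <= 1).
  { apply Rnot_lt_le. intro Hgt. destruct (Cont (U m - 1) ltac:(lra)) as (d & Hd & HC).
    assert (m + d / 2 <= m); [|lra]. apply M1. split; [lra|]. intros r Hr.
    destruct (Rlt_dec r m); [apply Below; lra|].
    pose proof (HC r ltac:(apply Rabs_def1; lra)) as A. apply Rabs_def2 in A. lra. }
  exists m. split; [split|split; [lra|auto]].
  - destruct m0 as [|E]; auto. rewrite <- E in Hle. lra.
  - apply M2. intros s [Hs Hr]. apply Rnot_lt_le. intro. pose proof (Hr b ltac:(lra)). lra.
Qed.

Lemma clock_continuity_pt c U Q s : lin_sol (lam c) U Q -> 1 < U s ->
  Q s ^ 2 = 3 + lam c * (U s ^ 2 - 1) -> continuity_pt (clock U Q) s.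
Proof.
  intros H Hu E. apply continuity_pt_filterlim, (ex_derive_continuous (clock U Q)).
  eexists. eapply clock_derive; eauto.
Qed.

Lemma clock_ivt c U Q b t : lin_sol (lam c) U Q ->
  (forall s, Q s ^ 2 = 3 + lam c * (U s ^ 2 - 1)) -> 0 <= t -> 0 <= b ->
  (forall r, 0 <= r <= b -> 1 < U r) -> t <= clock U Q b - clock U Q 0 ->
  exists s, 0 <= s <= b /\ clock U Q s - clock U Q 0 = t.
Proof.
  intros H E Ht Hb HU HB. destruct Ht as [Ht|<-].
  2:{ exists 0. split; [lra|ring]. }
  destruct HB as [HB|HB].
  2:{ exists b. split; [lra|auto]. }
  assert (0 < b). { destruct Hb as [|Hb]; auto. rewrite <- Hb, Rminus_eq_0 in HB. lra. }
  destruct (Ranalysis5.IVT_interv (fun s => clock U Q s - (clock U Q 0 + t)) 0 b) as [s [Hs Es]]; auto; try lra.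
  - intros a Ha. apply (continuity_pt_minus (clock U Q) (fun _ => clock U Q 0 + t)).
    + eapply clock_continuity_pt; eauto.
    + apply continuity_pt_const. intros ? ?; reflexivity.
  - exists s. split; auto. lra.
Qed.

(** Completeness of the geodesic. If [U] comes down to 1 at a first [m], then [Q m = - sqrt 3] and
    [sqrt 3 U + Q] tends to 0 there, so its logarithm sends the clock to infinity before the exit.
    Otherwise linear growth suffices. *)
Lemma clock_onto_forward c U Q t : lin_sol (lam c) U Q ->
  (forall s, Q s ^ 2 = 3 + lam c * (U s ^ 2 - 1)) -> 1 < U 0 -> 0 <= t ->
  exists s, 0 <= s /\ (forall r, 0 <= r <= s -> 1 < U r) /\ clock U Q s - clock U Q 0 = t.
Proof.
  intros H E U0 Ht. destruct (lin_sol_continuity _ _ _ H) as [CU CQ].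
  destruct (classic (exists b, 0 <= b /\ U b <= 1)) as [(b & Hb & HUb)|N].
  - destruct (first_exit U b CU U0 Hb HUb) as (m & [m0 _] & Um & Below).
    (* The energy leaves the signs open; a positive derivative would put [U] below 1 just before
       [m]. *)
    assert (Qm : Q m = - sqrt 3).
    { pose proof (E m) as Em. rewrite Um in Em. pose proof sqrt3_sq. pose proof sqrt3_pos.
      assert (Q m <= 0).
      { apply Rnot_lt_le. intro Hpos.
        destruct (proj1 (is_derive_Reals U m (Q m)) (proj1 (H m)) (Q m) Hpos) as [d Hd].
        set (h := - Rmin (d / 2) m).
        assert (Rmin (d / 2) m <= d / 2) by apply Rmin_l. assert (Rmin (d / 2) m <= m) by apply Rmin_r.
        pose proof (cond_pos d).
        assert (0 < Rmin (d / 2) m) by (apply Rmin_glb_lt; lra).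
        specialize (Hd h ltac:(unfold h; lra)).
        assert (Rabs h < d) by (unfold h; rewrite Rabs_Ropp, Rabs_right; lra).
        specialize (Hd H6). apply Rabs_def2 in Hd.
        pose proof (Below (m + h) ltac:(unfold h; lra)).
        assert (0 < (U (m + h) - U m) / h) by lra.
        assert ((U (m + h) - U m) / h < 0); [|lra].
        unfold Rdiv. assert (/ h < 0) by (apply Rinv_lt_0_compat; unfold h; lra). nra. }
      nra. }
    (* Chosen so that [sqrt 3 U + Q <= k] makes the logarithmic term of the clock at least
       [t + clock U Q 0 + 1]. *)
    set (k := exp (- (4 / sqrt 3 * (t + clock U Q 0 + 1)) )).
    pose proof sqrt3_bounds as S3. pose proof sqrt3_sq as S33.
    assert (Hk : 0 < k) by apply exp_pos.
    set (e := Rmin (1 / 4) (k / 4)). assert (He : 0 < e) by (apply Rmin_glb_lt; lra).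
    assert (e <= 1 / 4) by apply Rmin_l. assert (e <= k / 4) by apply Rmin_r.
    destruct (continuity_at U m CU e He) as (d1 & Hd1 & C1). destruct (continuity_at Q m CQ e He) as (d2 & Hd2 & C2).
    set (b' := Rmax 0 (m - Rmin d1 d2 / 2)).
    assert (Rmin d1 d2 <= d1) by apply Rmin_l. assert (Rmin d1 d2 <= d2) by apply Rmin_r.
    assert (0 < Rmin d1 d2) by (apply Rmin_glb_lt; lra).
    assert (b0 : 0 <= b') by apply Rmax_l. assert (m - Rmin d1 d2 / 2 <= b') by apply Rmax_r.
    assert (b1 : b' < m) by (apply Rmax_lub_lt; lra).
    pose proof (C1 b' ltac:(apply Rabs_def1; lra)) as A1.
    pose proof (C2 b' ltac:(apply Rabs_def1; lra)) as A2.
    apply Rabs_def2 in A1, A2. rewrite Um in A1. rewrite Qm in A2.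
    pose proof (Below b' ltac:(lra)) as Ub.
    destruct (energy_gap c (U b') (Q b') Ub (E b')) as (G1 & G2 & _).
    assert (B : t <= clock U Q b' - clock U Q 0).
    { unfold clock at 1, lag.
      assert (L1 : ln (sqrt 3 * U b' + Q b') <= ln k) by (apply ln_le; nra).
      assert (L2 : ln 1 <= ln (sqrt 3 * U b' - Q b')) by (apply ln_le; nra). rewrite ln_1 in L2.
      unfold k in L1. rewrite ln_exp in L1.
      assert (sqrt 3 / 4 * (4 / sqrt 3 * (t + clock U Q 0 + 1)) = t + clock U Q 0 + 1) by (field; lra).
      nra. }
    destruct (clock_ivt c U Q b' t H E Ht b0) as (s & Hs & Es); auto.
    { intros r Hr. apply Below. lra. }
    exists s. split; [lra|]. split; auto. intros r Hr. apply Below. lra.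
  - assert (HU : forall r, 0 <= r -> 1 < U r).
    { intros r Hr. apply Rnot_le_lt. intro. apply N. now exists r. }
    destruct (clock_ivt c U Q (2 * t) t H E Ht) as (s & Hs & Es); auto; try lra.
    { intros r Hr. apply HU; lra. }
    { pose proof (clock_expands c U Q 0 (2 * t) H E ltac:(intros; apply HU; lra) ltac:(lra)). lra. }
    exists s. split; [lra|]. split; auto. intros r Hr. apply HU; lra.
Qed.

(** [s], of either sign, lies in the component of [U > 1] that contains 0; there the clock is
    strictly increasing. *)
Definition reach (U : R -> R) (s : R) : Prop := forall r, Rmin 0 s <= r <= Rmax 0 s -> 1 < U r.

Lemma clock_onto c U Q : lin_sol (lam c) U Q ->
  (forall s, Q s ^ 2 = 3 + lam c * (U s ^ 2 - 1)) -> 1 < U 0 ->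
  forall t, exists s, reach U s /\ clock U Q s - clock U Q 0 = t.
Proof.
  intros H E U0 t. destruct (Rle_dec 0 t) as [Ht|Ht].
  - destruct (clock_onto_forward c U Q t H E U0 Ht) as (s & Hs & HU & Es). exists s. split; auto.
    intros r Hr. rewrite Rmin_left, Rmax_right in Hr by lra. auto.
  - destruct (clock_onto_forward c (fun s => U (- s)) (fun s => - Q (- s)) (- t)
      (lin_sol_rev _ _ _ H)) as (s & Hs & HU & Es); try lra.
    + intro s. rewrite <- E. ring.
    + now rewrite Ropp_0.
    + exists (- s). split.
      * intros r Hr. rewrite Rmin_right, Rmax_left in Hr by lra.
        replace r with (- - r) by ring. apply HU. lra.
      * unfold clock, lag in *. rewrite Ropp_0 in Es.
        replace (sqrt 3 * U (- s) + - Q (- s)) with (sqrt 3 * U (- s) - Q (- s)) in Es by ring.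
        replace (sqrt 3 * U (- s) - - Q (- s)) with (sqrt 3 * U (- s) + Q (- s)) in Es by ring.
        replace (sqrt 3 * U 0 + - Q 0) with (sqrt 3 * U 0 - Q 0) in Es by ring.
        replace (sqrt 3 * U 0 - - Q 0) with (sqrt 3 * U 0 + Q 0) in Es by ring. lra.
Qed.

(** The Lipschitz bound on [s] stands in for continuity of the inverse and lets the difference
    quotient of [f] be inverted directly. *)
Lemma inverse_derive (f s : R -> R) (t0 D k : R) : is_derive f (s t0) D -> 0 < D ->
  (forall t, f (s t) = t + k) -> (forall t, Rabs (s t - s t0) <= 2 * Rabs (t - t0)) ->
  is_derive s t0 (/ D).
Proof.
  intros Hf HD Inv Lip. apply is_derive_Reals. apply is_derive_Reals in Hf.
  intros e He. destruct (Hf (e * D / 4) ltac:(apply Rdiv_lt_0_compat; nra)) as [d Hd].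
  assert (Hd2 : 0 < d / 2) by (pose proof (cond_pos d); lra).
  exists (mkposreal (d / 2) Hd2). intros h Hh Hhd. simpl in Hhd.
  set (z := s (t0 + h) - s t0).
  assert (Ez : f (s t0 + z) - f (s t0) = h).
  { unfold z. replace (s t0 + (s (t0 + h) - s t0)) with (s (t0 + h)) by ring. rewrite !Inv. ring. }
  assert (Nz : z <> 0). { intro Z. rewrite Z, Rplus_0_r in Ez. lra. }
  assert (Lz : Rabs z <= 2 * Rabs h).
  { eapply Rle_trans; [apply Lip|]. replace (t0 + h - t0) with h by ring. lra. }
  specialize (Hd z Nz ltac:(lra)). rewrite Ez in Hd.
  replace (z / h - / D) with ((z / h) * (/ D * - (h / z - D))) by (field; repeat split; auto; lra).
  rewrite !Rabs_mult, Rabs_Ropp, (Rabs_right (/ D)) by (apply Rle_ge; left; now apply Rinv_0_lt_compat).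
  assert (Rabs (z / h) <= 2).
  { unfold Rdiv. rewrite Rabs_mult, Rabs_inv. pose proof (Rabs_pos_lt h Hh).
    apply (Rmult_le_reg_r (Rabs h)); auto. rewrite Rmult_assoc, Rinv_l by lra. lra. }
  assert (0 < / D) by now apply Rinv_0_lt_compat.
  assert (/ D * Rabs (h / z - D) < e / 2).
  { apply Rlt_le_trans with (/ D * (e * D / 4)); [apply Rmult_lt_compat_l; auto|].
    replace (/ D * (e * D / 4)) with (e / 4) by (field; lra). lra. }
  pose proof (Rabs_pos (z / h)). pose proof (Rabs_pos (h / z - D)).
  assert (0 <= / D * Rabs (h / z - D)) by nra. nra.
Qed.

(** The linear solution is reparametrised by the inverse of the clock, which is unique because the
    clock expands. The last clause says that each parameter before the exit is reached in finite
    time; it carries boundary value problems for [U] over to geodesics. *)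
Theorem flow_exists c U Q x0 : lin_sol (lam c) U Q -> 1 < U 0 ->
  Q 0 ^ 2 = 3 + lam c * (U 0 ^ 2 - 1) ->
  exists x u p, flow c x u p /\ x 0 = x0 /\ u 0 = U 0 /\ p 0 = Q 0 /\
    forall s, 0 <= s -> (forall r, 0 <= r <= s -> 1 < U r) ->
      exists T, 0 <= T /\ x T = x0 + 2 * c * s /\ u T = U s.
Proof.
  intros H U0 E0. pose proof (lin_sol_energy _ _ _ H E0) as E.
  pose proof (clock_onto c U Q H E U0) as On.
  set (s := fun t => proj1_sig (constructive_indefinite_description _ (On t))).
  assert (Hs : forall t, reach U (s t) /\ clock U Q (s t) - clock U Q 0 = t).
  { intro t. exact (proj2_sig (constructive_indefinite_description _ (On t))). }
  clearbody s.
  assert (Exp : forall a b, reach U a -> reach U b -> Rabs (a - b) <= 2 * Rabs (clock U Q a - clock U Q b)).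
  { assert (W : forall a b, a <= b -> reach U a -> reach U b ->
       Rabs (a - b) <= 2 * Rabs (clock U Q a - clock U Q b)).
    { intros a b Hab Ra Rb. pose proof (clock_expands c U Q a b H E) as Cx.
      assert (HU : forall r, a <= r <= b -> 1 < U r).
      { intros r Hr. destruct (Rle_dec 0 r).
        - apply Rb. split; [eapply Rle_trans; [apply Rmin_l|lra]|eapply Rle_trans; [|apply Rmax_r]; lra].
        - apply Ra. split; [eapply Rle_trans; [apply Rmin_r|lra]|eapply Rle_trans; [|apply Rmax_l]; lra]. }
      specialize (Cx HU Hab). rewrite Rabs_minus_sym, (Rabs_right (b - a)) by lra.
      rewrite Rabs_minus_sym, Rabs_right by lra. lra. }
    intros a b Ra Rb. destruct (Rle_dec a b); [apply W; auto|].
    rewrite (Rabs_minus_sym a), (Rabs_minus_sym (clock U Q a)). apply W; auto; lra. }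
  assert (HUs : forall t, 1 < U (s t)).
  { intro t. apply (proj1 (Hs t)). split; [apply Rmin_r|apply Rmax_r]. }
  assert (Ds : forall t : R, is_derive s t (srate (U (s t)))).
  { intro t. pose proof (srate_pos _ (HUs t)). apply is_derive_eq with (/ / srate (U (s t))); [|apply Rinv_inv].
    apply (inverse_derive (clock U Q) s t (/ srate (U (s t))) (clock U Q 0)).
    - eapply clock_derive; eauto.
    - now apply Rinv_0_lt_compat.
    - intro r. destruct (Hs r) as [_ Er]. lra.
    - intro r. destruct (Hs r) as [Rr Er]. destruct (Hs t) as [Rt Et].
      eapply Rle_trans; [apply Exp; auto|]. right. do 2 f_equal. lra. }
  assert (R0 : reach U 0). { intros r Hr. rewrite Rmin_left, Rmax_left in Hr by lra. replace r with 0 by lra. auto. }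
  assert (Uniq : forall a t, reach U a -> clock U Q a - clock U Q 0 = t -> s t = a).
  { intros a t Ra Ea. destruct (Hs t) as [Rt Et]. pose proof (Exp (s t) a Rt Ra) as X.
    replace (clock U Q (s t) - clock U Q a) with 0 in X by lra. rewrite Rabs_R0 in X.
    pose proof (Rabs_pos (s t - a)).
    destruct (Req_dec (s t - a) 0) as [|Nn]; [lra|]. pose proof (Rabs_pos_lt _ Nn). lra. }
  assert (s0 : s 0 = 0) by (apply Uniq; auto; ring).
  exists (fun t => x0 + 2 * c * s t), (fun t => U (s t)), (fun t => Q (s t)).
  split; [|rewrite s0; repeat split; auto; try ring].
  - intro t. split; [apply HUs|]. split; [|split; [|split]].
    + apply is_derive_eq with (0 + 2 * c * srate (U (s t))); [|ring].
      apply is_derive_plus_R; [apply is_derive_const_R|]. now apply (is_derive_scal_R s).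
    + apply is_derive_eq with (srate (U (s t)) * Q (s t)); [|ring].
      apply (is_derive_comp U s t); auto. apply H.
    + apply is_derive_eq with (srate (U (s t)) * (lam c * U (s t))); [|ring].
      apply (is_derive_comp Q s t); auto. apply H.
    + apply E.
  - intros a Ha HU. assert (Ra : reach U a).
    { intros r Hr. rewrite Rmin_left, Rmax_right in Hr by lra. auto. }
    exists (clock U Q a - clock U Q 0).
    pose proof (clock_expands c U Q 0 a H E HU Ha). rewrite (Uniq a _ Ra eq_refl).
    repeat split; auto. lra.
Qed.

(** * Rays with a common end *)

(** Gronwall for [a ^ 2 + b ^ 2]. The factor [m] is a change of time: 1 for the linear equation,
    [srate] along a trajectory. *)
Lemma linear_pair_zero (a b m : R -> R) (l : R) :
  (forall t : R, is_derive a t (b t * m t)) -> (forall t : R, is_derive b t (l * a t * m t)) ->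
  (forall t, 0 <= m t <= 2) -> a 0 = 0 -> b 0 = 0 -> forall t, 0 <= t -> a t = 0 /\ b t = 0.
Proof.
  intros Da Db Hm A0 B0 t Ht. set (K := 2 * (1 + Rabs l)).
  assert (G : - ((a 0 * a 0 + b 0 * b 0) * exp (- K * 0)) <=
              - ((a t * a t + b t * b t) * exp (- K * t))).
  { apply (derive_le (fun t => - ((a t * a t + b t * b t) * exp (- K * t)))
     (fun t => - (((b t * m t * a t + a t * (b t * m t)) +
                   (l * a t * m t * b t + b t * (l * a t * m t))) * exp (- K * t) +
                  (a t * a t + b t * b t) * (- K * exp (- K * t))))); auto.
    - intros r _. apply (is_derive_opp (fun t => (a t * a t + b t * b t) * exp (- K * t)) r).
      apply (is_derive_mult_R (fun t => a t * a t + b t * b t) (fun t => exp (- K * t))).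
      + apply is_derive_plus_R; apply is_derive_mult_R; auto.
      + auto_derive; auto. ring.
    - intros r _. pose proof (exp_pos (- K * r)). specialize (Hm r).
      assert (B : 2 * (a r * b r) * (m r * (1 + l)) <= K * (a r * a r + b r * b r)).
      { pose proof (Rle_abs (2 * (a r * b r) * (m r * (1 + l)))) as HH.
        rewrite (Rabs_mult (2 * (a r * b r))), (Rabs_mult (m r)), (Rabs_right (m r)) in HH by lra.
        assert (Rabs (2 * (a r * b r)) <= a r * a r + b r * b r).
        { apply Rabs_le. pose proof (pow2_ge_0 (a r - b r)). pose proof (pow2_ge_0 (a r + b r)).
          split; nra. }
        assert (Rabs (1 + l) <= 1 + Rabs l).
        { eapply Rle_trans; [apply Rabs_triang|]. rewrite Rabs_R1. lra. }
        pose proof (Rabs_pos (1 + l)). pose proof (Rabs_pos (2 * (a r * b r))).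
        assert (m r * Rabs (1 + l) <= K) by (unfold K; nra).
        assert (0 <= m r * Rabs (1 + l)) by (apply Rmult_le_pos; lra).
        assert (Rabs (2 * (a r * b r)) * (m r * Rabs (1 + l)) <= (a r * a r + b r * b r) * K)
          by (apply Rmult_le_compat; auto).
        lra. }
      match goal with |- 0 <= - (?X * _ + _) => replace X with (2 * (a r * b r) * (m r * (1 + l))) by ring end.
      nra. }
  rewrite A0, B0 in G. pose proof (exp_pos (- K * t)).
  assert (a t * a t + b t * b t <= 0) by (apply Rnot_lt_le; intro; nra). split; nra.
Qed.

Lemma lin_sol_unique l U Q V W : lin_sol l U Q -> lin_sol l V W -> U 0 = V 0 -> Q 0 = W 0 ->
  forall s, 0 <= s -> U s = V s /\ Q s = W s.
Proof.
  intros H H' E0 E1 s Hs.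
  assert (Z : U s - V s = 0 /\ Q s - W s = 0); [|lra].
  apply (linear_pair_zero (fun s => U s - V s) (fun s => Q s - W s) (fun _ => 1) l); auto; try lra.
  - intro t. apply is_derive_eq with (Q t - W t); [|ring].
    apply is_derive_minus_R; [apply H|apply H'].
  - intro t. apply is_derive_eq with (l * U t - l * V t); [|ring].
    apply is_derive_minus_R; [apply H|apply H'].
  - intros. lra.
Qed.

Lemma flow_lin c x u p U Q : flow c x u p -> lin_sol (lam c) U Q -> U 0 = u 0 -> Q 0 = p 0 ->
  forall t, 0 <= t -> u t = U (stime u p t) /\ p t = Q (stime u p t).
Proof.
  intros F H E0 E1 t Ht. pose proof (stime_derive _ _ _ _ F) as DS.
  assert (Z : u t - U (stime u p t) = 0 /\ p t - Q (stime u p t) = 0); [|lra].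
  apply (linear_pair_zero (fun t => u t - U (stime u p t)) (fun t => p t - Q (stime u p t))
     (fun t => srate (u t)) (lam c)); auto.
  - intro r. apply is_derive_eq with (p r * srate (u r) - srate (u r) * Q (stime u p r)); [|ring].
    apply is_derive_minus_R; [apply (flow_u _ _ _ _ F)|].
    apply (is_derive_comp U (stime u p) r); [apply H|apply DS].
  - intro r.
    apply is_derive_eq with (lam c * u r * srate (u r) - srate (u r) * (lam c * U (stime u p r))); [|ring].
    apply is_derive_minus_R; [apply (flow_p _ _ _ _ F)|].
    apply (is_derive_comp Q (stime u p) r); [apply H|apply DS].
  - intro r. pose proof (srate_pos _ (flow_gt1 _ _ _ _ F r)). pose proof (srate_lt_2 (u r)). lra.
  - rewrite stime_0. lra.
  - rewrite stime_0. lra.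
Qed.

Lemma stime_incr c x u p : flow c x u p -> forall t t', t <= t' -> stime u p t <= stime u p t'.
Proof.
  intros F t t' H. apply (derive_le (stime u p) (fun t => srate (u t))); auto.
  - intros r _. apply (stime_derive _ _ _ _ F).
  - intros r _. left. apply srate_pos, (flow_gt1 _ _ _ _ F).
Qed.

(** On a descent [s] increases and stays bounded; its supremum [se] is the exit parameter. By
    continuity [U], [Q] and [x] take at [se] their limits along the ray, and the energy with [p < 0]
    gives [- sqrt 3]. *)
Lemma down_exit g c p t1 d xi U Q : gflow g c p -> descends g c p t1 d xi ->
  lin_sol (lam c) U Q -> U 0 = cosh (snd (g 0)) -> Q 0 = p 0 ->
  exists se, 0 < se /\ fst (g 0) + 2 * c * se = xi /\ U se = 1 /\ Q se = - sqrt 3 /\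
    forall r, 0 <= r < se -> 1 < U r.
Proof.
  intros G D H E0 E1. pose proof (gflow_down_conv _ _ _ _ _ _ G D) as Cv.
  destruct G as [F Hy]. destruct D as (H1 & H2 & H3 & H4).
  set (x := fun t => fst (g t)) in *. set (u := fun t => cosh (snd (g t))) in *.
  destruct (lin_sol_continuity _ _ _ H) as [CU CQ].
  pose proof (flow_gt1 _ _ _ _ F) as HU1.
  pose proof (flow_lin _ _ _ _ U Q F H E0 E1) as FL.
  pose proof (stime_incr _ _ _ _ F) as SI.
  set (s := stime u p) in *.
  destruct (completeness (fun z => exists t, 0 <= t /\ z = s t)) as [se [Se1 Se2]].
  { exists (s t1 + / d * u t1). intros z (t & Ht & ->). destruct (Rle_dec t t1) as [L|L].
    - pose proof (SI t t1 L). pose proof (HU1 t1). assert (0 < / d) by (apply Rinv_0_lt_compat; lra). nra.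
    - pose proof (flow_down_s _ _ _ _ _ _ F H2 H3 t1 t ltac:(lra) ltac:(lra)) as X. fold s in X.
      pose proof (HU1 t). assert (0 < / d) by (apply Rinv_0_lt_compat; lra). nra. }
  { exists (s 0), 0. split; auto; lra. }
  assert (s0 : s 0 = 0) by apply stime_0.
  assert (Lt : forall t, 0 <= t -> s t < se).
  { intros t Ht. apply Rlt_le_trans with (s (t + 1)).
    - apply (derive_lt s (fun t => srate (u t))); [| |lra].
      + intros r _. apply (stime_derive _ _ _ _ F).
      + intros r _. apply srate_pos, HU1.
    - apply Se1. exists (t + 1). split; auto; lra. }
  assert (Near : forall e, 0 < e -> exists T, 0 <= T /\ forall t, T <= t -> Rabs (s t - se) < e).
  { intros e He. assert (exists T, 0 <= T /\ se - e < s T) as (T & HT & HsT).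
    { apply Classical_Prop.NNPP. intro N. assert (se <= se - e); [|lra].
      apply Se2. intros z (t & Ht & ->). apply Rnot_lt_le. intro. apply N. now exists t. }
    exists T. split; auto. intros t Ht. pose proof (SI T t Ht). pose proof (Lt t ltac:(lra)).
    apply Rabs_def1; lra. }
  assert (LimU : forall (f : R -> R) L, continuity f ->
     (forall e, 0 < e -> exists T, forall t, T <= t -> 0 <= t -> Rabs (f (s t) - L) < e) -> f se = L).
  { intros f L Cf HL. destruct (Req_dec (f se) L) as [|N]; auto. exfalso.
    assert (He : 0 < Rabs (f se - L) / 2). { pose proof (Rabs_pos_lt (f se - L) ltac:(lra)). lra. }
    destruct (continuity_at f se Cf _ He) as (dd & Hdd & Hc).
    destruct (Near dd Hdd) as (T1 & HT1 & HN). destruct (HL _ He) as (T2 & HT2).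
    set (t := Rmax T1 T2). pose proof (Rmax_l T1 T2). pose proof (Rmax_r T1 T2).
    pose proof (Hc (s t) (HN t ltac:(unfold t; lra))) as A.
    pose proof (HT2 t ltac:(unfold t; lra) ltac:(unfold t; lra)) as B.
    assert (Rabs (f se - L) <= Rabs (f (s t) - f se) + Rabs (f (s t) - L)); [|lra].
    replace (f se - L) with (- (f (s t) - f se) + (f (s t) - L)) by ring.
    eapply Rle_trans; [apply Rabs_triang|]. rewrite Rabs_Ropp. lra. }
  assert (USe : U se = 1).
  { apply LimU; auto. intros e He.
    destruct (flow_down_lim _ _ _ _ _ _ F H2 H3 e He) as (T & HT & HTu).
    exists T. intros t Ht Ht0. destruct (FL t Ht0) as [<- _].
    pose proof (HTu t Ht). pose proof (HU1 t). apply Rabs_def1; lra. }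
  assert (QSe : Q se = - sqrt 3).
  { pose proof (lin_sol_energy _ _ _ H) as En.
    assert (E2 : Q 0 ^ 2 = 3 + lam c * (U 0 ^ 2 - 1)).
    { rewrite E0, E1. apply (flow_energy _ _ _ _ F). }
    specialize (En E2 se). rewrite USe in En.
    assert (Q se <= 0).
    { apply Rnot_lt_le. intro Hp. destruct (continuity_at Q se CQ _ Hp) as (dd & Hdd & Hc).
      destruct (Near dd Hdd) as (T & HT & HN).
      set (t := Rmax T t1). pose proof (Rmax_l T t1). pose proof (Rmax_r T t1).
      pose proof (Hc (s t) (HN t ltac:(unfold t; lra))) as A. apply Rabs_def2 in A.
      destruct (FL t ltac:(unfold t; lra)) as [_ B].
      pose proof (flow_neg_stays _ _ _ _ _ _ F H2 H3 t ltac:(unfold t; lra)). lra. }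
    pose proof sqrt3_sq. pose proof sqrt3_pos. nra. }
  exists se. split; [|split; [|split; [auto|split; [auto|]]]].
  - rewrite <- s0. apply Lt. lra.
  - apply (LimU (fun z => fst (g 0) + 2 * c * z)).
    + apply (derive_continuity _ (fun z => 0 + 2 * c * 1)). intro z.
      apply is_derive_plus_R; [apply is_derive_const_R|apply is_derive_scal_R, is_derive_id_R].
    + intros e He. destruct (Cv e He) as (T & HT). exists T. intros t Ht _.
      destruct (HT t Ht) as [A _]. cbn [fst] in A.
      pose proof (flow_x_stime _ _ _ _ F t) as X. unfold s. unfold x in X. rewrite X in A. exact A.
  - intros r Hr. assert (exists T, 0 <= T /\ r <= s T) as (T & HT & HrT).
    { destruct (Near (se - r) ltac:(lra)) as (T & HT & HN). exists T. split; auto.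
      specialize (HN T ltac:(lra)). apply Rabs_def2 in HN. lra. }
    destruct (IVT_gen s 0 T r) as (t & Ht & Et).
    { apply (derive_continuity _ _ (stime_derive _ _ _ _ F)). }
    { rewrite s0. rewrite Rmin_left, Rmax_right by lra. lra. }
    rewrite Rmin_left, Rmax_right in Ht by lra. rewrite <- Et. destruct (FL t ltac:(lra)) as [<- _].
    apply HU1.
Qed.

(* Sturm comparison of the two solutions, read backwards from the common end point. *)
Lemma exit_compare c1 U1 Q1 s1 c2 U2 Q2 s2 : lin_sol (lam c1) U1 Q1 -> lin_sol (lam c2) U2 Q2 ->
  0 < c1 < c2 -> 0 < s1 -> 0 < s2 -> 2 * c1 * s1 = 2 * c2 * s2 ->
  U1 s1 = 1 -> Q1 s1 = - sqrt 3 -> U2 s2 = 1 -> Q2 s2 = - sqrt 3 ->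
  (forall r, 0 <= r < s1 -> 1 < U1 r) -> (forall r, 0 <= r < s2 -> 1 < U2 r) -> U2 0 < U1 0.
Proof.
  intros H1 H2 Hc Hs1 Hs2 Ex A1 B1 A2 B2 P1 P2.
  set (X := 2 * c1 * s1). assert (HX : 0 < X) by (unfold X; nra).
  (* Both solutions are expressed through the horizontal distance [r] from the common end, so that
     they live on the same interval [[0, X]]. *)
  set (k1 := / (2 * c1)). set (k2 := / (2 * c2)).
  assert (K : 0 < k2 < k1).
  { unfold k1, k2. split; [apply Rinv_0_lt_compat; lra|apply Rinv_lt_contravar; nra]. }
  assert (DV : forall c U Q k z, lin_sol (lam c) U Q -> forall r : R,
     is_derive (fun r => U (z - k * r)) r (- k * Q (z - k * r)) /\
     is_derive (fun r => - k * Q (z - k * r)) r (k ^ 2 * lam c * U (z - k * r))).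
  { intros c U Q k z H r. destruct (H (z - k * r)) as [HU HQ].
    assert (Dl : is_derive (fun r => z - k * r) r (- k)).
    { apply is_derive_eq with (0 - k * 1); [|ring].
      apply is_derive_minus_R; [apply is_derive_const_R|apply is_derive_scal_R, is_derive_id_R]. }
    split.
    - apply (is_derive_comp U (fun r => z - k * r) r); auto.
    - apply is_derive_eq with (- k * (- k * (lam c * U (z - k * r)))); [|ring].
      apply (is_derive_scal_R (fun r => Q (z - k * r))).
      apply (is_derive_comp Q (fun r => z - k * r) r); auto. }
  set (V1 := fun r => U1 (s1 - k1 * r)). set (W1 := fun r => - k1 * Q1 (s1 - k1 * r)).
  set (V2 := fun r => U2 (s2 - k2 * r)). set (W2 := fun r => - k2 * Q2 (s2 - k2 * r)).
  pose proof (DV c1 U1 Q1 k1 s1 H1) as D1. pose proof (DV c2 U2 Q2 k2 s2 H2) as D2.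
  assert (Ek1 : k1 * X = s1) by (unfold k1, X; field; lra).
  assert (Ek2 : k2 * X = s2) by (unfold k2, X; rewrite Ex; field; lra).
  (* In the variable [r] the coefficient of the equation is [k ^ 2 * lam c = k ^ 2 - 1], which is
     larger for the smaller [c]. *)
  assert (L12 : k2 ^ 2 * lam c2 < k1 ^ 2 * lam c1).
  { unfold lam. replace (k2 ^ 2 * (1 - 4 * c2 ^ 2)) with (k2 ^ 2 - 1) by (unfold k2; field; lra).
    replace (k1 ^ 2 * (1 - 4 * c1 ^ 2)) with (k1 ^ 2 - 1) by (unfold k1; field; lra). nra. }
  assert (Pos : forall r, 0 <= r <= X -> 1 <= V1 r /\ 1 <= V2 r).
  { intros r Hr. destruct (Req_dec r 0) as [->|N].
    - unfold V1, V2. rewrite !Rmult_0_r, !Rminus_0_r. lra.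
    - unfold V1, V2.
      assert (k1 * r <= k1 * X) by (apply Rmult_le_compat_l; lra).
      assert (k2 * r <= k2 * X) by (apply Rmult_le_compat_l; lra).
      assert (0 < k1 * r) by (apply Rmult_lt_0_compat; lra).
      assert (0 < k2 * r) by (apply Rmult_lt_0_compat; lra).
      split; left; [apply P1|apply P2]; lra. }
  (* The Wronskian. It starts at [(k1 - k2) sqrt 3 > 0] and does not decrease, so [V1 / V2] strictly
     increases from 1. *)
  set (w := fun r => W1 r * V2 r - V1 r * W2 r).
  assert (Dw : forall r : R, is_derive w r ((k1 ^ 2 * lam c1 * V1 r * V2 r + W1 r * W2 r) -
      (W1 r * W2 r + V1 r * (k2 ^ 2 * lam c2 * V2 r)))).
  { intro r. apply is_derive_minus_R; apply is_derive_mult_R; first [apply D1|apply D2]. }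
  assert (w0 : 0 < w 0).
  { unfold w, W1, W2, V1, V2. rewrite !Rmult_0_r, !Rminus_0_r, A1, A2, B1, B2.
    pose proof sqrt3_pos. nra. }
  assert (Hw : forall r, 0 <= r <= X -> 0 < w r).
  { intros r Hr. apply Rlt_le_trans with (w 0); auto.
    apply (derive_le w _ 0 r (fun t _ => Dw t)); [|lra].
    intros t Ht. destruct (Pos t ltac:(lra)). 
    replace (k1 ^ 2 * lam c1 * V1 t * V2 t + W1 t * W2 t - (W1 t * W2 t + V1 t * (k2 ^ 2 * lam c2 * V2 t)))
      with ((k1 ^ 2 * lam c1 - k2 ^ 2 * lam c2) * (V1 t * V2 t)) by ring.
    apply Rmult_le_pos; [lra|]. apply Rmult_le_pos; lra. }
  assert (Lst : ln (V1 0) - ln (V2 0) < ln (V1 X) - ln (V2 X)).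
  { apply (derive_lt (fun r => ln (V1 r) - ln (V2 r)) (fun r => W1 r / V1 r - W2 r / V2 r)); auto.
    - intros t Ht. destruct (Pos t Ht). apply is_derive_minus_R.
      + apply (is_derive_ln_comp V1); [lra|apply D1].
      + apply (is_derive_ln_comp V2); [lra|apply D2].
    - intros t Ht. destruct (Pos t Ht). pose proof (Hw t Ht).
      replace (W1 t / V1 t - W2 t / V2 t) with (w t / (V1 t * V2 t)) by (unfold w; field; lra).
      apply Rdiv_lt_0_compat; auto. apply Rmult_lt_0_compat; lra. }
  assert (V10 : V1 0 = 1) by (unfold V1; rewrite Rmult_0_r, Rminus_0_r; auto).
  assert (V20 : V2 0 = 1) by (unfold V2; rewrite Rmult_0_r, Rminus_0_r; auto).
  rewrite V10, V20 in Lst. destruct (Pos X ltac:(lra)) as [X1 X2].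
  replace (U1 0) with (V1 X) by (unfold V1; f_equal; lra).
  replace (U2 0) with (V2 X) by (unfold V2; f_equal; lra).
  apply ln_lt_inv; lra.
Qed.

(** Equal nonzero displacements force [c1] and [c2] to have the same sign, and [exit_compare]
    excludes [c1 <> c2], as the starting heights agree. With equal [c] the exit parameters agree,
    and both solutions satisfy the same initial conditions when read backwards from the exit. *)
Lemma exit_unique c1 U1 Q1 s1 c2 U2 Q2 s2 : lin_sol (lam c1) U1 Q1 -> lin_sol (lam c2) U2 Q2 ->
  0 < s1 -> 0 < s2 -> 2 * c1 * s1 = 2 * c2 * s2 -> c1 <> 0 ->
  U1 s1 = 1 -> Q1 s1 = - sqrt 3 -> U2 s2 = 1 -> Q2 s2 = - sqrt 3 ->
  (forall r, 0 <= r < s1 -> 1 < U1 r) -> (forall r, 0 <= r < s2 -> 1 < U2 r) -> U1 0 = U2 0 ->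
  c1 = c2 /\ Q1 0 = Q2 0.
Proof.
  intros H1 H2 Hs1 Hs2 Ex Nc A1 B1 A2 B2 P1 P2 E0.
  assert (Ec : c1 = c2).
  { assert (S : forall c, lam (- c) = lam c) by (intro; unfold lam; ring).
    destruct (Rtotal_order c1 0) as [N|[N|N]]; [|lra|].
    - assert (c2 < 0). { apply Rnot_le_lt. intro. nra. }
      destruct (Rtotal_order c1 c2) as [L|[L|L]]; auto; exfalso.
      + pose proof (exit_compare (- c2) U2 Q2 s2 (- c1) U1 Q1 s1 ltac:(rewrite S; auto)
          ltac:(rewrite S; auto) ltac:(lra) Hs2 Hs1 ltac:(lra) A2 B2 A1 B1 P2 P1). lra.
      + pose proof (exit_compare (- c1) U1 Q1 s1 (- c2) U2 Q2 s2 ltac:(rewrite S; auto)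
          ltac:(rewrite S; auto) ltac:(lra) Hs1 Hs2 ltac:(lra) A1 B1 A2 B2 P1 P2). lra.
    - assert (0 < c2). { apply Rnot_le_lt. intro. nra. }
      destruct (Rtotal_order c1 c2) as [L|[L|L]]; auto; exfalso.
      + pose proof (exit_compare c1 U1 Q1 s1 c2 U2 Q2 s2 H1 H2 ltac:(lra) Hs1 Hs2 Ex A1 B1 A2 B2 P1 P2). lra.
      + pose proof (exit_compare c2 U2 Q2 s2 c1 U1 Q1 s1 H2 H1 ltac:(lra) Hs2 Hs1 ltac:(lra) A2 B2 A1 B1 P2 P1). lra. }
  split; auto. subst c2.
  assert (s1 = s2). { apply (Rmult_eq_reg_l (2 * c1)); lra. } subst s2.
  assert (Sh : forall U Q, lin_sol (lam c1) U Q -> lin_sol (lam c1) (fun r => U (s1 - r)) (fun r => - Q (s1 - r))).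
  { intros U Q H. assert (T : lin_sol (lam c1) (fun r => U (r + s1)) (fun r => Q (r + s1))).
    { intro r. destruct (H (r + s1)) as [HU HQ].
      assert (D : is_derive (fun r => r + s1) r 1).
      { apply is_derive_eq with (1 + 0); [|ring].
        apply is_derive_plus_R; [apply is_derive_id_R|apply is_derive_const_R]. }
      split.
      - apply is_derive_eq with (1 * Q (r + s1)); [|ring]. apply (is_derive_comp U (fun r => r + s1)); auto.
      - apply is_derive_eq with (1 * (lam c1 * U (r + s1))); [|ring].
        apply (is_derive_comp Q (fun r => r + s1)); auto. }
    pose proof (lin_sol_rev _ _ _ T) as T'. cbv beta in T'. intro r. specialize (T' r).
    destruct T' as [TU TQ]. split.
    - apply is_derive_ext with (fun s => U (- s + s1)); [intro; f_equal; apply Rplus_comm|].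
      apply is_derive_eq with (- Q (- r + s1)); auto. do 2 f_equal. ring.
    - apply is_derive_ext with (fun s => - Q (- s + s1)); [intro; do 2 f_equal; apply Rplus_comm|].
      apply is_derive_eq with (lam c1 * U (- r + s1)); auto. do 2 f_equal. ring. }
  destruct (lin_sol_unique _ _ _ _ _ (Sh _ _ H1) (Sh _ _ H2)) with (s := s1) as [_ E]; auto.
  - rewrite Rminus_0_r. lra.
  - rewrite Rminus_0_r. lra.
  - lra.
  - rewrite Rminus_eq_0 in E. lra.
Qed.

Theorem end_determines_direction g1 c1 p1 g2 c2 p2 w : gflow g1 c1 p1 -> gflow g2 c2 p2 ->
  g1 0 = g2 0 -> conv_to (fun t => Phi0 (g1 t)) w -> conv_to (fun t => Phi0 (g2 t)) w ->
  c1 = c2 /\ p1 0 = p2 0.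
Proof.
  intros G1 G2 E0 W1 W2.
  pose proof (flow_energy _ _ _ _ (proj1 G1) 0) as En1. pose proof (flow_energy _ _ _ _ (proj1 G2) 0) as En2.
  cbv beta in En1, En2. rewrite E0 in En1.
  destruct (up_or_down _ _ _ G1) as [U1|(t1 & d1 & xi1 & D1)];
    destruct (up_or_down _ _ _ G2) as [U2|(t2 & d2 & xi2 & D2)].
  - pose proof (conv_to_unique _ _ _ W1 (gflow_up_end _ _ _ G1 U1)) as X1.
    pose proof (conv_to_unique _ _ _ W2 (gflow_up_end _ _ _ G2 U2)) as X2. rewrite X1 in X2.
    injection X2 as X2 _. assert (c1 = c2) by lra. subst c2. split; auto.
    destruct U1, U2. nra.
  - pose proof (conv_to_unique _ _ _ W1 (gflow_up_end _ _ _ G1 U1)) as X1.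
    pose proof (conv_to_unique _ _ _ W2 (gflow_down_end _ _ _ _ _ _ G2 D2)) as X2.
    rewrite X1 in X2. now apply ends_disjoint in X2.
  - pose proof (conv_to_unique _ _ _ W1 (gflow_down_end _ _ _ _ _ _ G1 D1)) as X1.
    pose proof (conv_to_unique _ _ _ W2 (gflow_up_end _ _ _ G2 U2)) as X2.
    rewrite X2 in X1. now apply ends_disjoint in X1.
  - pose proof (conv_to_unique _ _ _ W1 (gflow_down_end _ _ _ _ _ _ G1 D1)) as X1.
    pose proof (conv_to_unique _ _ _ W2 (gflow_down_end _ _ _ _ _ _ G2 D2)) as X2.
    rewrite X1 in X2. injection X2 as X2. apply squash_inj in X2. subst xi2.
    destruct (lin_sol_exists (lam c1) (cosh (snd (g1 0))) (p1 0)) as (V1 & Q1 & L1 & A1 & B1).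
    destruct (lin_sol_exists (lam c2) (cosh (snd (g2 0))) (p2 0)) as (V2 & Q2 & L2 & A2 & B2).
    destruct (down_exit _ _ _ _ _ _ _ _ G1 D1 L1 A1 B1) as (s1 & S1 & X1' & I1 & J1 & K1).
    destruct (down_exit _ _ _ _ _ _ _ _ G2 D2 L2 A2 B2) as (s2 & S2 & X2' & I2 & J2 & K2).
    rewrite E0 in X1', A1.
    destruct (Req_dec c1 0) as [Z|Z].
    (* Vertical rays have no horizontal displacement to compare; here the energy fixes [p 0] up to
       sign and descent makes it negative. *)
    + subst c1. assert (c2 = 0) by nra. subst c2. split; auto.
      assert (Neg : forall g p t d xi, gflow g 0 p -> descends g 0 p t d xi -> p 0 < 0).
      { intros g p t d xi [F _] (T1 & T2 & T3 & _).
        apply Rnot_le_lt. intros [Hp|Hp].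
        - pose proof (flow_up_p _ _ _ _ F ltac:(unfold lam; lra) Hp t). lra.
        - pose proof (flow_energy _ _ _ _ F 0) as E. rewrite <- Hp in E. unfold lam in E.
          pose proof (flow_gt1 _ _ _ _ F 0). nra. }
      pose proof (Neg _ _ _ _ _ G1 D1). pose proof (Neg _ _ _ _ _ G2 D2). nra.
    + rewrite <- B1, <- B2.
      apply (exit_unique c1 V1 Q1 s1 c2 V2 Q2 s2); auto; lra.
Qed.

(** * Geodesics between two points *)

(* In terms of [x], the trajectories satisfy [u'' = k u] with [k = (1 - 4 c^2) / (4 c^2) > -1]. *)
Definition chord (a X b k : R) : Prop :=
  exists V W, lin_sol k V W /\ V 0 = a /\ W 0 ^ 2 = 3 + k * (2 + a ^ 2) /\ V X = b /\
    forall r, 0 <= r < X -> 1 < V r.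

(** The conserved [W ^ 2 - k V ^ 2 = 3 + 2 k] is positive, so [W] has no zero and [V] is monotone
    between two values at least 1, the first of them larger than 1. *)
Lemma lin_sol_monotone_gt1 k V W X : lin_sol k V W -> 0 <= k -> 1 < V 0 ->
  W 0 ^ 2 = 3 + k * (2 + V 0 ^ 2) -> 0 < X -> 1 <= V X -> forall r, 0 <= r < X -> 1 < V r.
Proof.
  intros H Hk V0 W0 HX VX r Hr.
  assert (E : forall s, W s * W s - k * (V s * V s) = 3 + 2 * k).
  { intro s. transitivity (W 0 * W 0 - k * (V 0 * V 0)); [|simpl in W0; lra].
    apply (derive_0_const (fun s => W s * W s - k * (V s * V s))
      (fun s => (k * V s * W s + W s * (k * V s)) - k * (W s * V s + V s * W s))); [|intros; ring].
    intro t. destruct (H t) as [HV HW]. apply is_derive_minus_R.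
    - now apply is_derive_mult_R.
    - apply (is_derive_scal_R (fun s => V s * V s)). now apply is_derive_mult_R. }
  assert (Nz : forall s, W s <> 0).
  { intros s Z. pose proof (E s) as Es. rewrite Z in Es. pose proof (Rle_0_sqr (V s)) as Q. unfold Rsqr in Q.
    assert (0 <= k * (V s * V s)) by (apply Rmult_le_pos; auto). lra. }
  destruct (lin_sol_continuity _ _ _ H) as [_ CW].
  destruct (Rlt_dec 0 (W 0)) as [P0|P0].
  - apply Rlt_le_trans with (V 0); auto. apply (derive_le V W); [|intros t _|lra].
    + intros t _. apply H.
    + left. apply (nonzero_keeps_pos W 0 t); auto.
  - assert (W 0 < 0) by (pose proof (Nz 0); lra).
    apply Rle_lt_trans with (V X); auto. apply Ropp_lt_cancel.
    apply (derive_lt (fun s => - V s) (fun s => - W s)); [|intros t _|lra].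
    + intros t _. apply (is_derive_opp V t), H.
    + assert (W t < 0); [|lra]. apply (nonzero_keeps_neg W 0 t); auto.
Qed.

Lemma chord_zero a X b : 1 < a -> 0 < X -> 1 <= b -> (b - a) ^ 2 = 3 * X ^ 2 -> chord a X b 0.
Proof.
  intros Ha HX Hb E. set (m := (b - a) / X).
  assert (Hm : m ^ 2 = 3).
  { unfold m. replace (((b - a) / X) ^ 2) with ((b - a) ^ 2 / X ^ 2) by (field; lra).
    rewrite E. field. lra. }
  assert (L : lin_sol 0 (fun s => a + m * s) (fun _ => m)).
  { intro s. split; auto_derive; auto; ring. }
  exists (fun s => a + m * s), (fun _ => m). split; auto. split; [ring|]. split; [lra|].
  assert (EX : a + m * X = b) by (unfold m; field; lra). split; auto.
  apply (lin_sol_monotone_gt1 0 (fun s => a + m * s) (fun _ => m)); auto; try lra.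
Qed.

(** The end value [V X = b] forces the initial slope [m = (b - a C) n / S]; the hypothesis is the
    energy condition on this slope, multiplied out. *)
Lemma chord_pos a X b n : 1 < a -> 0 < X -> 1 <= b -> 0 < n ->
  (3 + 2 * n ^ 2) * sinh (n * X) ^ 2 + n ^ 2 * (2 * b * a * cosh (n * X) - b ^ 2 - a ^ 2) = 0 ->
  chord a X b (n ^ 2).
Proof.
  intros Ha HX Hb Hn E. pose proof (sinh_pos (n * X) ltac:(nra)) as HS.
  pose proof (cosh_sq (n * X)) as C2. set (S := sinh (n * X)) in *. set (C := cosh (n * X)) in *.
  set (m := (b - a * C) * n / S).
  assert (Hm : m ^ 2 = 3 + n ^ 2 * (2 + a ^ 2)).
  { unfold m. replace (((b - a * C) * n / S) ^ 2) with ((b - a * C) ^ 2 * n ^ 2 / S ^ 2) by (field; lra).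
    apply (Rmult_eq_reg_r (S ^ 2)); [|nra]. unfold Rdiv. rewrite Rmult_assoc, Rinv_l by nra.
    assert (a ^ 2 * n ^ 2 * C ^ 2 = a ^ 2 * n ^ 2 * (1 + S ^ 2)) by now rewrite C2. nra. }
  set (V := fun s => a * cosh (n * s) + m / n * sinh (n * s)).
  set (W := fun s => a * n * sinh (n * s) + m * cosh (n * s)).
  assert (L : lin_sol (n ^ 2) V W).
  { intro s. unfold V, W. split; auto_derive; auto; field; lra. }
  assert (V0 : V 0 = a) by (unfold V; rewrite Rmult_0_r, cosh_0, sinh_0; ring).
  assert (W0 : W 0 = m) by (unfold W; rewrite Rmult_0_r, cosh_0, sinh_0; ring).
  assert (VX : V X = b) by (unfold V; fold S C; unfold m; field; lra).
  exists V, W. rewrite W0. repeat (split; auto).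
  apply (lin_sol_monotone_gt1 (n ^ 2) V W); auto; try lra; try nra.
Qed.

Lemma chord_neg a X b n : 1 < a -> 0 < X -> 1 <= b -> 0 < n -> n * X < PI ->
  (3 - 2 * n ^ 2) * sin (n * X) ^ 2 + n ^ 2 * (2 * b * a * cos (n * X) - b ^ 2 - a ^ 2) = 0 ->
  chord a X b (- n ^ 2).
Proof.
  intros Ha HX Hb Hn HP E. assert (HnX : 0 < n * X) by nra.
  pose proof (sin_gt_0 (n * X) HnX HP) as HS.
  pose proof (sin2_cos2 (n * X)) as C2. unfold Rsqr in C2.
  set (S := sin (n * X)) in *. set (C := cos (n * X)) in *.
  set (m := (b - a * C) * n / S).
  assert (Hm : m ^ 2 = 3 + - n ^ 2 * (2 + a ^ 2)).
  { unfold m. replace (((b - a * C) * n / S) ^ 2) with ((b - a * C) ^ 2 * n ^ 2 / S ^ 2) by (field; lra).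
    apply (Rmult_eq_reg_r (S ^ 2)); [|nra]. unfold Rdiv. rewrite Rmult_assoc, Rinv_l by nra.
    assert (a ^ 2 * n ^ 2 * (S * S + C * C) = a ^ 2 * n ^ 2 * 1) by now rewrite C2. nra. }
  set (V := fun s => a * cos (n * s) + m / n * sin (n * s)).
  set (W := fun s => - a * n * sin (n * s) + m * cos (n * s)).
  assert (L : lin_sol (- n ^ 2) V W).
  { intro s. unfold V, W. split; auto_derive; auto; field; lra. }
  assert (V0 : V 0 = a) by (unfold V; rewrite Rmult_0_r, cos_0, sin_0; ring).
  assert (W0 : W 0 = m) by (unfold W; rewrite Rmult_0_r, cos_0, sin_0; ring).
  assert (VX : V X = b) by (unfold V; fold S C; unfold m; field; lra).
  exists V, W. rewrite W0. repeat (split; auto).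
  intros r Hr.
  (* The solution interpolates [a] and [b] by sines, whose sum is at least [S] by the addition
     formula; hence [V r] stays above 1. *)
  assert (EV : V r * S = a * sin (n * X - n * r) + b * sin (n * r)).
  { unfold V. rewrite sin_minus. fold S C. unfold m. field. lra. }
  assert (R0 : 0 <= n * r) by nra. assert (R1 : 0 < n * X - n * r) by nra.
  assert (Q1 : 0 < sin (n * X - n * r)) by (apply sin_gt_0; lra).
  assert (Q2 : 0 <= sin (n * r)) by (apply sin_ge_0; lra).
  assert (Q3 : S <= sin (n * X - n * r) + sin (n * r)).
  { unfold S. replace (n * X) with ((n * X - n * r) + n * r) at 1 by ring. rewrite sin_plus.
    pose proof (COS_bound (n * r)). pose proof (COS_bound (n * X - n * r)). nra. }
  apply (Rmult_lt_reg_r S); auto. rewrite EV. nra.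
Qed.

Lemma sin_ge_id_cos z : 0 <= z <= PI -> z * cos z <= sin z.
Proof.
  intros Hz. assert (sin 0 - 0 * cos 0 <= sin z - z * cos z); [|rewrite sin_0 in *; lra].
  apply (derive_le (fun z => sin z - z * cos z) (fun z => z * sin z)); [| |lra].
  - intros t _. auto_derive; auto. ring.
  - intros t Ht. apply Rmult_le_pos; [lra|]. apply sin_ge_0; lra.
Qed.

Lemma continuity_sign_near (f : R -> R) : continuity f -> 0 < f 0 ->
  exists d, 0 < d /\ forall r, 0 <= r < d -> 0 < f r.
Proof.
  intros C H. destruct (continuity_at f 0 C (f 0) H) as (d & Hd & Hc). exists d. split; auto.
  intros r Hr. specialize (Hc r ltac:(rewrite Rminus_0_r, Rabs_right; lra)).
  apply Rabs_def2 in Hc. lra.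
Qed.

Lemma ex_derive_continuity (f : R -> R) : (forall t : R, ex_derive f t) -> continuity f.
Proof.
  intros H t. apply continuity_pt_filterlim, (ex_derive_continuous f t), H.
Qed.

(** The energy condition is solved for the frequency [n] by the intermediate value theorem. The sign
    of [(b - a) ^ 2 - 3 X ^ 2] decides between trigonometric, affine and hyperbolic solutions. Since
    [k = (1 - 4 c ^ 2) / (4 c ^ 2)], only [k > -1] corresponds to a geodesic. *)
Theorem chord_exists a X b : 1 < a -> 0 < X -> 1 <= b -> exists k, -1 < k /\ chord a X b k.
Proof.
  intros Ha HX Hb. assert (Hab : 1 < b * a) by nra.
  destruct (Rtotal_order ((b - a) ^ 2) (3 * X ^ 2)) as [L|[L|L]].
  - set (F := fun n => (3 - 2 * n ^ 2) * sin (n * X) ^ 2 + n ^ 2 * (2 * b * a * cos (n * X) - b ^ 2 - a ^ 2)).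
    (* [F] vanishes to second order at 0. For small [n], [z cos z <= sin z] gives
       [F n >= n ^ 2 G n], and [G 0 = 3 X ^ 2 - (b - a) ^ 2] is positive. *)
    set (G := fun n => (3 - 2 * n ^ 2) * X ^ 2 * cos (n * X) ^ 2 + 2 * b * a * cos (n * X) - b ^ 2 - a ^ 2).
    assert (CF : continuity F). { apply ex_derive_continuity. intro t. unfold F. auto_derive; auto. }
    assert (CG : continuity G). { apply ex_derive_continuity. intro t. unfold G. auto_derive; auto. }
    destruct (continuity_sign_near G CG) as (d & Hd & HG).
    { unfold G. rewrite Rmult_0_l, cos_0. nra. }
    pose proof PI_RGT_0 as Pi.
    (* [n < 1] keeps [k > -1] and [n X < PI] keeps the sines positive; [F] is negative at whichever
       limit comes first. *)
    set (N := Rmin 1 (PI / X)).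
    assert (PX : 0 < PI / X) by (apply Rdiv_lt_0_compat; lra).
    assert (HN : 0 < N) by (apply Rmin_glb_lt; lra).
    assert (N1 : N <= 1) by apply Rmin_l. assert (N2 : N <= PI / X) by apply Rmin_r.
    assert (NX : N * X <= PI).
    { apply Rle_trans with (PI / X * X); [apply Rmult_le_compat_r; lra|right; field; lra]. }
    set (n0 := Rmin (d / 2) (N / 2)).
    assert (Hn0 : 0 < n0) by (apply Rmin_glb_lt; lra).
    assert (n0 <= d / 2) by apply Rmin_l. assert (n0 <= N / 2) by apply Rmin_r.
    assert (F0 : 0 < F n0).
    { pose proof (HG n0 ltac:(lra)) as Gp. unfold F, G in *.
      assert (n0 * X <= PI / 2) by nra.
      pose proof (sin_ge_id_cos (n0 * X) ltac:(split; nra)) as Sc.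
      assert (Cp : 0 <= cos (n0 * X)) by (apply cos_ge_0; nra).
      assert (0 <= n0 * X * cos (n0 * X)) by (apply Rmult_le_pos; nra).
      assert (Sq : (n0 * X * cos (n0 * X)) ^ 2 <= sin (n0 * X) ^ 2) by (apply pow_incr; lra).
      assert (0 < 3 - 2 * n0 ^ 2) by nra.
      assert ((3 - 2 * n0 ^ 2) * (n0 * X * cos (n0 * X)) ^ 2 <= (3 - 2 * n0 ^ 2) * sin (n0 * X) ^ 2)
        by (apply Rmult_le_compat_l; lra).
      assert (0 < n0 ^ 2) by nra.
      set (CC := cos (n0 * X)) in *.
      assert (0 < n0 ^ 2 * ((3 - 2 * n0 ^ 2) * X ^ 2 * CC ^ 2 + 2 * b * a * CC - b ^ 2 - a ^ 2))
        by (apply Rmult_lt_0_compat; auto). nra. }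
    assert (FN : F N < 0).
    { unfold F, N, Rmin. destruct (Rle_dec 1 (PI / X)) as [Le|Gt].
      - assert (XP : X <= PI).
        { apply (Rmult_le_compat_r X) in Le; [|lra]. replace (PI / X * X) with PI in Le by (field; lra). lra. }
        rewrite Rmult_1_l. pose proof (sin2_cos2 X) as C2. unfold Rsqr in C2.
        assert (cos X < 1). { rewrite <- cos_0. apply cos_decreasing_1; lra. }
        pose proof (COS_bound X). set (c := cos X) in *. set (s := sin X) in *.
        assert (0 < (1 - c) * (2 * (b * a) - 1 - c)) by (apply Rmult_lt_0_compat; lra).
        pose proof (pow2_ge_0 (b - a)). nra.
      - replace (PI / X * X) with PI by (field; lra). rewrite sin_PI, cos_PI.
        assert (0 < (PI / X) ^ 2) by nra.
        assert (0 < (PI / X) ^ 2 * (2 * b * a + b ^ 2 + a ^ 2)) by (apply Rmult_lt_0_compat; nra). nra. }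
    destruct (Ranalysis5.IVT_interv (fun n => - F n) n0 N) as (n & Hn & En); try lra.
    { intros t _. apply (continuity_pt_opp F), CF. }
    assert (n <> N) by (intro Z; rewrite Z in En; lra).
    exists (- n ^ 2). split; [nra|].
    apply chord_neg; auto; try lra.
    + assert (n * X < N * X) by (apply Rmult_lt_compat_r; lra). lra.
    + unfold F in En. lra.
  - exists 0. split; [lra|]. now apply chord_zero.
  - set (F := fun n => (3 + 2 * n ^ 2) * sinh (n * X) ^ 2 + n ^ 2 * (2 * b * a * cosh (n * X) - b ^ 2 - a ^ 2)).
    set (G := fun n => - ((3 + 2 * n ^ 2) * X ^ 2 * cosh (n * X) ^ 2 + 2 * b * a * cosh (n * X) - b ^ 2 - a ^ 2)).
    assert (CF : continuity F). { apply ex_derive_continuity. intro t. unfold F. auto_derive; auto. }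
    assert (CG : continuity G). { apply ex_derive_continuity. intro t. unfold G. auto_derive; auto. }
    destruct (continuity_sign_near G CG) as (d & Hd & HG).
    { unfold G. rewrite Rmult_0_l, cosh_0. nra. }
    (* With [N X = a ^ 2 + b ^ 2], [cosh (N X)] is at least [a ^ 2 + b ^ 2], so the bracket in [F N]
       is nonnegative. *)
    set (N := (b ^ 2 + a ^ 2) / X). assert (HN : 0 < N) by (apply Rdiv_lt_0_compat; nra).
    set (n0 := Rmin (d / 2) (N / 2)).
    assert (Hn0 : 0 < n0) by (apply Rmin_glb_lt; lra).
    assert (n0 <= d / 2) by apply Rmin_l. assert (n0 <= N / 2) by apply Rmin_r.
    assert (F0 : F n0 < 0).
    { pose proof (HG n0 ltac:(lra)) as Gp. unfold F, G in *.
      pose proof (sinh_pos (n0 * X) ltac:(nra)).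
      pose proof (sinh_le_id_cosh (n0 * X) ltac:(nra)) as Sc.
      assert (Sq : sinh (n0 * X) ^ 2 <= (n0 * X * cosh (n0 * X)) ^ 2) by (apply pow_incr; lra).
      assert ((3 + 2 * n0 ^ 2) * sinh (n0 * X) ^ 2 <= (3 + 2 * n0 ^ 2) * (n0 * X * cosh (n0 * X)) ^ 2)
        by (apply Rmult_le_compat_l; nra).
      assert (0 < n0 ^ 2) by nra.
      set (CC := cosh (n0 * X)) in *.
      assert (0 < n0 ^ 2 * - ((3 + 2 * n0 ^ 2) * X ^ 2 * CC ^ 2 + 2 * b * a * CC - b ^ 2 - a ^ 2))
        by (apply Rmult_lt_0_compat; auto). nra. }
    assert (FN : 0 < F N).
    { unfold F. assert (NX : N * X = b ^ 2 + a ^ 2) by (unfold N; field; lra). rewrite NX.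
      assert (Hs : 0 < b ^ 2 + a ^ 2) by nra.
      pose proof (sinh_ge_id (b ^ 2 + a ^ 2) ltac:(lra)). pose proof (sinh_le_cosh (b ^ 2 + a ^ 2)).
      set (S := sinh (b ^ 2 + a ^ 2)) in *. set (C := cosh (b ^ 2 + a ^ 2)) in *.
      assert (0 < (3 + 2 * N ^ 2) * S ^ 2) by (apply Rmult_lt_0_compat; nra).
      assert (0 <= N ^ 2 * (2 * b * a * C - b ^ 2 - a ^ 2)); [|lra].
      apply Rmult_le_pos; [nra|]. nra. }
    destruct (Ranalysis5.IVT_interv F n0 N) as (n & Hn & En); try lra.
    { intros t _. apply CF. }
    exists (n ^ 2). split; [nra|]. apply chord_pos; auto; lra.
Qed.

(** * Rays from the base point *)

Lemma flow_gflow c x u p : flow c x u p -> gflow (fun t => (x t, acosh (u t))) c p.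
Proof.
  intros F. pose proof (flow_gt1 _ _ _ _ F) as U.
  assert (E : forall t, cosh (acosh (u t)) = u t). { intro t. apply cosh_acosh. pose proof (U t). lra. }
  split; [|intro t; apply acosh_pos, U]. intro t. destruct (F t) as (H1 & H2 & H3 & H4 & H5).
  cbn [fst snd]. rewrite E. split; [auto|]. split; [auto|]. split; [|auto].
  apply is_derive_ext with u; auto.
Qed.

(** The final height [u1 = 1] is allowed, so that the same boundary value problem yields rays to
    points of [Sigma] and rays to points of the line [y = 0]. *)
Lemma target_exists x1 u1 : 1 <= u1 -> (x1, u1) <> (0, cosh 1) ->
  exists c U Q s1, lin_sol (lam c) U Q /\ U 0 = cosh 1 /\ Q 0 ^ 2 = 3 + lam c * (U 0 ^ 2 - 1) /\
    0 < s1 /\ 2 * c * s1 = x1 /\ U s1 = u1 /\ forall r, 0 <= r < s1 -> 1 < U r.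
Proof.
  intros Hu N. pose proof (cosh_gt_1 1 ltac:(lra)) as Ch. set (a := cosh 1) in *.
  destruct (Req_dec x1 0) as [->|Nx].
  - assert (Nu : u1 <> a) by (intros ->; now apply N).
    assert (S2 : 0 < sqrt 2) by (apply sqrt_lt_R0; lra). assert (S22 : sqrt 2 ^ 2 = 2) by (apply pow2_sqrt; lra).
    (* For [c = 0] the energy law is [p ^ 2 = u ^ 2 + 2], with the solutions [sqrt 2 sinh (s0 + s)]
       and [sqrt 2 sinh (s0 - s)], upwards and downwards. *)
    set (s0 := arcsinh (a / sqrt 2)). set (z := arcsinh (u1 / sqrt 2)).
    assert (E0 : sqrt 2 * sinh s0 = a) by (unfold s0; rewrite sinh_arcsinh; field; lra).
    assert (E1 : sqrt 2 * sinh z = u1) by (unfold z; rewrite sinh_arcsinh; field; lra).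
    assert (Main : forall e, (e = 1 \/ e = -1) -> 0 < e * (z - s0) ->
      exists c U Q s1, lin_sol (lam c) U Q /\ U 0 = a /\ Q 0 ^ 2 = 3 + lam c * (U 0 ^ 2 - 1) /\
        0 < s1 /\ 2 * c * s1 = 0 /\ U s1 = u1 /\ forall r, 0 <= r < s1 -> 1 < U r).
    { intros e He Hpos. set (U := fun s => sqrt 2 * sinh (s0 + e * s)).
      assert (e2 : e * e = 1) by (destruct He as [-> | ->]; ring).
      exists 0, U, (fun s => e * (sqrt 2 * cosh (s0 + e * s))), (e * (z - s0)).
      assert (U0 : U 0 = a) by (unfold U; rewrite Rmult_0_r, Rplus_0_r; auto).
      assert (Uz : U (e * (z - s0)) = u1).
      { unfold U. replace (s0 + e * (e * (z - s0))) with (s0 + e * e * (z - s0)) by ring.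
        rewrite e2. replace (s0 + 1 * (z - s0)) with z by ring. auto. }
      split; [|split; [auto|split; [|split; [auto|split; [ring|split; [auto|]]]]]].
      - intro s. unfold U, lam. split.
        + auto_derive; auto. ring.
        + auto_derive; auto.
          replace (1 - 4 * (0 * (0 * 1))) with 1 by ring.
          transitivity (e * e * (sqrt 2 * sinh (s0 + e * s))); [ring|]. rewrite e2. ring.
      - rewrite U0, Rmult_0_r, Rplus_0_r. unfold lam.
        replace ((e * (sqrt 2 * cosh s0)) ^ 2) with (e * e * sqrt 2 ^ 2 * cosh s0 ^ 2) by ring.
        rewrite e2, cosh_sq. replace (a ^ 2) with (sqrt 2 ^ 2 * sinh s0 ^ 2) by (rewrite <- E0; ring).
        rewrite S22. ring.
      - intros r Hr. destruct He as [-> | ->].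
        + apply Rlt_le_trans with (U 0); [lra|]. unfold U. apply Rmult_le_compat_l; [lra|].
          destruct (Req_dec r 0) as [->|]; [lra|]. left. apply sinh_lt. lra.
        + apply Rle_lt_trans with (U (-1 * (z - s0))); [lra|]. unfold U.
          apply Rmult_lt_compat_l; [lra|]. apply sinh_lt. lra. }
    destruct (Rtotal_order z s0) as [L|[L|L]].
    + apply (Main (-1)); [auto|lra].
    + exfalso. apply Nu. rewrite <- E0, <- E1, L. reflexivity.
    + apply (Main 1); [auto|lra].
  - set (X := Rabs x1). assert (HX : 0 < X) by now apply Rabs_pos_lt.
    destruct (chord_exists a X u1 Ch HX Hu) as (k & Hk & V & W & L & V0 & W0 & VX & Pos).
    (* This is [2 |c|], solved from [k = (1 - 4 c ^ 2) / (4 c ^ 2)]; it rescales the variable [x] of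
       the chord back to [s]. *)
    set (m := / sqrt (1 + k)). assert (Sk : 0 < sqrt (1 + k)) by (apply sqrt_lt_R0; lra).
    assert (Sk2 : sqrt (1 + k) ^ 2 = 1 + k) by (apply pow2_sqrt; lra).
    assert (Hm : 0 < m) by now apply Rinv_0_lt_compat.
    assert (m2 : m ^ 2 = / (1 + k)). { unfold m. rewrite pow_inv, Sk2. reflexivity. }
    set (c := sign x1 * m / 2).
    assert (sg2 : sign x1 ^ 2 = 1).
    { destruct (Rtotal_order x1 0) as [N1|[N1|N1]]; [rewrite sign_eq_m1| lra|rewrite sign_eq_1]; auto; ring. }
    assert (sgX : sign x1 * X = x1).
    { unfold X. destruct (Rtotal_order x1 0) as [N1|[N1|N1]]; [|lra|].
      - rewrite sign_eq_m1, Rabs_left; auto; ring.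
      - rewrite sign_eq_1, Rabs_right; auto; lra. }
    assert (c2 : 4 * c ^ 2 = m ^ 2).
    { unfold c. replace (4 * (sign x1 * m / 2) ^ 2) with (sign x1 ^ 2 * m ^ 2) by field. rewrite sg2. ring. }
    assert (Hl : lam c = m ^ 2 * k). { unfold lam. rewrite c2, m2. field. lra. }
    exists c, (fun s => V (m * s)), (fun s => m * W (m * s)), (X / m).
    assert (D : forall s : R, is_derive (fun s => m * s) s m).
    { intro s. apply is_derive_eq with (m * 1); [apply is_derive_scal_R, is_derive_id_R|ring]. }
    split; [|split; [|split; [|split; [|split; [|split]]]]].
    + intro s. destruct (L (m * s)) as [HV HW]. split.
      * apply (is_derive_comp V (fun s => m * s)); auto.
      * rewrite Hl. apply is_derive_eq with (m * (m * (k * V (m * s)))); [|ring].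
        apply (is_derive_scal_R (fun s => W (m * s))). apply (is_derive_comp W (fun s => m * s)); auto.
    + now rewrite Rmult_0_r.
    + rewrite Rmult_0_r, Rpow_mult_distr, W0, V0, Hl, m2. field. lra.
    + now apply Rdiv_lt_0_compat.
    + unfold c. rewrite <- sgX at 2. field. lra.
    + replace (m * (X / m)) with X by (field; lra). auto.
    + intros r Hr. apply Pos. split; [nra|].
      destruct Hr as [_ Hr]. apply (Rmult_lt_compat_l m) in Hr; auto.
      replace (m * (X / m)) with X in Hr by (field; lra). auto.
Qed.

Lemma acosh_cosh_1 : acosh (cosh 1) = 1.
Proof. apply acosh_cosh. lra. Qed.

Theorem geodesic_through q : in_Sigma q -> q <> p0 ->
  exists g T, geodesic g /\ g 0 = p0 /\ 0 < T /\ g T = q.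
Proof.
  destruct q as [x y]. unfold in_Sigma; cbn [snd]. intros Hy N.
  pose proof (cosh_gt_1 y Hy) as Cy.
  destruct (target_exists x (cosh y) ltac:(lra)) as (c & U & Q & s1 & L & U0 & E & Hs & Ex & Eu & Pos).
  { intro Z. injection Z as Z1 Z2. apply N. unfold p0. apply cosh_inj in Z2; [|lra|lra]. now subst. }
  pose proof (cosh_gt_1 1 ltac:(lra)) as Ch.
  destruct (flow_exists c U Q 0 L ltac:(lra) E) as (X & u & p & F & X0 & u0 & p0' & Rch).
  destruct (Rch s1 ltac:(lra)) as (T & HT & XT & uT).
  { intros r Hr. destruct (Req_dec r s1) as [->|]; [rewrite Eu; auto|apply Pos; lra]. }
  exists (fun t => (X t, acosh (u t))), T.
  assert (G0 : (X 0, acosh (u 0)) = p0). { rewrite X0, u0, U0, acosh_cosh_1. reflexivity. }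
  assert (GT : (X T, acosh (u T)) = (x, y)). { rewrite XT, uT, Eu, acosh_cosh by auto. f_equal. lra. }
  split; [exact (flow_geodesic _ _ _ _ F)|]. split; [auto|]. split; [|auto].
  destruct HT as [|HT]; auto. exfalso. rewrite <- HT in GT. apply N. congruence.
Qed.

(** The length of [(2 c sinh 1, p 0)] for every ray from [p0], by the energy law at height 1. This
    vector is a fixed positive multiple of the initial velocity. *)
Definition rho : R := sqrt (3 + sinh 1 ^ 2).

Lemma rho_pos : 0 < rho.
Proof. apply sqrt_lt_R0. nra. Qed.

Lemma rho_sq : rho ^ 2 = 3 + sinh 1 ^ 2.
Proof. apply pow2_sqrt. nra. Qed.

Lemma geodesic_with_direction c b : (2 * c * sinh 1) ^ 2 + b ^ 2 = rho ^ 2 ->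
  exists g p, geodesic g /\ g 0 = p0 /\ gflow g c p /\ p 0 = b.
Proof.
  intros E. rewrite rho_sq in E. pose proof (cosh_gt_1 1 ltac:(lra)) as Ch.
  destruct (lin_sol_exists (lam c) (cosh 1) b) as (U & Q & L & U0 & Q0).
  destruct (flow_exists c U Q 0 L) as (X & u & p & F & X0 & u0 & p0' & _).
  { lra. }
  { rewrite U0, Q0, cosh_sq. unfold lam. lra. }
  exists (fun t => (X t, acosh (u t))), p.
  split; [exact (flow_geodesic _ _ _ _ F)|]. split; [rewrite X0, u0, U0, acosh_cosh_1; reflexivity|].
  split; [now apply flow_gflow|lra].
Qed.

Lemma gflow_base_norm g c p : gflow g c p -> g 0 = p0 -> (2 * c * sinh 1) ^ 2 + p 0 ^ 2 = rho ^ 2.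
Proof.
  intros [F _] E. pose proof (flow_energy _ _ _ _ F 0) as En. cbv beta in En.
  rewrite E in En. unfold p0 in En; cbn [snd] in En. rewrite cosh_sq in En. rewrite rho_sq, En.
  unfold lam. ring.
Qed.

Lemma squash_onto u : -1 < u < 1 -> exists xi, squash xi = u.
Proof.
  intros Hu. set (s := sqrt (1 - u ^ 2)). assert (Hs : 0 < s) by (apply sqrt_lt_R0; nra).
  assert (s2 : s ^ 2 = 1 - u ^ 2) by (apply pow2_sqrt; nra).
  exists (u / s). unfold squash, Rad.
  replace (1 + (u / s) ^ 2 + 0 ^ 2) with ((/ s) ^ 2).
  - rewrite sqrt_pow2 by (left; now apply Rinv_0_lt_compat). field. lra.
  - replace ((/ s) ^ 2) with (1 / s ^ 2) by (field; lra).
    replace (1 + (u / s) ^ 2 + 0 ^ 2) with ((s ^ 2 + u ^ 2) / s ^ 2) by (field; lra).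
    rewrite s2. f_equal. ring.
Qed.

(** On the semicircle, corners included, [c = a / 2] is prescribed by the first coordinate and the
    rising root of the energy is taken. On the open segment the boundary value problem with final
    height [u = 1] is used. *)
Theorem geodesic_to w : bdD w -> exists g, geodesic g /\ g 0 = p0 /\ conv_to (fun t => Phi0 (g t)) w.
Proof.
  destruct w as [a b]. intros H. pose proof (sinh_pos 1 ltac:(lra)) as S1.
  assert (C : (a ^ 2 + b ^ 2 = 1 /\ 0 <= b) \/ (b = 0 /\ -1 < a < 1)).
  { unfold bdD in H; cbn [fst snd] in H. destruct H as [H|[H1 H2]]; [now left|].
    destruct (Req_dec a 1); [left; split; nra|]. destruct (Req_dec a (-1)); [left; split; nra|].
    right. split; auto; lra. }
  destruct C as [[E Hb]|[-> Ha]].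
  - pose proof rho_pos as Rp. pose proof rho_sq as R2.
    assert (Pos : 0 < rho ^ 2 - (2 * (a / 2) * sinh 1) ^ 2).
    { rewrite R2. replace (2 * (a / 2) * sinh 1) with (a * sinh 1) by field.
      rewrite Rpow_mult_distr.
      assert (a ^ 2 * sinh 1 ^ 2 <= 1 * sinh 1 ^ 2) by (apply Rmult_le_compat_r; nra). lra. }
    destruct (geodesic_with_direction (a / 2) (sqrt (rho ^ 2 - (2 * (a / 2) * sinh 1) ^ 2)))
      as (g & p & G & G0 & F & P0).
    { rewrite pow2_sqrt; lra. }
    exists g. split; auto. split; auto.
    assert (Lb : lam (a / 2) = b ^ 2) by (unfold lam; nra).
    assert (U : ascends (a / 2) p). { split; [rewrite Lb; nra|]. rewrite P0. now apply sqrt_lt_R0. }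
    pose proof (gflow_up_end _ _ _ F U) as Cv. rewrite Lb, sqrt_pow2 in Cv by auto.
    replace (2 * (a / 2)) with a in Cv by field. exact Cv.
  - destruct (squash_onto a Ha) as [xi Exi]. pose proof (cosh_gt_1 1 ltac:(lra)) as Ch.
    destruct (target_exists xi 1 ltac:(lra)) as (c & U & Q & s1 & L & U0 & E & Hs & Ex & Eu & Pos).
    { intro Z. injection Z as _ Z. lra. }
    destruct (flow_exists c U Q 0 L ltac:(lra) E) as (X & u & p & F & X0 & u0 & q0 & Rch).
    pose proof (flow_gflow _ _ _ _ F) as G. set (g := fun t => (X t, acosh (u t))) in *.
    exists g. split; [exact (flow_geodesic _ _ _ _ F)|]. split; [unfold g; rewrite X0, u0, U0, acosh_cosh_1; reflexivity|].
    destruct (up_or_down _ _ _ G) as [[UL UP]|(t1 & d & xi' & D)].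
    (* A rising ray never drops below its initial height, whereas [U] is below [cosh 1] shortly
       before [s1]. *)
    + exfalso. destruct (lin_sol_continuity _ _ _ L) as [CU _].
      destruct (continuity_at U s1 CU (cosh 1 - 1) ltac:(lra)) as (dd & Hd & Hc).
      set (s := Rmax 0 (s1 - dd / 2)). assert (Hs0 : 0 <= s) by apply Rmax_l.
      assert (s1 - dd / 2 <= s) by apply Rmax_r. assert (s < s1) by (apply Rmax_lub_lt; lra).
      specialize (Hc s ltac:(apply Rabs_def1; lra)). apply Rabs_def2 in Hc.
      destruct (Rch s Hs0) as (T & HT & _ & uT). { intros r Hr. apply Pos. lra. }
      pose proof (flow_rise_u _ _ _ _ T F) as B.
      assert (u 0 <= u T); [|lra]. apply B; [|lra].
      intros t _. pose proof (flow_up_p _ _ _ _ F UL UP t). lra.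
    + destruct (down_exit g c p t1 d xi' U Q G D L) as (se & Se & Xe & Ue & _ & Pe).
      { unfold g; cbn [snd]. rewrite cosh_acosh by lra. auto. } { auto. }
      (* Both are the first parameter at which [U] equals 1. *)
      assert (Ese : se = s1).
      { destruct (Rtotal_order se s1) as [O|[O|O]]; auto; exfalso.
        - pose proof (Pos se ltac:(lra)). lra.
        - pose proof (Pe s1 ltac:(lra)). lra. }
      assert (Exi' : xi' = xi). { rewrite <- Xe, <- Ex, Ese. unfold g; cbn [fst]. lra. }
      rewrite <- Exi, <- Exi'. exact (gflow_down_end _ _ _ _ _ _ G D).
Qed.

(** * The map onto the closed half disk and its bijectivity *)

(** On [Inf g] the total operators [Lim] and [real] give a value for every curve; for geodesics it
    is the true limit by [geodesic_end]. *)
Definition Phi (z : cpt) : R * R :=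
  match z with
  | Pt q => Phi0 q
  | Inf g => (real (Lim (fun t => fst (Phi0 (g t))) p_infty),
              real (Lim (fun t => snd (Phi0 (g t))) p_infty))
  end.

Lemma Phi_end g w : conv_to (fun t => Phi0 (g t)) w -> Phi (Inf g) = w.
Proof.
  intros C. destruct w as [a b]. simpl.
  assert (L : forall (f : R -> R) l, (forall e, 0 < e -> exists T, forall t, T <= t -> Rabs (f t - l) < e) ->
     real (Lim f p_infty) = l).
  { intros f l H. rewrite (is_lim_unique f p_infty (Finite l)); [reflexivity|].
    apply is_lim_spec. intro e. destruct (H e (cond_pos e)) as [T HT]. exists T. intros t Ht.
    apply HT. lra. }
  f_equal; apply L; intros e He; destruct (C e He) as [T HT]; exists T; intros t Ht; now apply HT.
Qed.

Lemma geodesic_end g : geodesic g -> conv_to (fun t => Phi0 (g t)) (Phi (Inf g)) /\ bdD (Phi (Inf g)).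
Proof.
  intros H. destruct (geodesic_gflow g H) as (c & p & G).
  destruct (up_or_down _ _ _ G) as [U|(t1 & d & xi & D)].
  - pose proof (gflow_up_end _ _ _ G U) as C. rewrite (Phi_end _ _ C). split; auto.
    left. cbn [fst snd]. destruct U as [U _]. rewrite pow2_sqrt by auto. split; [unfold lam; ring|apply sqrt_pos].
  - pose proof (gflow_down_end _ _ _ _ _ _ G D) as C. rewrite (Phi_end _ _ C). split; auto.
    right. cbn [fst snd]. pose proof (squash_bounds xi). lra.
Qed.

Lemma Phi_eq_asymptotic g1 g2 : geodesic g1 -> geodesic g2 ->
  (Phi (Inf g1) = Phi (Inf g2) <-> asymptotic g1 g2).
Proof.
  intros H1 H2. apply asymptotic_iff_same_end; auto; now apply geodesic_end.
Qed.

Lemma bdD_inD w : bdD w -> inD w.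
Proof. unfold bdD, inD. intros [H|H]; split; nra. Qed.

Lemma Phi0_interior q : in_Sigma q ->
  fst (Phi0 q) ^ 2 + snd (Phi0 q) ^ 2 < 1 /\ 0 < snd (Phi0 q).
Proof.
  destruct q as [x y]. unfold in_Sigma, Phi0; cbn [fst snd]. intros Hy.
  pose proof (Rad_pos x y). pose proof (Rad_sq x y) as E. split; [|now apply Rdiv_lt_0_compat].
  replace ((x / Rad x y) ^ 2 + (y / Rad x y) ^ 2) with ((x ^ 2 + y ^ 2) / Rad x y ^ 2) by (field; lra).
  rewrite E. apply (Rmult_lt_reg_r (1 + x ^ 2 + y ^ 2)); [nra|].
  unfold Rdiv. rewrite Rmult_assoc, Rinv_l by nra. lra.
Qed.

Definition Psi0 (w : R * R) : R * R :=
  (fst w * / sqrt (1 - (fst w ^ 2 + snd w ^ 2)), snd w * / sqrt (1 - (fst w ^ 2 + snd w ^ 2))).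

Lemma Psi0_Phi0 q : Psi0 (Phi0 q) = q.
Proof.
  destruct q as [x y]. unfold Psi0, Phi0; cbn [fst snd].
  pose proof (Rad_pos x y) as Rp. pose proof (Rad_sq x y) as E.
  replace (1 - ((x / Rad x y) ^ 2 + (y / Rad x y) ^ 2)) with ((/ Rad x y) ^ 2).
  - rewrite sqrt_pow2 by (left; now apply Rinv_0_lt_compat). f_equal; field; lra.
  - transitivity ((Rad x y ^ 2 - (x ^ 2 + y ^ 2)) / Rad x y ^ 2); [rewrite E at 1|]; field; lra.
Qed.

Lemma Phi0_Psi0 w : fst w ^ 2 + snd w ^ 2 < 1 -> Phi0 (Psi0 w) = w.
Proof.
  destruct w as [a b]. unfold Psi0, Phi0; cbn [fst snd]. intros H.
  set (s := sqrt (1 - (a ^ 2 + b ^ 2))). assert (Hs : 0 < s) by (apply sqrt_lt_R0; lra).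
  assert (s2 : s ^ 2 = 1 - (a ^ 2 + b ^ 2)) by (apply pow2_sqrt; lra).
  assert (E : Rad (a * / s) (b * / s) = / s).
  { unfold Rad. replace (1 + (a * / s) ^ 2 + (b * / s) ^ 2) with ((s ^ 2 + a ^ 2 + b ^ 2) * (/ s) ^ 2) by (field; lra).
    rewrite s2. replace ((1 - (a ^ 2 + b ^ 2) + a ^ 2 + b ^ 2) * (/ s) ^ 2) with ((/ s) ^ 2) by ring.
    apply sqrt_pow2. left. now apply Rinv_0_lt_compat. }
  rewrite E. f_equal; field; lra.
Qed.

Lemma Psi0_Sigma w : fst w ^ 2 + snd w ^ 2 < 1 -> 0 < snd w -> in_Sigma (Psi0 w).
Proof.
  intros H Hb. unfold in_Sigma, Psi0; cbn [snd]. apply Rmult_lt_0_compat; auto.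
  apply Rinv_0_lt_compat, sqrt_lt_R0. lra.
Qed.

Lemma inD_cases w : inD w -> bdD w \/ (fst w ^ 2 + snd w ^ 2 < 1 /\ 0 < snd w).
Proof.
  intros [H1 H2]. unfold bdD. destruct H1 as [H1|H1]; [|left; left; auto].
  destruct H2 as [H2|H2]; [right; auto|left; right]. split; auto. rewrite <- H2 in H1. nra.
Qed.

Lemma Phi_onto w : inD w -> exists z, valid z /\ Phi z = w.
Proof.
  intros H. destruct (inD_cases w H) as [B|[B1 B2]].
  - destruct (geodesic_to w B) as (g & G & _ & C). exists (Inf g). split; auto. now apply Phi_end.
  - exists (Pt (Psi0 w)). split; [now apply Psi0_Sigma|]. now apply Phi0_Psi0.
Qed.

Lemma interior_not_bd w : fst w ^ 2 + snd w ^ 2 < 1 -> 0 < snd w -> ~ bdD w.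
Proof. intros H1 H2 [H|H]; lra. Qed.

Lemma Phi_bd z : valid z -> (is_inf z <-> bdD (Phi z)).
Proof.
  destruct z as [q|g]; simpl valid; intros H; split; simpl is_inf; try tauto.
  - intros B. destruct (Phi0_interior q H) as [I1 I2]. now apply (interior_not_bd _ I1 I2).
  - intros _. now apply geodesic_end.
Qed.

Lemma Phi_in z : valid z -> inD (Phi z).
Proof.
  destruct z as [q|g]; intros H.
  - destruct (Phi0_interior q H) as [I1 I2]. split; simpl Phi; lra.
  - apply bdD_inD, geodesic_end, H.
Qed.

Lemma Phi_same z1 z2 : valid z1 -> valid z2 -> (Phi z1 = Phi z2 <-> same z1 z2).
Proof.
  intros H1 H2. destruct z1 as [q1|g1], z2 as [q2|g2]; simpl same.
  - simpl Phi. split; [|congruence]. intros E. rewrite <- (Psi0_Phi0 q1), E. apply Psi0_Phi0.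
  - split; [|tauto]. intros E. assert (B : bdD (Phi (Pt q1))) by (rewrite E; now apply geodesic_end).
    now apply (Phi_bd (Pt q1) H1) in B.
  - split; [|tauto]. intros E. assert (B : bdD (Phi (Pt q2))) by (rewrite <- E; now apply geodesic_end).
    now apply (Phi_bd (Pt q2) H2) in B.
  - now apply Phi_eq_asymptotic.
Qed.

(** * The cone topology *)

(** The cosine of the angle between [v] and [(a, b)] when [(a, b)] has length [rho]. *)
Definition cosang (v : R * R) (a b : R) : R :=
  (fst v * a + snd v * b) / (sqrt (fst v ^ 2 + snd v ^ 2) * rho).

Lemma cosang_bounds v a b : v <> (0, 0) -> a ^ 2 + b ^ 2 = rho ^ 2 -> -1 <= cosang v a b <= 1.
Proof.
  destruct v as [v1 v2]. intros Hv E. unfold cosang; cbn [fst snd]. pose proof rho_pos.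
  assert (Hp : 0 < v1 ^ 2 + v2 ^ 2).
  { destruct (Req_dec v1 0) as [->|N1]; [|nra]. destruct (Req_dec v2 0) as [->|N2]; [|nra].
    exfalso. now apply Hv. }
  pose proof (sqrt_lt_R0 _ Hp) as Hs. pose proof (pow2_sqrt (v1 ^ 2 + v2 ^ 2) ltac:(lra)) as S2.
  set (s := sqrt (v1 ^ 2 + v2 ^ 2)) in *.
  assert (Hm : 0 < s * rho) by (apply Rmult_lt_0_compat; auto).
  assert (CS : (v1 * a + v2 * b) ^ 2 <= (s * rho) ^ 2).
  { rewrite Rpow_mult_distr, S2, <- E. pose proof (pow2_ge_0 (v1 * b - v2 * a)). nra. }
  assert (- (s * rho) <= v1 * a + v2 * b <= s * rho).
  { split; apply Rnot_lt_le; intro; nra. }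
  split; apply (Rmult_le_reg_r (s * rho)); auto; unfold Rdiv; rewrite (Rmult_assoc (_ + _)), Rinv_l; lra.
Qed.

(** The initial velocity is the positive multiple [m] of [(2 c sinh 1, p 0)], and the angle is
    insensitive to [m]. *)
Lemma base_angle g c p w1 w2 v : gflow g c p -> g 0 = p0 ->
  derivable_pt_lim (fun s => fst (g s)) 0 w1 -> derivable_pt_lim (fun s => snd (g s)) 0 w2 ->
  angle v (w1, w2) = acos (cosang v (2 * c * sinh 1) (p 0)).
Proof.
  intros [F Hy] E D1 D2. pose proof (sinh_pos 1 ltac:(lra)) as S1. pose proof (cosh_gt_1 1 ltac:(lra)) as C1.
  pose proof (srate_pos _ C1) as Hsig. set (m := srate (cosh 1) / sinh 1).
  assert (Hm : 0 < m) by now apply Rdiv_lt_0_compat.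
  assert (E1 : w1 = m * (2 * c * sinh 1)).
  { apply is_derive_Reals in D1. pose proof (flow_x _ _ _ _ F 0) as X. cbv beta in X.
    rewrite E in X. unfold p0 in X; cbn [snd] in X.
    rewrite <- (is_derive_unique _ _ _ D1), (is_derive_unique _ _ _ X). unfold m. field. lra. }
  assert (E2 : w2 = m * p 0).
  { apply is_derive_Reals in D2. pose proof (flow_u _ _ _ _ F 0) as X. cbv beta in X.
    rewrite E in X. unfold p0 in X; cbn [snd] in X.
    assert (X' : is_derive (fun t => cosh (snd (g t))) 0 (w2 * sinh 1)).
    { apply (is_derive_comp cosh (fun t => snd (g t)) 0); auto. rewrite E. apply is_derive_cosh. }
    assert (w2 * sinh 1 = p 0 * srate (cosh 1)).
    { rewrite <- (is_derive_unique _ _ _ X), <- (is_derive_unique _ _ _ X'). reflexivity. }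
    unfold m. apply (Rmult_eq_reg_r (sinh 1)); [|lra]. rewrite H. field. lra. }
  unfold angle, cosang; cbn [fst snd]. rewrite E1, E2. f_equal.
  set (a := 2 * c * sinh 1). set (b := p 0).
  assert (N : a ^ 2 + b ^ 2 = rho ^ 2) by (apply (gflow_base_norm g c p); auto; split; auto).
  replace ((m * a) ^ 2 + (m * b) ^ 2) with ((m * rho) ^ 2) by (rewrite Rpow_mult_distr, <- N; ring).
  pose proof rho_pos. rewrite sqrt_pow2 by (apply Rmult_le_pos; lra).
  (* For [v = (0, 0)] both quotients divide by zero and are 0 by the convention [/ 0 = 0]. *)
  destruct (Req_dec (sqrt (fst v ^ 2 + snd v ^ 2)) 0) as [Z|Z].
  - rewrite Z, !Rmult_0_l. unfold Rdiv. rewrite Rinv_0. ring.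
  - field. repeat split; auto; lra.
Qed.

Lemma starts_in_cone_iff g c p v eps : geodesic g -> gflow g c p -> g 0 = p0 ->
  (starts_in_cone v eps g <-> acos (cosang v (2 * c * sinh 1) (p 0)) < eps).
Proof.
  intros H G E. split.
  - intros (_ & _ & w1 & w2 & D1 & D2 & A). now rewrite (base_angle g c p w1 w2 v G E D1 D2) in A.
  - intros A. destruct H as (dP & vx & vy & ax & ay & HP & H).
    split; [exists dP, vx, vy, ax, ay; auto|]. split; auto. exists (vx 0), (vy 0).
    split; [apply H|]. split; [apply H|]. rewrite (base_angle g c p (vx 0) (vy 0) v G E); auto; apply H.
Qed.

Lemma cos_ge_quadratic x : 0 < x -> 1 - x ^ 2 / 2 <= cos x.
Proof.
  intros H. replace x with (2 * (x / 2)) at 2 by field. rewrite cos_2a_sin.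
  pose proof (sin_lt_x (x / 2) ltac:(lra)).
  assert (- (x / 2) <= sin (x / 2)).
  { destruct (Rle_dec (x / 2) PI) as [L|L].
    - pose proof (sin_ge_0 (x / 2) ltac:(lra) L). lra.
    - pose proof (SIN_bound (x / 2)). pose proof PI2_1. lra. }
  nra.
Qed.

Lemma acos_lt_cos X e : -1 <= X <= 1 -> 0 < e <= PI -> (acos X < e <-> cos e < X).
Proof.
  intros HX He. pose proof (acos_bound X). rewrite <- (cos_acos X) at 2 by auto. split; intro L.
  - apply cos_decreasing_1; lra.
  - apply cos_decreasing_0; lra.
Qed.

(** On the circle of radius [rho] the squared chord is [2 rho ^ 2 (1 - cos)], below
    [(rho eps) ^ 2 <= d ^ 2] by [cos eps >= 1 - eps ^ 2 / 2]. The cap 1 keeps [eps] below [PI],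
    where [cos] decreases. *)
Lemma direction_close a0 b0 a b d : 0 < d -> a0 ^ 2 + b0 ^ 2 = rho ^ 2 -> a ^ 2 + b ^ 2 = rho ^ 2 ->
  acos (cosang (a0, b0) a b) < Rmin 1 (d / rho) -> Rabs (a - a0) < d /\ Rabs (b - b0) < d.
Proof.
  intros Hd E0 E A. pose proof rho_pos as Rp. set (eps := Rmin 1 (d / rho)) in *.
  assert (Hdr : 0 < d / rho) by (apply Rdiv_lt_0_compat; auto).
  assert (He : 0 < eps) by (apply Rmin_glb_lt; lra). assert (e1 : eps <= 1) by apply Rmin_l.
  assert (e2 : eps <= d / rho) by apply Rmin_r.
  assert (Nz : (a0, b0) <> (0, 0)). { intro Z. injection Z as -> ->. nra. }
  pose proof PI2_1. apply acos_lt_cos in A; [|now apply cosang_bounds|lra].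
  unfold cosang in A; cbn [fst snd] in A. rewrite E0, sqrt_pow2 in A by lra.
  pose proof (cos_ge_quadratic eps He).
  assert (A2 : 1 - eps ^ 2 / 2 < (a0 * a + b0 * b) / (rho * rho)) by lra.
  apply (Rmult_lt_compat_r (rho * rho)) in A2; [|nra].
  replace ((a0 * a + b0 * b) / (rho * rho) * (rho * rho)) with (a0 * a + b0 * b) in A2 by (field; lra).
  assert (eps * rho <= d).
  { apply Rle_trans with (d / rho * rho); [apply Rmult_le_compat_r; lra|right; field; lra]. }
  assert ((eps * rho) ^ 2 <= d ^ 2) by (apply pow_incr; split; [apply Rmult_le_pos; lra|auto]).
  assert (S : (a - a0) ^ 2 + (b - b0) ^ 2 < d ^ 2) by nra.
  pose proof (pow2_ge_0 (a - a0)). pose proof (pow2_ge_0 (b - b0)).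
  split; apply Rabs_def1; apply Rnot_le_lt; intro; nra.
Qed.

Lemma sq_diff_lt z w r : -1 <= z <= 1 -> -1 <= w <= 1 -> - r < w - z < r -> z ^ 2 - w ^ 2 < 2 * r.
Proof.
  intros Hz Hw Hr. replace (z ^ 2 - w ^ 2) with ((z - w) * (z + w)) by ring.
  destruct (Rle_dec 0 (z - w)); nra.
Qed.

(** In the ball of radius [Rd] about [p0] one has [Rad x y ^ 2 <= K] and [y >= exp (- 2 Rd)]. The
    image thus keeps [1 - u ^ 2 - v ^ 2 = 1 / Rad ^ 2] and [v] above positive constants, away from
    both pieces of the boundary. *)
Lemma dist_far a b Rd : bdD (a, b) -> 0 < Rd -> exists r, 0 < r /\
  forall q, in_Sigma q -> Rabs (fst (Phi0 q) - a) < r -> Rabs (snd (Phi0 q) - b) < r ->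
    ~ dist_le p0 q Rd.
Proof.
  intros B HR. set (M := 2 + 2 * Rd + (2 * Rd + 1)).
  set (K := 1 + M ^ 2 + M ^ 2). assert (HK : 1 <= K) by (unfold K; nra).
  set (m0 := exp (- (2 * Rd)) / K). set (m1 := / K).
  assert (H1 : 0 < m1) by (apply Rinv_0_lt_compat; lra).
  assert (H0 : 0 < m0) by (apply Rdiv_lt_0_compat; [apply exp_pos|lra]).
  exists (Rmin m0 (m1 / 4)). assert (L0 : Rmin m0 (m1 / 4) <= m0) by apply Rmin_l.
  assert (L1 : Rmin m0 (m1 / 4) <= m1 / 4) by apply Rmin_r.
  split; [apply Rmin_glb_lt; lra|]. intros q Hq A1 A2 D.
  pose proof (dist_le_x _ _ _ D) as Dx. pose proof (dist_le_y _ _ _ D) as Dy.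
  pose proof (dist_le_ln_y _ _ _ D) as Dl. unfold p0 in *; cbn [fst snd] in *.
  rewrite ln_1 in Dl. apply abs_le_inv in Dx, Dy, Dl.
  destruct (Phi0_interior q Hq) as [I1 I2]. destruct q as [x y]. unfold in_Sigma in Hq. cbn [snd fst] in *.
  pose proof (Rad_pos x y) as Rp. pose proof (Rad_sq x y) as R2.
  assert (RK : Rad x y ^ 2 <= K). { rewrite R2. unfold K, M. nra. }
  assert (R1 : 1 <= Rad x y) by nra. assert (RK' : Rad x y <= K) by nra.
  apply Rabs_def2 in A1, A2. unfold Phi0 in *; cbn [fst snd] in *.
  set (u := x / Rad x y) in *. set (v := y / Rad x y) in *.
  destruct B as [[B1 B2]|[B1 B2]]; cbn [fst snd] in *.
  - assert (Es : u ^ 2 + v ^ 2 = 1 - / Rad x y ^ 2).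
    { unfold u, v. replace ((x / Rad x y) ^ 2 + (y / Rad x y) ^ 2) with ((x ^ 2 + y ^ 2) / Rad x y ^ 2) by (field; lra).
      replace (x ^ 2 + y ^ 2) with (Rad x y ^ 2 - 1) by lra. field. lra. }
    assert (m1 <= / Rad x y ^ 2). { apply Rinv_le_contravar; nra. }
    assert (-1 <= u <= 1) by nra. assert (-1 <= v <= 1) by nra.
    assert (-1 <= a <= 1) by nra. assert (-1 <= b <= 1) by nra.
    set (r := Rmin m0 (m1 / 4)) in *.
    pose proof (sq_diff_lt a u r ltac:(lra) ltac:(lra) ltac:(lra)).
    pose proof (sq_diff_lt b v r ltac:(lra) ltac:(lra) ltac:(lra)). lra.
  - subst b. assert (exp (- (2 * Rd)) <= y).
    { rewrite <- (exp_ln y) by auto.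
      destruct (Req_dec (- (2 * Rd)) (ln y)) as [->|N]; [lra|left; apply exp_increasing; lra]. }
    assert (m0 <= v).
    { unfold m0, v. apply Rmult_le_compat; try lra; [left; apply exp_pos|left; apply Rinv_0_lt_compat; lra|].
      apply Rinv_le_contravar; lra. }
    lra.
Qed.

Lemma Psi0_continuous w e : fst w ^ 2 + snd w ^ 2 < 1 -> 0 < snd w -> 0 < e ->
  exists r, 0 < r /\ forall w', Rabs (fst w' - fst w) < r -> Rabs (snd w' - snd w) < r ->
    fst w' ^ 2 + snd w' ^ 2 < 1 /\ 0 < snd w' /\
    Rabs (fst (Psi0 w') - fst (Psi0 w)) < e /\ Rabs (snd (Psi0 w') - snd (Psi0 w)) < e.
Proof.
  destruct w as [a b]. cbn [fst snd]. intros H Hb He. set (s0 := a ^ 2 + b ^ 2) in *.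
  set (k := fun s => / sqrt (1 - s)).
  assert (Ck : continuity_pt k s0).
  { apply continuity_pt_filterlim, (ex_derive_continuous k). unfold k. auto_derive.
    assert (0 < sqrt (1 - s0)) by (apply sqrt_lt_R0; lra).
    replace (1 + - s0) with (1 - s0) by ring. repeat split; lra. }
  destruct (Ck (e / 2) ltac:(lra)) as (d & Hd & Hc).
  assert (Hk : 0 < k s0) by (apply Rinv_0_lt_compat, sqrt_lt_R0; lra).
  set (r := Rmin (Rmin (d / 8) ((1 - s0) / 8)) (Rmin (b / 2) (e / (4 * k s0)))).
  assert (Hr : 0 < r).
  { unfold r. repeat apply Rmin_glb_lt; try lra. apply Rdiv_lt_0_compat; lra. }
  assert (r1 : r <= d / 8) by (eapply Rle_trans; [apply Rmin_l|apply Rmin_l]).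
  assert (r2 : r <= (1 - s0) / 8) by (eapply Rle_trans; [apply Rmin_l|apply Rmin_r]).
  assert (r3 : r <= b / 2) by (eapply Rle_trans; [apply Rmin_r|apply Rmin_l]).
  assert (r4 : r <= e / (4 * k s0)) by (eapply Rle_trans; [apply Rmin_r|apply Rmin_r]).
  exists r. split; auto. intros [a' b']; cbn [fst snd]. intros Ha Hb'.
  assert (Ha2 := Ha). assert (Hb2 := Hb'). apply Rabs_def2 in Ha2, Hb2.
  assert (-1 <= a <= 1) by (unfold s0 in H; nra). assert (-1 <= b <= 1) by (unfold s0 in H; nra).
  assert (0 <= s0) by (unfold s0; nra).
  set (s1 := a' ^ 2 + b' ^ 2).
  assert (Hs : Rabs (s1 - s0) < 8 * r).
  { replace (s1 - s0) with ((a' - a) * (a' + a) + (b' - b) * (b' + b)) by (unfold s1, s0; ring).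
    apply Rabs_def1; nra. }
  assert (Hs' := Hs). apply Rabs_def2 in Hs'. assert (s1 < 1) by lra.
  assert (Kc : Rabs (k s1 - k s0) < e / 2).
  { destruct (Req_dec s1 s0) as [->|N]; [rewrite Rminus_eq_0, Rabs_R0; lra|].
    apply (Hc s1). split; [split; [exact I|auto]|]. simpl. unfold R_dist. lra. }
  split; [auto|]. split; [lra|]. unfold Psi0; cbn [fst snd]. fold s1 s0.
  change (/ sqrt (1 - s1)) with (k s1). change (/ sqrt (1 - s0)) with (k s0).
  assert (Kr : k s0 * r <= e / 4).
  { apply Rle_trans with (k s0 * (e / (4 * k s0))); [apply Rmult_le_compat_l; lra|right; field; lra]. }
  assert (Q : forall z z', Rabs (z' - z) < r -> Rabs z' <= 1 -> Rabs (z' * k s1 - z * k s0) < e).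
  { intros z z' Hz Hz'. replace (z' * k s1 - z * k s0) with (z' * (k s1 - k s0) + (z' - z) * k s0) by ring.
    eapply Rle_lt_trans; [apply Rabs_triang|]. rewrite !Rabs_mult, (Rabs_right (k s0)) by lra.
    pose proof (Rabs_pos z'). pose proof (Rabs_pos (k s1 - k s0)).
    assert (Rabs z' * Rabs (k s1 - k s0) <= 1 * Rabs (k s1 - k s0)) by (apply Rmult_le_compat_r; auto).
    assert (Rabs (z' - z) * k s0 <= r * k s0) by (apply Rmult_le_compat_r; lra). lra. }
  split; apply Q; auto; apply Rabs_le; unfold s1 in *; nra.
Qed.

Lemma near_limit g w v e T : conv_to g w ->
  (forall t, T <= t -> Rabs (fst (g t) - fst v) < e /\ Rabs (snd (g t) - snd v) < e) ->
  Rabs (fst w - fst v) <= e /\ Rabs (snd w - snd v) <= e.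
Proof.
  intros C H. split; apply le_epsilon; intros h Hh; destruct (C h Hh) as [T' HT'];
    destruct (HT' (Rmax T T') (Rmax_r _ _)) as [A B]; destruct (H (Rmax T T') (Rmax_l _ _)) as [A' B'].
  - replace (fst w - fst v) with (- (fst (g (Rmax T T')) - fst w) + (fst (g (Rmax T T')) - fst v)) by ring.
    eapply Rle_trans; [apply Rabs_triang|]. rewrite Rabs_Ropp. lra.
  - replace (snd w - snd v) with (- (snd (g (Rmax T T')) - snd w) + (snd (g (Rmax T T')) - snd v)) by ring.
    eapply Rle_trans; [apply Rabs_triang|]. rewrite Rabs_Ropp. lra.
Qed.

Lemma gflow_cone_limit g c p : geodesic g -> gflow g c p ->
  cone_limit c (fun t => fst (g t)) (fun t => cosh (snd (g t))) p (Phi (Inf g)).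
Proof.
  intros H G. destruct (up_or_down _ _ _ G) as [U|(t1 & d & xi & D)].
  - rewrite (Phi_end _ _ (gflow_up_end _ _ _ G U)). now apply gflow_cone_up.
  - rewrite (Phi_end _ _ (gflow_down_end _ _ _ _ _ _ G D)). destruct D as (D1 & D2 & D3 & D4).
    apply (cone_limit_down _ _ _ _ t1 d xi); auto. apply G.
Qed.

(** Uniform convergence restated for rays from [p0]: it controls the late points of nearby rays and,
    in the limit, their ends. *)
Theorem cone_at_direction g c p : geodesic g -> gflow g c p -> g 0 = p0 -> forall e, 0 < e ->
  exists d T, 0 < d /\ forall g' c' p', geodesic g' -> gflow g' c' p' -> g' 0 = p0 ->
    Rabs (2 * c' * sinh 1 - 2 * c * sinh 1) < d -> Rabs (p' 0 - p 0) < d ->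
    (forall t, T <= t -> Rabs (fst (Phi0 (g' t)) - fst (Phi (Inf g))) < e /\
                         Rabs (snd (Phi0 (g' t)) - snd (Phi (Inf g))) < e) /\
    Rabs (fst (Phi (Inf g')) - fst (Phi (Inf g))) <= e /\
    Rabs (snd (Phi (Inf g')) - snd (Phi (Inf g))) <= e.
Proof.
  intros H G E e He. pose proof (sinh_pos 1 ltac:(lra)) as S1.
  destruct (gflow_cone_limit g c p H G e He) as (d & T & Hd & HT).
  exists (Rmin d (d * (2 * sinh 1))), T.
  assert (M1 : Rmin d (d * (2 * sinh 1)) <= d) by apply Rmin_l.
  assert (M2 : Rmin d (d * (2 * sinh 1)) <= d * (2 * sinh 1)) by apply Rmin_r.
  split; [apply Rmin_glb_lt; nra|]. intros g' c' p' H' G' E' Hc Hp.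
  assert (Hcc : Rabs (c' - c) < d).
  { replace (2 * c' * sinh 1 - 2 * c * sinh 1) with ((c' - c) * (2 * sinh 1)) in Hc by ring.
    rewrite Rabs_mult, (Rabs_right (2 * sinh 1)) in Hc by lra.
    apply (Rmult_lt_reg_r (2 * sinh 1)); lra. }
  assert (Near : forall t, T <= t -> Rabs (fst (Phi0 (g' t)) - fst (Phi (Inf g))) < e /\
                         Rabs (snd (Phi0 (g' t)) - snd (Phi (Inf g))) < e).
  { intros t Ht. rewrite <- (gflow_point g' c' p' G' t).
    apply (HT c' (fun t => fst (g' t)) (fun t => cosh (snd (g' t))) p'); auto; try lra.
    - apply G'.
    - now rewrite E, E'.
    - now rewrite E, E'. }
  split; auto. apply (near_limit (fun t => Phi0 (g' t)) _ _ e T); auto. now apply geodesic_end.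
Qed.

(** * Comparison of the cone topology with that of the half disk *)

Theorem open_to_cone V : open_in_D V -> cone_open (fun z => valid z /\ V (Phi z)).
Proof.
  intros HV z Hz [_ Vz]. destruct (HV (Phi z) (Phi_in z Hz) Vz) as (r & Hr & HB).
  destruct z as [q|g].
  - destruct q as [x y]. destruct (Phi0_continuous x y (r / 2) ltac:(lra)) as (d & Hd & Hc).
    exists d. split; auto. intros [x' y'] Hq' Hn. cbn [fst snd] in Hn. split; [exact Hq'|].
    apply HB; [now apply Phi_in|].
    assert (A : Rabs (x' - x) < d /\ Rabs (y' - y) < d).
    { pose proof (pow2_ge_0 (x' - x)). pose proof (pow2_ge_0 (y' - y)).
      split; apply Rabs_def1; apply Rnot_le_lt; intro; nra. }
    destruct (Hc x' y' (proj1 A) (proj2 A)) as [B1 B2]. simpl Phi.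
    apply Rabs_def2 in B1, B2. nra.
  (* The class of [g] is represented by a ray [g0] from [p0] with the same end; its direction is the
     axis of the cone. *)
  - destruct (geodesic_end g Hz) as [_ Bd]. destruct (geodesic_to _ Bd) as (g0 & H0 & E0 & C0).
    pose proof (Phi_end _ _ C0) as P0.
    destruct (geodesic_gflow g0 H0) as (c & p & G0).
    pose proof (gflow_base_norm _ _ _ G0 E0) as N0. pose proof rho_pos as Rp.
    destruct (cone_at_direction g0 c p H0 G0 E0 (r / 2) ltac:(lra)) as (d & T & Hd & HT).
    set (v := (2 * c * sinh 1, p 0)). set (eps := Rmin 1 (d / rho)).
    assert (He : 0 < eps). { apply Rmin_glb_lt; [lra|]. now apply Rdiv_lt_0_compat. }
    assert (Nz : v <> (0, 0)). { unfold v. intro Z. injection Z as Z1 Z2. rewrite Z1, Z2 in N0. nra. }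
    exists v, eps, (Rmax 1 T). split; auto. split; auto.
    split; [eapply Rlt_le_trans; [|apply Rmax_l]; lra|].
    assert (As : asymptotic g0 g) by (now apply Phi_eq_asymptotic).
    split.
    { simpl. exists g0. split; auto. apply (starts_in_cone_iff g0 c p); auto.
      replace (cosang v (2 * c * sinh 1) (p 0)) with 1; [rewrite acos_1; auto|].
      unfold cosang, v; cbn [fst snd]. rewrite N0, sqrt_pow2 by lra.
      replace (2 * c * sinh 1 * (2 * c * sinh 1) + p 0 * p 0) with (rho ^ 2) by (rewrite <- N0; ring).
      field. lra. }
    assert (Close : forall sg, starts_in_cone v eps sg -> geodesic sg /\ sg 0 = p0 /\
      (forall t, T <= t -> Rabs (fst (Phi0 (sg t)) - fst (Phi (Inf g))) < r / 2 /\
                         Rabs (snd (Phi0 (sg t)) - snd (Phi (Inf g))) < r / 2) /\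
       Rabs (fst (Phi (Inf sg)) - fst (Phi (Inf g))) <= r / 2 /\
       Rabs (snd (Phi (Inf sg)) - snd (Phi (Inf g))) <= r / 2).
    { intros sg Hsg. assert (Hs := Hsg). destruct Hs as (Hs & Es & _).
      destruct (geodesic_gflow sg Hs) as (c' & p' & G').
      split; auto. split; auto. rewrite <- P0.
      apply (starts_in_cone_iff sg c' p' v eps Hs G' Es) in Hsg.
      pose proof (gflow_base_norm _ _ _ G' Es) as N'.
      destruct (direction_close _ _ _ _ d Hd N0 N' Hsg) as [A1 A2].
      apply (HT sg c' p'); auto. }
    intros z' Hz' Hc. split; auto. apply HB; [now apply Phi_in|].
    destruct z' as [q|g'].
    + destruct Hc as (Far & sg & t & Ht & Eq & Hsg).
      destruct (Close sg Hsg) as (Hs & Es & Cl & _).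
      (* A point reached before time [T] would lie within distance [T] of [p0], contrary to the
         truncation. *)
      assert (HtT : T <= t).
      { apply Rnot_lt_le. intro L. apply Far. rewrite <- Eq, <- Es.
        apply dist_le_mono with t; [apply geodesic_dist; auto; lra|].
        apply Rle_trans with T; [lra|apply Rmax_r]. }
      destruct (Cl t HtT) as [B1 B2]. simpl Phi at 1 3. rewrite Eq in B1, B2.
      apply Rabs_def2 in B1, B2. nra.
    + destruct Hc as (sg & Asg & Hsg). destruct (Close sg Hsg) as (Hs & Es & _ & B1 & B2).
      apply Phi_eq_asymptotic in Asg; auto. rewrite <- Asg. apply abs_le_inv in B1, B2. nra.
Qed.

(** The direction at [p0] is an angle, so that compactness of [[- PI, PI]] applies; points and ends
    of rays are treated together. *)
Definition on_ray (al : R) (w : R * R) : Prop :=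
  exists g c p, geodesic g /\ gflow g c p /\ g 0 = p0 /\
    2 * c * sinh 1 = rho * cos al /\ p 0 = rho * sin al /\
    ((exists T, 0 < T /\ w = Phi (Pt (g T))) \/ w = Phi (Inf g)).

Lemma unit_angle x y : x ^ 2 + y ^ 2 = 1 -> exists al, - PI <= al <= PI /\ x = cos al /\ y = sin al.
Proof.
  intros E. assert (Hx : -1 <= x <= 1) by nra. pose proof (acos_bound x).
  assert (S : sin (acos x) = sqrt (1 - x ^ 2)).
  { rewrite sin_acos by auto. unfold Rsqr. f_equal. ring. }
  replace (1 - x ^ 2) with (y ^ 2) in S by lra.
  destruct (Rle_dec 0 y) as [L|L].
  - exists (acos x). split; [lra|]. rewrite cos_acos, S, sqrt_pow2; auto.
  - exists (- acos x). split; [lra|]. rewrite cos_neg, sin_neg, cos_acos, S by auto.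
    replace (y ^ 2) with ((- y) ^ 2) by ring. rewrite sqrt_pow2 by lra. split; ring.
Qed.

Lemma on_some_ray w : inD w -> w <> Phi0 p0 -> exists al, - PI <= al <= PI /\ on_ray al w.
Proof.
  intros Hw N.
  assert (R : exists g, geodesic g /\ g 0 = p0 /\ ((exists T, 0 < T /\ w = Phi (Pt (g T))) \/ w = Phi (Inf g))).
  { destruct (inD_cases w Hw) as [B|[B1 B2]].
    - destruct (geodesic_to w B) as (g & G & G0 & C). exists g. split; auto. split; auto. right.
      symmetry. now apply Phi_end.
    - destruct (geodesic_through (Psi0 w)) as (g & T & G & G0 & HT & ET).
      + now apply Psi0_Sigma.
      + intro Z. apply N. rewrite <- Z. symmetry. now apply Phi0_Psi0.
      + exists g. split; auto. split; auto. left. exists T. split; auto. rewrite ET. simpl.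
        symmetry. now apply Phi0_Psi0. }
  destruct R as (g & G & G0 & Hg). destruct (geodesic_gflow g G) as (c & p & F).
  pose proof (gflow_base_norm _ _ _ F G0) as Nm. pose proof rho_pos as Rp.
  destruct (unit_angle (2 * c * sinh 1 / rho) (p 0 / rho)) as (al & Hal & E1 & E2).
  { replace ((2 * c * sinh 1 / rho) ^ 2 + (p 0 / rho) ^ 2) with
      (((2 * c * sinh 1) ^ 2 + p 0 ^ 2) / rho ^ 2) by (field; lra). rewrite Nm. field. lra. }
  exists al. split; auto. exists g, c, p. repeat (split; auto).
  - rewrite <- E1. field. lra.
  - rewrite <- E2. field. lra.
Qed.

Lemma cosang_continuous v eps al : v <> (0, 0) -> 0 < eps ->
  acos (cosang v (rho * cos al) (rho * sin al)) < eps ->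
  exists d, 0 < d /\ forall al', Rabs (al' - al) < d ->
    acos (cosang v (rho * cos al') (rho * sin al')) < eps.
Proof.
  intros Nz He A. pose proof rho_pos as Rp.
  assert (Bd : forall x, -1 <= cosang v (rho * cos x) (rho * sin x) <= 1).
  { intro x. apply cosang_bounds; auto. pose proof (sin2_cos2 x) as Q. unfold Rsqr in Q.
    replace ((rho * cos x) ^ 2 + (rho * sin x) ^ 2) with (rho ^ 2 * (sin x * sin x + cos x * cos x)) by ring.
    rewrite Q. ring. }
  destruct (Rle_dec eps PI) as [L|L].
  - apply acos_lt_cos in A; auto.
    assert (C : continuity (fun x => cosang v (rho * cos x) (rho * sin x))).
    { apply ex_derive_continuity. intro t. unfold cosang, Rdiv. auto_derive. auto. }
    destruct (continuity_at _ al C (cosang v (rho * cos al) (rho * sin al) - cos eps) ltac:(lra))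
      as (d & Hd & Hc).
    exists d. split; auto. intros x Hx. apply acos_lt_cos; auto. specialize (Hc x Hx).
    apply Rabs_def2 in Hc. lra.
  - exists 1. split; [lra|]. intros x _. pose proof (acos_bound (cosang v (rho * cos x) (rho * sin x))). lra.
Qed.

Lemma trig_close al d : 0 < d -> exists h, 0 < h /\ forall al', Rabs (al' - al) < h ->
  Rabs (rho * cos al' - rho * cos al) < d /\ Rabs (rho * sin al' - rho * sin al) < d.
Proof.
  intros Hd.
  assert (C1 : continuity (fun x => rho * cos x)). { apply ex_derive_continuity. intro. auto_derive. auto. }
  assert (C2 : continuity (fun x => rho * sin x)). { apply ex_derive_continuity. intro. auto_derive. auto. }
  destruct (continuity_at _ al C1 d Hd) as (h1 & H1 & K1).
  destruct (continuity_at _ al C2 d Hd) as (h2 & H2 & K2).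
  exists (Rmin h1 h2). split; [now apply Rmin_glb_lt|]. intros x Hx.
  pose proof (Rmin_l h1 h2). pose proof (Rmin_r h1 h2). split; [apply K1|apply K2]; lra.
Qed.

(** At an end [w], suppose points outside [V] converge to [w]. They lie on rays from [p0] whose
    angles cluster at some [a]. The ray of angle [a] ends at [w], hence is the ray of the given
    cone, so some of those points lie in that open cone and beyond its truncation, that is in
    [V]. *)
Theorem cone_to_open V : cone_open (fun z => valid z /\ V (Phi z)) -> open_in_D V.
Proof.
  intros HC w Hw Vw. destruct (Phi_onto w Hw) as (z & Hz & Ez). subst w.
  pose proof (HC z Hz (conj Hz Vw)) as H. destruct z as [q|g].
  - destruct H as (r & Hr & HB). destruct (Phi0_interior q Hz) as [I1 I2].
    destruct (Psi0_continuous (Phi0 q) (r / 2) I1 I2 ltac:(lra)) as (d & Hd & Hc).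
    exists d. split; auto. intros w' Hw' Hn. simpl Phi in Hn.
    assert (A : Rabs (fst w' - fst (Phi0 q)) < d /\ Rabs (snd w' - snd (Phi0 q)) < d).
    { pose proof (pow2_ge_0 (fst w' - fst (Phi0 q))). pose proof (pow2_ge_0 (snd w' - snd (Phi0 q))).
      split; apply Rabs_def1; apply Rnot_le_lt; intro; nra. }
    destruct (Hc w' (proj1 A) (proj2 A)) as (J1 & J2 & B1 & B2). rewrite Psi0_Phi0 in B1, B2.
    destruct (HB (Psi0 w')) as [_ Hv].
    + now apply Psi0_Sigma.
    + apply Rabs_def2 in B1, B2. nra.
    + simpl in Hv. now rewrite Phi0_Psi0 in Hv.
  - destruct H as (v & eps & Rd & Nz & He & HR & Hin & HB).
    set (w := Phi (Inf g)) in *. apply NNPP. intro NE.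
    destruct (geodesic_end g Hz) as [_ Bd]. fold w in Bd.
    assert (P0S : in_Sigma p0) by (unfold in_Sigma, p0; cbn [snd]; lra).
    destruct (Phi0_interior p0 P0S) as [K1 K2].
    destruct (dist_far (fst w) (snd w) 1 ltac:(destruct w; auto) ltac:(lra)) as (r0 & Hr0 & Far0).
    assert (Seq : forall n : nat, exists al, - PI <= al <= PI /\ exists w', inD w' /\
       Rabs (fst w' - fst w) < / (INR n + 1) /\ Rabs (snd w' - snd w) < / (INR n + 1) /\
       ~ V w' /\ on_ray al w').
    (* The bound [r0] keeps the chosen point away from the image of [p0], which has no direction. *)
    { intro n. pose proof (pos_INR n). set (d := Rmin r0 (/ (INR n + 1))).
      assert (D1 : d <= r0) by apply Rmin_l. assert (D2 : d <= / (INR n + 1)) by apply Rmin_r.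
      assert (Hd : 0 < d) by (apply Rmin_glb_lt; [auto|apply Rinv_0_lt_compat; lra]).
      assert (exists w', inD w' /\ (fst w' - fst w) ^ 2 + (snd w' - snd w) ^ 2 < d ^ 2 /\ ~ V w')
        as (w' & Hw' & Hn & Nv).
      { apply NNPP. intro N. apply NE. exists d. split; auto. intros w' Hw' Hn. apply NNPP. intro Nv.
        apply N. now exists w'. }
      assert (A : Rabs (fst w' - fst w) < d /\ Rabs (snd w' - snd w) < d).
      { pose proof (pow2_ge_0 (fst w' - fst w)). pose proof (pow2_ge_0 (snd w' - snd w)).
        split; apply Rabs_def1; apply Rnot_le_lt; intro; nra. }
      destruct (on_some_ray w' Hw') as (al & Hal & Hr).
      { intro Z. rewrite Z in A. apply (Far0 p0 P0S); try lra.
        apply (segment_dist _ _ 1); simpl; try lra. rewrite !Rminus_eq_0, Rabs_R0. lra. }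
      exists al. split; auto. exists w'. repeat (split; auto); lra. }
    set (al := fun n => proj1_sig (constructive_indefinite_description _ (Seq n))).
    assert (Hal : forall n, - PI <= al n <= PI /\ exists w', inD w' /\
       Rabs (fst w' - fst w) < / (INR n + 1) /\ Rabs (snd w' - snd w) < / (INR n + 1) /\
       ~ V w' /\ on_ray (al n) w').
    { intro n. exact (proj2_sig (constructive_indefinite_description _ (Seq n))). }
    clearbody al.
    destruct (Bolzano_Weierstrass al (fun x => - PI <= x <= PI) (compact_P3 (- PI) PI)) as [a Ha].
    { intro n. apply Hal. }
    assert (Clu : forall h, 0 < h -> forall N, exists n, (N <= n)%nat /\ Rabs (al n - a) < h).
    { intros h Hh N. destruct (Ha (fun x => Rabs (x - a) < h) N) as (n & Hn & Hx).
      - exists (mkposreal h Hh). intros x Hx. exact Hx.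
      - now exists n. }
    pose proof rho_pos as Rp. pose proof (sinh_pos 1 ltac:(lra)) as S1.
    destruct (geodesic_with_direction (rho * cos a / (2 * sinh 1)) (rho * sin a)) as (gs & ps & Gs & Gs0 & Fs & Ps).
    { replace (2 * (rho * cos a / (2 * sinh 1)) * sinh 1) with (rho * cos a) by (field; lra).
      pose proof (sin2_cos2 a) as Q. unfold Rsqr in Q.
      replace ((rho * cos a) ^ 2 + (rho * sin a) ^ 2) with (rho ^ 2 * (sin a * sin a + cos a * cos a)) by ring.
      rewrite Q. ring. }
    set (cs := rho * cos a / (2 * sinh 1)) in *.
    assert (Ecs : 2 * cs * sinh 1 = rho * cos a) by (unfold cs; field; lra).
    assert (Far : forall M, exists N : nat, forall n, (N <= n)%nat -> forall q, in_Sigma q ->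
       Rabs (fst (Phi0 q) - fst w) < / (INR n + 1) -> Rabs (snd (Phi0 q) - snd w) < / (INR n + 1) ->
       ~ dist_le p0 q (Rmax 1 M)).
    { intro M. destruct (dist_far (fst w) (snd w) (Rmax 1 M) ltac:(destruct w; auto)) as (r & Hr & HF).
      { eapply Rlt_le_trans; [|apply Rmax_l]; lra. }
      destruct (INR_unbounded (/ r)) as [N HN]. exists N. intros n Hn q Hq A1 A2.
      apply le_INR in Hn. assert (/ (INR n + 1) < r).
      { rewrite <- (Rinv_inv r). apply Rinv_lt_contravar.
        - apply Rmult_lt_0_compat; [now apply Rinv_0_lt_compat|]. pose proof (Rinv_0_lt_compat r Hr). lra.
        - lra. }
      apply HF; auto; lra. }
    (* For a cluster index [n] the chosen point is within [e] of the end of [gs] by uniform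
       convergence, as it lies beyond time [T], and within [1 / (n + 1)] of [w]. *)
    assert (Ends : Phi (Inf gs) = w).
    { assert (Q : forall e, 0 < e -> Rabs (fst (Phi (Inf gs)) - fst w) <= 2 * e /\
         Rabs (snd (Phi (Inf gs)) - snd w) <= 2 * e).
      { intros e Hee. destruct (cone_at_direction gs cs ps Gs Fs Gs0 e Hee) as (d & T & Hd & HT).
        destruct (trig_close a d Hd) as (h & Hh & Tr).
        destruct (Far T) as (N1 & HN1). destruct (INR_unbounded (/ e)) as [N2 HN2].
        destruct (Clu h Hh (Nat.max N1 N2)) as (n & Hn & Hx).
        destruct (Hal n) as (_ & w' & Hw' & W1 & W2 & _ & g' & c' & p' & G' & F' & G0' & Ec' & Ep' & Cs).
        destruct (Tr (al n) Hx) as [T1 T2]. rewrite <- Ecs, <- Ec' in T1. rewrite <- Ps, <- Ep' in T2.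
        destruct (HT g' c' p' G' F' G0' T1 T2) as (B1 & B2 & B3).
        assert (Small : / (INR n + 1) < e).
        { assert (INR N2 <= INR n) by (apply le_INR; lia).
          rewrite <- (Rinv_inv e). pose proof (Rinv_0_lt_compat e Hee). apply Rinv_lt_contravar.
          - apply Rmult_lt_0_compat; lra.
          - lra. }
        assert (B : Rabs (fst w' - fst (Phi (Inf gs))) <= e /\ Rabs (snd w' - snd (Phi (Inf gs))) <= e).
        { destruct Cs as [(t & Ht & Ew)| ->]; [|split; auto].
          assert (Sq : in_Sigma (g' t)) by apply F'.
          assert (T <= t).
          { apply Rnot_lt_le. intro L. rewrite Ew in W1, W2. simpl Phi in W1, W2.
            apply (HN1 n ltac:(lia) (g' t) Sq W1 W2).
            apply dist_le_mono with t; [rewrite <- G0'; apply geodesic_dist; auto; lra|].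
            apply Rle_trans with T; [lra|apply Rmax_r]. }
          destruct (B1 t H) as [X1 X2]. rewrite Ew. simpl Phi at 1 3. lra. }
        destruct B as [X1 X2]. apply abs_le_inv in X1, X2. apply Rabs_def2 in W1, W2.
        split; apply Rabs_le; lra. }
      assert (Z : forall x y, (forall e, 0 < e -> Rabs (x - y) <= 2 * e) -> x = y).
      { intros x y HQ. destruct (Req_dec x y) as [|N]; auto. exfalso.
        pose proof (Rabs_pos_lt (x - y) ltac:(lra)). pose proof (HQ (Rabs (x - y) / 4) ltac:(lra)). lra. }
      rewrite (surjective_pairing (Phi (Inf gs))), (surjective_pairing w).
      f_equal; apply Z; intros e Hee; now apply Q. }
    destruct Hin as (sg & Asg & Hsg). assert (Hs := Hsg). destruct Hs as (Hs & Es & _).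
    apply Phi_eq_asymptotic in Asg; auto. fold w in Asg.
    destruct (geodesic_gflow sg Hs) as (c & p & G).
    (* Injectivity of the end in the direction puts the cluster direction inside the given cone. *)
    destruct (end_determines_direction sg c p gs cs ps w G Fs) as [Ec Ep].
    { congruence. } { rewrite <- Asg. now apply geodesic_end. } { rewrite <- Ends. now apply geodesic_end. }
    apply (starts_in_cone_iff sg c p v eps Hs G Es) in Hsg.
    rewrite Ec, Ep, Ecs, Ps in Hsg.
    destruct (cosang_continuous v eps a Nz He Hsg) as (h & Hh & Hcl).
    destruct (Far Rd) as (N1 & HN1). destruct (Clu h Hh N1) as (n & Hn & Hx).
    destruct (Hal n) as (_ & w' & Hw' & W1 & W2 & Nv & g' & c' & p' & G' & F' & G0' & Ec' & Ep' & Cs).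
    assert (St : starts_in_cone v eps g').
    { apply (starts_in_cone_iff g' c' p'); auto. rewrite Ec', Ep'. now apply Hcl. }
    apply Nv. destruct Cs as [(t & Ht & Ew)|Ew]; rewrite Ew.
    + assert (Sq : in_Sigma (g' t)) by apply F'.
      apply (HB (Pt (g' t))); [exact Sq|]. split; [|exists g', t; auto].
      intro D. rewrite Ew in W1, W2. apply (HN1 n Hn (g' t) Sq W1 W2).
      eapply dist_le_mono; [exact D|apply Rmax_r].
    + apply (HB (Inf g')); [exact G'|]. exists g'. split; auto. now apply Phi_eq_asymptotic.
Qed.

(** * The distinguished classes *)

Lemma y_infty_ascends g : geodesic g -> y_to_infty g -> exists c p, gflow g c p /\ ascends c p /\
  Phi (Inf g) = (2 * c, sqrt (lam c)).
Proof.
  intros H Y. destruct (geodesic_gflow g H) as (c & p & G).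
  destruct (up_or_down _ _ _ G) as [U|(t1 & d & xi & D)].
  - exists c, p. split; auto. split; auto. now apply Phi_end, (gflow_up_end _ _ p).
  - exfalso. exact (down_not_y_infty g xi (gflow_down_conv _ _ _ _ _ _ G D) Y).
Qed.

(** Along a ray [dx/dy = 2 c sinh y / p]. Since [c] is constant, comparison with the slope of the
    given curve at one late time identifies the ray's class. *)
Lemma eventually_on_slope g x0 f df c p : gflow g c p -> eventually_on g x0 f -> y_to_infty g ->
  (forall y : R, 0 < y -> is_derive f y (df y)) ->
  exists t, 0 <= t /\ 2 * c * sinh (snd (g t)) = df (snd (g t)) * p t.
Proof.
  intros [F Hy] [T HT] Y D. set (t := Rmax 0 T + 1).
  assert (Ht0 : 0 <= t) by (unfold t; pose proof (Rmax_l 0 T); lra).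
  assert (HtT : T < t) by (unfold t; pose proof (Rmax_r 0 T); lra).
  exists t. split; auto. pose proof (Hy t) as Hyt. pose proof (sinh_pos _ Hyt) as Hs.
  pose proof (flow_x _ _ _ _ F t) as Dx. pose proof (flow_y _ _ _ _ F t) as Dy. cbv beta in Dx, Dy.
  rewrite cosh_sq in Dy. replace (1 + sinh (snd (g t)) ^ 2 - 1) with (sinh (snd (g t)) ^ 2) in Dy by ring.
  rewrite sqrt_pow2 in Dy by lra.
  apply (is_derive_ext _ (fun t => snd (g t))) in Dy; [|intro r; now apply acosh_cosh].
  set (u := cosh (snd (g t))) in *. pose proof (srate_pos u (flow_gt1 _ _ _ _ F t)) as Hsig.
  assert (D2 : is_derive (fun t => fst (g t)) t (p t * srate u / sinh (snd (g t)) * df (snd (g t)))).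
  { apply is_derive_ext_loc with (fun t => x0 + f (snd (g t))).
    - assert (Hp : 0 < t - T) by lra. exists (mkposreal _ Hp). intros r Hr. symmetry. apply HT.
      unfold ball in Hr; simpl in Hr. unfold AbsRing_ball, abs, minus, plus, opp in Hr; simpl in Hr.
      apply Rabs_def2 in Hr. lra.
    - apply is_derive_eq with (0 + p t * srate u / sinh (snd (g t)) * df (snd (g t))); [|ring].
      apply is_derive_plus_R; [apply is_derive_const_R|].
      apply (is_derive_comp f (fun t => snd (g t)) t); auto. }
  assert (E : 2 * c * srate u = p t * srate u / sinh (snd (g t)) * df (snd (g t))).
  { rewrite <- (is_derive_unique _ _ _ Dx), <- (is_derive_unique _ _ _ D2). reflexivity. }
  apply (Rmult_eq_reg_r (srate u / sinh (snd (g t)))).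
  - transitivity (2 * c * srate u); [field; lra|]. rewrite E. field. lra.
  - apply Rgt_not_eq. now apply Rdiv_lt_0_compat.
Qed.

Lemma squash_continuity : continuity squash.
Proof.
  apply ex_derive_continuity. intro x. unfold squash, Rad. auto_derive.
  assert (0 < 1 + x * (x * 1) + 0 * (0 * 1)) by nra. pose proof (sqrt_lt_R0 _ H).
  repeat split; lra.
Qed.

Lemma vertical_end g x0 : geodesic g -> eventually_on g x0 (fun _ => 0) -> y_to_infty g ->
  Phi (Inf g) = (0, 1).
Proof.
  intros H E Y. destruct (y_infty_ascends g H Y) as (c & p & G & U & ->).
  destruct (eventually_on_slope g x0 (fun _ => 0) (fun _ => 0) c p G E Y) as (t & Ht & Et).
  { intros. apply is_derive_const_R. }
  pose proof (sinh_pos _ (proj2 G t)).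
  assert (c = 0) by nra. subst c. unfold lam.
  replace (1 - 4 * 0 ^ 2) with 1 by ring. rewrite sqrt_1. f_equal. ring.
Qed.

(** The slope [s sinh y / sqrt 3] gives [2 c sqrt 3 = s p]; squared, with the energy law, this reads
    [lam c (sinh y ^ 2 + 3) = 0]. *)
Lemma critical_end g x0 a s : geodesic g -> (s = 1 \/ s = -1) ->
  eventually_on g x0 (fun y => s * / sqrt 3 * (cosh y - cosh a)) -> y_to_infty g ->
  Phi (Inf g) = (s, 0).
Proof.
  intros H Hs E Y. destruct (y_infty_ascends g H Y) as (c & p & G & U & ->).
  pose proof sqrt3_pos as S3. pose proof sqrt3_sq as S33.
  destruct (eventually_on_slope g x0 _ (fun y => s * / sqrt 3 * sinh y) c p G E Y) as (t & Ht & Et).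
  { intros y _. apply is_derive_scal_R. apply is_derive_eq with (sinh y - 0); [|ring].
    apply is_derive_minus_R; [apply is_derive_cosh|apply is_derive_const_R]. }
  pose proof (sinh_pos _ (proj2 G t)) as Hsh. destruct U as [U1 U2].
  pose proof (flow_up_p _ _ _ _ (proj1 G) U1 U2 t) as Hp.
  pose proof (flow_energy _ _ _ _ (proj1 G) t) as En. cbv beta in En. rewrite cosh_sq in En.
  set (S := sinh (snd (g t))) in *.
  assert (E2 : 2 * c * sqrt 3 = s * p t).
  { apply (Rmult_eq_reg_r (S / sqrt 3)); [|apply Rgt_not_eq; now apply Rdiv_lt_0_compat].
    transitivity (2 * c * S); [field; lra|]. rewrite Et. field. lra. }
  assert (s2 : s * s = 1) by (destruct Hs as [-> | ->]; ring).
  assert (L : lam c = 0).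
  { assert (Q : (2 * c * sqrt 3) ^ 2 = p t ^ 2).
    { rewrite E2. replace ((s * p t) ^ 2) with (s * s * p t ^ 2) by ring. rewrite s2. ring. }
    replace ((2 * c * sqrt 3) ^ 2) with (4 * c ^ 2 * (sqrt 3 * sqrt 3)) in Q by ring.
    rewrite S33 in Q. unfold lam in *. nra. }
  rewrite L, sqrt_0. f_equal. unfold lam in L. destruct Hs as [-> | ->]; nra.
Qed.

Lemma is_derive_Fm a m y : 0 < m ^ 2 * sinh a ^ 2 - 3 ->
  is_derive (Fm a m) y (sqrt (3 + sinh a ^ 2) * sinh y /
    sqrt ((m ^ 2 * sinh a ^ 2 - 3) * cosh y ^ 2 + 3 * cosh a ^ 2 + 2 * m ^ 2 * sinh a ^ 2)).
Proof.
  intros HB. unfold Fm. set (A := sqrt (3 + sinh a ^ 2)). set (B2 := m ^ 2 * sinh a ^ 2 - 3) in *.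
  set (B := sqrt B2). assert (Bp : 0 < B) by (now apply sqrt_lt_R0).
  assert (EB : B * B = B2) by (apply sqrt_sqrt; lra).
  set (K := 3 * cosh a ^ 2 + 2 * m ^ 2 * sinh a ^ 2).
  assert (HK : 0 < K).
  { unfold K. pose proof (cosh_ge_1 a). assert (3 < m ^ 2 * sinh a ^ 2) by (unfold B2 in HB; lra). nra. }
  pose proof (cosh_ge_1 y) as Cy.
  set (R := fun y => B2 * cosh y ^ 2 + 3 * cosh a ^ 2 + 2 * m ^ 2 * sinh a ^ 2).
  assert (ER : forall y, R y = B2 * cosh y ^ 2 + K) by (intro; unfold R, K; ring).
  assert (HR : 0 < R y). { rewrite ER. assert (0 < B2 * cosh y ^ 2) by (apply Rmult_lt_0_compat; nra). lra. }
  set (W := sqrt (R y)). assert (HW : 0 < W) by (now apply sqrt_lt_R0).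
  assert (DR : is_derive R y (B2 * (2 * cosh y * sinh y))).
  { unfold R. auto_derive; auto. ring. }
  assert (DW : is_derive (fun y => sqrt (R y)) y (B2 * cosh y * sinh y / W)).
  { apply is_derive_eq with (B2 * (2 * cosh y * sinh y) * / (2 * sqrt (R y))).
    - apply (is_derive_comp sqrt R); auto. apply is_derive_Reals. now apply derivable_pt_lim_sqrt.
    - fold W. field. lra. }
  assert (Arg : 0 < B2 * cosh y + B * W).
  { assert (0 < B2 * cosh y) by (apply Rmult_lt_0_compat; lra). nra. }
  apply is_derive_eq with (A / B * ((B2 * sinh y + B * (B2 * cosh y * sinh y / W)) / (B2 * cosh y + B * W))).
  - apply (is_derive_scal_R (fun y => ln (B2 * cosh y + B * sqrt (R y)))).
    apply (is_derive_ln_comp (fun y => B2 * cosh y + B * sqrt (R y))); auto.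
    apply is_derive_plus_R; [apply (is_derive_scal_R cosh), is_derive_cosh|].
    apply (is_derive_scal_R (fun y => sqrt (R y))), DW.
  - fold (R y). fold W. rewrite <- EB in *. field.
    repeat split; try lra.
Qed.

(** With [A], [B] the two roots in the formula for [tan theta] and [D ^ 2 = A ^ 2 + B ^ 2], the
    slope of the curve yields [2 c = s A / D] and [sqrt (lam c) = B / D], which are the cosine and
    sine of [theta]. *)
Lemma oblique_end g x0 a m s theta : geodesic g -> 0 < a -> sqrt 3 / sinh a < m ->
  (s = 1 \/ s = -1) -> eventually_on g x0 (fun y => s * (Fm a m y - Fm a m a)) -> y_to_infty g ->
  0 < theta < PI -> theta <> PI / 2 ->
  tan theta = s * sqrt (m ^ 2 * sinh a ^ 2 - 3) / sqrt (3 + sinh a ^ 2) ->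
  Phi (Inf g) = (cos theta, sin theta).
Proof.
  intros H Ha Hm Hs E Y Hth Nth Tn. destruct (y_infty_ascends g H Y) as (c & p & G & U & ->).
  pose proof sqrt3_pos as S3. pose proof sqrt3_sq as S33. pose proof (sinh_pos a Ha) as Sa.
  assert (Hms : sqrt 3 < m * sinh a).
  { apply (Rmult_lt_compat_r (sinh a)) in Hm; auto.
    replace (sqrt 3 / sinh a * sinh a) with (sqrt 3) in Hm by (field; lra). auto. }
  assert (HB : 0 < m ^ 2 * sinh a ^ 2 - 3).
  { replace (m ^ 2 * sinh a ^ 2) with ((m * sinh a) ^ 2) by ring. nra. }
  set (B2 := m ^ 2 * sinh a ^ 2 - 3) in *. set (A2 := 3 + sinh a ^ 2) in *.
  assert (HA : 0 < A2) by (unfold A2; nra).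
  set (A := sqrt A2) in *. set (B := sqrt B2) in *.
  assert (Ap : 0 < A) by (now apply sqrt_lt_R0). assert (Bp : 0 < B) by (now apply sqrt_lt_R0).
  assert (EA : A * A = A2) by (apply sqrt_sqrt; lra). assert (EB : B * B = B2) by (apply sqrt_sqrt; lra).
  set (Rt := fun y => B2 * cosh y ^ 2 + 3 * cosh a ^ 2 + 2 * m ^ 2 * sinh a ^ 2).
  destruct (eventually_on_slope g x0 _ (fun y => s * (A * sinh y / sqrt (Rt y))) c p G E Y) as (t & Ht & Et).
  { intros y _. apply is_derive_scal_R.
    apply is_derive_eq with (A * sinh y / sqrt (Rt y) - 0); [|ring].
    apply is_derive_minus_R; [|apply is_derive_const_R]. now apply is_derive_Fm. }
  pose proof (sinh_pos _ (proj2 G t)) as Hsh. destruct U as [U1 U2].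
  pose proof (flow_up_p _ _ _ _ (proj1 G) U1 U2 t) as Hp.
  pose proof (flow_energy _ _ _ _ (proj1 G) t) as En. cbv beta in En. rewrite cosh_sq in En.
  set (S := sinh (snd (g t))) in *.
  (* In this form the squared slope equation and the energy law share the factor [S ^ 2 + 3], which
     cancels and leaves [4 c ^ 2 (A2 + B2) = A2]. *)
  assert (ER : Rt (snd (g t)) = (A2 + B2) * (S ^ 2 + 3) - A2 * S ^ 2).
  { unfold Rt. rewrite !cosh_sq. fold S. unfold A2, B2. ring. }
  set (W2 := Rt (snd (g t))) in *.
  assert (HW2 : 0 < W2).
  { rewrite ER. assert (0 < B2 * (S ^ 2 + 3)) by (apply Rmult_lt_0_compat; nra). nra. }
  set (W := sqrt W2) in *. assert (Wp : 0 < W) by (now apply sqrt_lt_R0).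
  assert (EW : W * W = W2) by (apply sqrt_sqrt; lra).
  assert (E2 : 2 * c * W = s * A * p t).
  { apply (Rmult_eq_reg_r (S / W)); [|apply Rgt_not_eq; now apply Rdiv_lt_0_compat].
    transitivity (2 * c * S); [field; lra|]. rewrite Et. field. lra. }
  assert (s2 : s * s = 1) by (destruct Hs as [-> | ->]; ring).
  assert (Q : 4 * c ^ 2 * (A2 + B2) = A2).
  { assert (Q1 : (2 * c * W) ^ 2 = A2 * p t ^ 2).
    { rewrite E2. replace ((s * A * p t) ^ 2) with (s * s * (A * A) * p t ^ 2) by ring.
      rewrite s2, EA. ring. }
    replace ((2 * c * W) ^ 2) with (4 * c ^ 2 * (W * W)) in Q1 by ring.
    rewrite EW, ER, En in Q1. unfold lam in Q1.
    apply (Rmult_eq_reg_r (S ^ 2 + 3)); [|nra]. nra. }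
  set (D := sqrt (A2 + B2)). assert (Dp : 0 < D) by (apply sqrt_lt_R0; lra).
  assert (ED : D * D = A2 + B2) by (apply sqrt_sqrt; lra).
  (* Squaring determines [2 c] up to sign; [p > 0] gives it the sign of [s]. *)
  assert (Ec : 2 * c = s * A / D).
  { assert (Sg : 0 < s * c).
    { assert (0 < s * c * (2 * W)); [|nra].
      replace (s * c * (2 * W)) with (s * (2 * c * W)) by ring. rewrite E2.
      replace (s * (s * A * p t)) with (s * s * (A * p t)) by ring. rewrite s2. nra. }
    apply (Rmult_eq_reg_r D); [|lra]. replace (s * A / D * D) with (s * A) by (field; lra).
    assert ((2 * c * D) ^ 2 = (s * A) ^ 2).
    { replace ((2 * c * D) ^ 2) with (4 * c ^ 2 * (D * D)) by ring.
      replace ((s * A) ^ 2) with (s * s * (A * A)) by ring. rewrite ED, s2, EA. lra. }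
    assert (Z : (2 * c * D - s * A) * (2 * c * D + s * A) = 0).
    { transitivity ((2 * c * D) ^ 2 - (s * A) ^ 2); [ring|lra]. }
    apply Rmult_integral in Z. destruct Z as [Z|Z]; [lra|exfalso].
    assert (0 < s * c * D) by (apply Rmult_lt_0_compat; auto).
    assert (s * (2 * c * D + s * A) = 2 * (s * c * D) + s * s * A) by ring.
    rewrite Z, s2 in H2. lra. }
  assert (El : sqrt (lam c) = B / D).
  { replace (lam c) with ((B / D) ^ 2).
    - apply sqrt_pow2. left. now apply Rdiv_lt_0_compat.
    - replace ((B / D) ^ 2) with (B * B / (D * D)) by (field; lra). rewrite EB, ED.
      apply (Rmult_eq_reg_r (A2 + B2)); [|lra]. replace (B2 / (A2 + B2) * (A2 + B2)) with B2 by (field; lra).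
      unfold lam. lra. }
  assert (Hsin : 0 < sin theta) by (apply sin_gt_0; lra).
  assert (Hcos : cos theta <> 0).
  { intro Z. apply Nth. destruct (Rtotal_order theta (PI / 2)) as [L|[L|L]]; auto; exfalso.
    - pose proof (cos_gt_0 theta ltac:(lra) L). lra.
    - pose proof (cos_lt_0 theta L ltac:(lra)). lra. }
  assert (T2 : sin theta * A = s * B * cos theta).
  { unfold tan in Tn. apply (f_equal (fun z => z * (cos theta * A))) in Tn.
    replace (sin theta / cos theta * (cos theta * A)) with (sin theta * A) in Tn by (field; auto).
    rewrite Tn. field. lra. }
  pose proof (sin2_cos2 theta) as SC. unfold Rsqr in SC.
  assert (ES : sin theta = B / D).
  { assert (Hq : (sin theta * D) ^ 2 = B ^ 2).
    { replace ((sin theta * D) ^ 2) with (sin theta * sin theta * (D * D)) by ring. rewrite ED, <- EA, <- EB.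
      assert ((sin theta * A) * (sin theta * A) = B * B * (cos theta * cos theta)).
      { rewrite T2. replace (s * B * cos theta * (s * B * cos theta)) with (s * s * (B * B * (cos theta * cos theta))) by ring.
        rewrite s2. ring. }
      replace (sin theta * sin theta * (A * A + B * B)) with
        (sin theta * A * (sin theta * A) + B * B * (sin theta * sin theta)) by ring.
      rewrite H0. transitivity (B * B * (sin theta * sin theta + cos theta * cos theta)); [ring|].
      rewrite SC. ring. }
    (* Both sides are positive because [theta] is between 0 and [PI]. *)
    assert (sin theta * D = B).
    { apply Rsqr_inj; [left; now apply Rmult_lt_0_compat|lra|]. unfold Rsqr. simpl in Hq. lra. }
    rewrite <- H0. field. lra. }
  assert (ECo : cos theta = s * A / D).
  { assert (B * cos theta = s * (sin theta * A)).
    { rewrite T2. replace (s * (s * B * cos theta)) with (s * s * (B * cos theta)) by ring. rewrite s2. ring. }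
    apply (Rmult_eq_reg_l B); [|lra]. rewrite H0, ES. field. lra. }
  rewrite Ec, El, ES, ECo. reflexivity.
Qed.

Theorem theorem3p3 :
  exists Phi : cpt -> R * R,
    (* Phi is a bijection of Sigma u S_oo(Sigma) onto D *)
    (forall z, valid z -> inD (Phi z)) /\
    (forall w, inD w -> exists z, valid z /\ Phi z = w) /\
    (forall z1 z2, valid z1 -> valid z2 -> (Phi z1 = Phi z2 <-> same z1 z2)) /\
    (* Phi is a homeomorphism (cone topology vs. Euclidean topology of D) *)
    (forall V : R * R -> Prop,
        open_in_D V <-> cone_open (fun z => valid z /\ V (Phi z))) /\
    (* S_oo(Sigma) corresponds to the boundary of D *)
    (forall z, valid z -> (is_inf z <-> bdD (Phi z))) /\
    (* (1) *)
    (exists h : R -> R,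
        continuity h /\ (forall s1 s2, h s1 = h s2 -> s1 = s2) /\
        (forall u, -1 < u < 1 <-> exists xi, h xi = u) /\
        forall g, geodesic g ->
          (forall xi, conv_to g (xi, 0) -> Phi (Inf g) = (h xi, 0)) /\
          (snd (Phi (Inf g)) = 0 -> -1 < fst (Phi (Inf g)) < 1 ->
             exists xi, conv_to g (xi, 0))) /\
    (* (2) *)
    (forall g x0, geodesic g -> eventually_on g x0 (fun _ => 0) -> y_to_infty g ->
        Phi (Inf g) = (0, 1)) /\
    (* (3) *)
    (forall g x0 a (s : R), geodesic g -> 0 < a -> (s = 1 \/ s = -1) ->
        eventually_on g x0 (fun y => s * / sqrt 3 * (cosh y - cosh a)) ->
        y_to_infty g ->
        Phi (Inf g) = (s, 0)) /\
    (* (4) *)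
    (forall g x0 a m (s : R), geodesic g -> 0 < a -> sqrt 3 / sinh a < m ->
        (s = 1 \/ s = -1) ->
        eventually_on g x0 (fun y => s * (Fm a m y - Fm a m a)) ->
        y_to_infty g ->
        forall theta, 0 < theta < PI -> theta <> PI / 2 ->
          tan theta = s * sqrt (m ^ 2 * sinh a ^ 2 - 3) / sqrt (3 + sinh a ^ 2) ->
          Phi (Inf g) = (cos theta, sin theta)).
Proof.
  exists Phi. split; [exact Phi_in|]. split; [exact Phi_onto|]. split; [exact Phi_same|].
  split; [split; [apply open_to_cone|apply cone_to_open]|]. split; [exact Phi_bd|].
  split; [|split; [exact vertical_end|split]].
  - exists squash. split; [exact squash_continuity|]. split; [exact squash_inj|]. split.
    + intro u. split; [apply squash_onto|]. intros [xi <-]. apply squash_bounds.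
    + intros g H. split.
      * intros xi C. now apply Phi_end, conv_to_Phi0.
      * intros E0 E1. destruct (geodesic_gflow g H) as (c & p & G).
        destruct (up_or_down _ _ _ G) as [U|(t1 & d & xi & D)].
        -- exfalso. rewrite (Phi_end _ _ (gflow_up_end _ _ _ G U)) in E0, E1. cbn [fst snd] in E0, E1.
           assert (L : 0 < lam c) by (unfold lam; nra). pose proof (sqrt_lt_R0 _ L). lra.
        -- exists xi. exact (gflow_down_conv _ _ _ _ _ _ G D).
  - intros g x0 a s H _. now apply critical_end.
  - intros g x0 a m s H Ha Hm Hs E Y theta Ht Nt Tn. now apply (oblique_end g x0 a m s theta).
Qed.
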